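(* Let $L>2\pi\sqrt{\frac{\sqrt5}{\sqrt5-1}}$ be fixed and consider $c\in\left(0,\frac12\sqrt{5-\frac{L^4}{(L^2-4\pi^2)^2}}\right)$. Let $\phi=\phi_c$ be the $L$-periodic dnoidal wave defined in the context. The operator $$\mathcal L_1=-(5-4c^2)\partial_x^2+(1-c^2)-3\phi^2-5\phi^4,$$ defined in $L^2_{per}([0,L])$ with domain $H^2_{per}([0,L])$, has a unique negative eigenvalue, which is simple, and zero is a simple eigenvalue with eigenfunction $\phi'$. Moreover, the remainder of the spectrum of $\mathcal L_1$ is constituted by a discrete set of eigenvalues bounded away from zero.
   Context: $L^2_{per}([0,L])$ and $H^2_{per}([0,L])$ are the $L$-periodic Lebesgue and Sobolev spaces. Let $r=1-c^2$, $s=5-4c^2$. For $\alpha_4\in\left(\frac{-1+\sqrt{1+4r}}2,\frac{-3+\sqrt{9+48r}}4\right)$ put $\beta=-4\alpha_4^2-4\alpha_4+3+16r$, $\alpha_1=\frac{-2\alpha_4-3-\sqrt3\sqrt\beta}4$, $\alpha_3=\frac{-2\alpha_4-3+\sqrt3\sqrt\beta}4$ (so $\alpha_1<0<\alpha_3<\alpha_4$), $k\in(0,1)$ with $k^2=\frac{-\alpha_1(\alpha_4-\alpha_3)}{\alpha_4(\alpha_3-\alpha_1)}$, and $$\phi(x)=\frac{\sqrt{\alpha_4}\,\mathrm{dn}(\gamma x,k)}{\sqrt{1+\frac{\alpha_4k^2}{-\alpha_1}\mathrm{sn}^2(\gamma x,k)}},\quad\gamma=\sqrt{\frac{\alpha_4(\alpha_3-\alpha_1)}{3s}},\quad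 T(\alpha_4,c)=\frac{2\sqrt{3s}\,K(k)}{\sqrt{\alpha_4(\alpha_3-\alpha_1)}},$$ with Jacobi elliptic functions $\mathrm{sn},\mathrm{dn}$ of modulus $k$ and $K(k)=\int_0^1\frac{dt}{\sqrt{(1-k^2t^2)(1-t^2)}}$. For $L,c$ as in the claim, $\phi_c$ is the function $\phi$ for the unique $\alpha_4\in\left(\frac{-1+\sqrt{1+4r}}2,\frac{-3+\sqrt{9+48r}}4\right)$ with $T(\alpha_4,c)=L$; it has fundamental period $L$ and solves $-\phi''+\frac rs\phi-\frac1s(\phi^3+\phi^5)=0$. *)

(* Defs.v *)
From HB Require Import structures.
From mathcomp Require Import all_boot all_order all_algebra.
From mathcomp Require Import all_classical all_reals all_analysis.
From mathcomp Require Import complex.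
Set Implicit Arguments.
Unset Strict Implicit.
Unset Printing Implicit Defensive.
Import Order.TTheory GRing.Theory Num.Theory.
Import numFieldNormedType.Exports.
Local Open Scope classical_set_scope.
Local Open Scope complex_scope.
Local Open Scope ring_scope.

Section JacobiElliptic.
Context {R : realType}.
Implicit Types k theta u : R.

Definition elliptic_K k : R :=
  \int[lebesgue_measure]_(t in `[0, 1])
    (Num.sqrt ((1 - k ^+ 2 * t ^+ 2) * (1 - t ^+ 2)))^-1.

(* The oriented integral from 0 to theta. *)
Definition elliptic_F k theta : R :=
  let g (t : R) := (Num.sqrt (1 - k ^+ 2 * sin t ^+ 2))^-1 in
  if 0 <= theta then \int[lebesgue_measure]_(t in `[0, theta]) g t
  else - \int[lebesgue_measure]_(t in `[theta, 0]) g t.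

(* For 0 < k < 1, elliptic_F k is an increasing bijection of R and am is its
   inverse; the functions below are meaningful for such k only. *)
Definition jacobi_am u k : R := get [set theta | elliptic_F k theta = u].
Definition jacobi_sn u k : R := sin (jacobi_am u k).
Definition jacobi_dn u k : R := Num.sqrt (1 - k ^+ 2 * jacobi_sn u k ^+ 2).

End JacobiElliptic.

Section DnoidalWave.
Context {R : realType}.
Implicit Types c a x : R.

Definition rc c : R := 1 - c ^+ 2.
Definition sc c : R := 5 - 4 * c ^+ 2.

Definition admissible c a : Prop :=
  (-1 + Num.sqrt (1 + 4 * rc c)) / 2 < a
  /\ a < (-3 + Num.sqrt (9 + 48 * rc c)) / 4.

Definition betac c a : R := -4 * a ^+ 2 - 4 * a + 3 + 16 * rc c.
Definition alpha1 c a : R :=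
  (-2 * a - 3 - Num.sqrt 3 * Num.sqrt (betac c a)) / 4.
Definition alpha3 c a : R :=
  (-2 * a - 3 + Num.sqrt 3 * Num.sqrt (betac c a)) / 4.

Definition modulus c a : R :=
  Num.sqrt (- alpha1 c a * (a - alpha3 c a)
            / (a * (alpha3 c a - alpha1 c a))).

Definition gammac c a : R :=
  Num.sqrt (a * (alpha3 c a - alpha1 c a) / (3 * sc c)).

Definition wave_period c a : R :=
  2 * Num.sqrt (3 * sc c) * elliptic_K (modulus c a)
  / Num.sqrt (a * (alpha3 c a - alpha1 c a)).

Definition dnoidal c a x : R :=
  let k := modulus c a in
  let u := gammac c a * x in
  Num.sqrt a * jacobi_dn u k
  / Num.sqrt (1 + a * k ^+ 2 / (- alpha1 c a) * jacobi_sn u k ^+ 2).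

End DnoidalWave.

(* Functions are defined on the whole line and L-periodic; elements of
   L^2_per are represented by functions, equality in L^2_per being equality
   almost everywhere. *)
Section PeriodicSpaces.
Context {R : realType}.
Variable L : R.
Implicit Types (f g : R -> R[i]) (u v psi : R -> R).

Definition re_part f : R -> R := fun x => complex.Re (f x).
Definition im_part f : R -> R := fun x => complex.Im (f x).

Definition ae_equal f g : Prop :=
  {ae (@lebesgue_measure R), forall x, f x = g x}.

Definition sqnorm f : \bar R :=
  (\int[lebesgue_measure]_(x in `[0%R, L])
     ((re_part f x) ^+ 2 + (im_part f x) ^+ 2)%:E)%E.

Definition L2per f : Prop :=
  [/\ periodic f L,
      measurable_fun setT (re_part f),
      measurable_fun setT (im_part f) &
      (sqnorm f < +oo)%E].

Definition L2norm f : R := Num.sqrt (fine (sqnorm f)).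

Definition test_function psi : Prop :=
  periodic psi L /\ forall (n : nat) (x : R), derivable (derive1n n psi) x 1.

Definition weak_derivative_real u v : Prop :=
  forall psi, test_function psi ->
    \int[lebesgue_measure]_(x in `[0, L]) (u x * derive1 psi x)
    = - \int[lebesgue_measure]_(x in `[0, L]) (v x * psi x).

Definition weak_derivative f g : Prop :=
  weak_derivative_real (re_part f) (re_part g) /\ weak_derivative_real (im_part f) (im_part g).

Definition H2per_derivatives f f1 f2 : Prop :=
  [/\ L2per f, L2per f1, L2per f2,
      weak_derivative f f1 & weak_derivative f1 f2].

(* An unbounded operator in L^2_per is given by its graph: A f g means that f
   is in the domain and that g represents the image of f. *)
Definition op_graph := (R -> R[i]) -> (R -> R[i]) -> Prop.

Section Spectrum.
Variable A : op_graph.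

Definition eigenfunction (z : R[i]) f : Prop :=
  A f (fun x => z * f x) /\ ~ ae_equal f (fun=> 0).

Definition eigenvalue_of (z : R[i]) : Prop := exists f, eigenfunction z f.

Definition simple_eigenvalue_with (z : R[i]) f : Prop :=
  eigenfunction z f /\
  forall g, A g (fun x => z * g x) ->
    exists a : R[i], ae_equal g (fun x => a * f x).

Definition simple_eigenvalue (z : R[i]) : Prop :=
  exists f, simple_eigenvalue_with z f.

(* A - z is a bijection from the domain onto L^2_per with bounded inverse;
   injectivity is contained in the norm estimate. *)
Definition resolvent_set : set R[i] := [set z |
  (exists M : R, forall f g, A f g ->
     L2norm f <= M * L2norm (fun x => g x - z * f x)) /\
  (forall h, L2per h ->
     exists f g, A f g /\ ae_equal (fun x => g x - z * f x) h)].

Definition spectrum : set R[i] := ~` resolvent_set.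

End Spectrum.

(* The operator - s d^2/dx^2 + V with domain H^2_per. *)
Definition schrodinger (s : R) (V : R -> R) : op_graph := fun f g =>
  exists f1 f2, H2per_derivatives f f1 f2 /\ L2per g /\
    ae_equal g (fun x => - s%:C * f2 x + (V x)%:C * f x).

End PeriodicSpaces.

Definition L1op {R : realType} (L c : R) (phi : R -> R) : op_graph :=
  schrodinger L (sc c) (fun x => rc c - 3 * phi x ^+ 2 - 5 * phi x ^+ 4).

(* Main.v *)
Require Import Defs.
From HB Require Import structures.
From mathcomp Require Import all_boot all_order all_algebra.
From mathcomp Require Import all_classical all_reals all_analysis.
From mathcomp Require Import measurable_realfun complex ring lra.
Set Implicit Arguments.
Unset Strict Implicit.
Unset Printing Implicit Defensive.
Import Order.TTheory GRing.Theory Num.Theory.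
Import numFieldNormedType.Exports.
Local Open Scope classical_set_scope.
Local Open Scope ring_scope.

(* The wave oscillates between its maximum at 0 and its minimum at the half period l, and
   p = phi' together with an explicit second solution u spans the kernel of the differential
   expression -s y'' + V y.  Since V is even about 0 and about l, an eigenfunction of the
   periodic problem splits into one satisfying Neumann conditions and one satisfying Dirichlet
   conditions on [0, l].  As p < 0 on (0, l), Picone's identity shows that the Dirichlet
   eigenvalues are nonnegative, with 0 simple and lowest; the signs of u and u' at the endpoints
   give a negative Neumann eigenvalue and exclude both a second one and the value 0.  Gronwall
   estimates bound the distance of two eigenvalues of the same type from below.

   In L^2, weak derivatives are primitives almost everywhere because the test functions contain
   the trigonometric polynomials.  Hence (A - z) f = h is a linear system for f and
   f' + (1/s) int h with continuous data and periodic conditions up to a prescribed jump.  By the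
   Fredholm alternative for the increments over a period, z is an eigenvalue or in the resolvent
   set, and the monotonicity of Im(f' conj(f)) for nonreal z makes the eigenvalues real. *)

(** * One-variable calculus *)

Section Derivatives.
Context {R : realType}.
Implicit Types (f g h : R -> R) (x a b c d : R).

(** The delicate point is the sign of [u1 l]. Up to a positive factor u is the derivative of the
    wave in alpha4 at fixed c, and [u1 l < 0] amounts to the period growing with alpha4; a closed
    form of u avoids differentiating elliptic integrals. With Y = phi^2 put u = A(phi) - tau p, tau'
    = B(phi), A a polynomial; then [u1 l] is - tau(l) p'(l), and its sign follows once B is
    pointwise positive. To A one may add multiples of s phi p^2 / (Y + 3/2 + x3 + a), a polynomial
    in phi by the energy identity: this leaves u unchanged and alters B by an exact derivative. The
    freedom is used to make B positive, which becomes the positivity of a polynomial with positive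
    coefficients in x3, Y - x3 and a - Y. On the half period, each comparison is the monotonicity of
    one explicit function whose endpoint values have a known sign, so neither Floquet theory nor
    quadratic forms on Sobolev spaces enter. Discreteness comes from the two types: among three
    eigenvalues close together, two have the same type. *)

Definition has_der x f d : Prop := is_derive x (1 : R) f d.

Lemma der_eq x f a b : has_der x f a -> a = b ->
  has_der x f b.
Proof. by move=> df <-. Qed.

Lemma derC x c : has_der x (fun=> c) 0.
Proof. exact: is_derive_cst. Qed.
Lemma derX x : has_der x (fun t => t) 1.
Proof. exact: is_derive_id. Qed.
Lemma derD x f g a b : has_der x f a -> has_der x g b ->
  has_der x (fun t => f t + g t) (a + b).
Proof. by move=> df dg; exact: is_deriveD. Qed.
Lemma derN x f a : has_der x f a ->
  has_der x (fun t => - f t) (- a).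
Proof. by move=> df; exact: is_deriveN. Qed.
Lemma derM x f g a b : has_der x f a -> has_der x g b ->
  has_der x (fun t => f t * g t) (a * g x + f x * b).
Proof.
move=> df dg; apply: (is_derive_eq (is_deriveM df dg)).
by rewrite /GRing.scale /= addrC [g x * _]mulrC.
Qed.
Lemma derXn x f n a : has_der x f a ->
  has_der x (fun t => f t ^+ n) (n%:R * f x ^+ n.-1 * a).
Proof.
move=> df; have -> : (fun t => f t ^+ n) = f ^+ n by apply/funext => t; rewrite exprfctE.
exact: is_deriveX.
Qed.
Lemma derV x f a : has_der x f a -> f x != 0 ->
  has_der x (fun t => (f t)^-1) (- a / f x ^+ 2).
Proof.
move=> df f0; have D := @is_deriveV R f x a 1 f0 df.
apply: (der_eq D).
by rewrite /GRing.scale /= mulNr mulrC -mulNr.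
Qed.
Lemma derComp x f g a b : has_der (g x) f a -> has_der x g b ->
  has_der x (fun t => f (g t)) (a * b).
Proof.
by move=> df dg; exact: (is_derive1_comp df dg).
Qed.

Lemma der_cont x f a : has_der x f a -> {for x, continuous f}.
Proof.
move=> df; apply: differentiable_continuous; apply/derivable1_diffP.
by case: df.
Qed.

Lemma der_sum (n : nat) (h : 'I_n -> R -> R) (dh : 'I_n -> R) x :
  (forall i, has_der x (h i) (dh i)) ->
  has_der x (fun t => \sum_i h i t) (\sum_i dh i).
Proof.
move=> H; have := is_derive_sum H; congr is_derive.
by apply/funext => t; rewrite fct_sumE.
Qed.

Lemma der_sin x : has_der x sin (cos x).
Proof. exact: is_derive_sin. Qed.
Lemma der_cos x : has_der x cos (- sin x).
Proof. exact: is_derive_cos. Qed.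
Lemma der_expR x : has_der x expR (expR x).
Proof. exact: is_derive_expR. Qed.

Lemma der_sqrt x f a : has_der x f a -> 0 < f x ->
  has_der x (fun t => Num.sqrt (f t)) (a / (2 * Num.sqrt (f x))).
Proof.
move=> df f0; rewrite mulrC; apply: (@derComp x Num.sqrt f) => //.
exact: is_derive1_sqrt.
Qed.

Lemma der_uniq x f a b : has_der x f a -> has_der x f b -> a = b.
Proof. by move=> [_ <-] [_ <-]. Qed.

Lemma der_derive1 x f a : has_der x f a -> derive1 f x = a.
Proof. by move=> [_ <-]; rewrite derive1E. Qed.

Lemma der_near x f g a : (\forall t \near x, f t = g t) ->
  has_der x f a -> has_der x g a.
Proof. by move=> fg; apply: near_eq_is_derive => //; exact: oner_neq0. Qed.

Lemma derChain x f g a b : has_der x g b -> has_der (g x) f a ->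
  has_der x (fun t => f (g t)) (a * b).
Proof. by move=> dg df; exact: derComp. Qed.

Lemma contD f g x : {for x, continuous f} -> {for x, continuous g} ->
  {for x, continuous (fun t => f t + g t)}.
Proof. by move=> cf cg; exact: (@continuousD _ _ _ f g). Qed.
Lemma contN f x : {for x, continuous f} -> {for x, continuous (fun t => - f t)}.
Proof. by move=> cf; exact: (@continuousN _ _ _ f). Qed.
Lemma contB f g x : {for x, continuous f} -> {for x, continuous g} ->
  {for x, continuous (fun t => f t - g t)}.
Proof. by move=> cf cg; exact: (@continuousB _ _ _ f g). Qed.
Lemma contM f g x : {for x, continuous f} -> {for x, continuous g} ->
  {for x, continuous (fun t => f t * g t)}.
Proof. by move=> cf cg; exact: (@continuousM _ _ f g). Qed.
Lemma contC c x : {for x, continuous (fun=> c : R)}.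
Proof. exact: cst_continuous. Qed.
Lemma contXn f n x : {for x, continuous f} -> {for x, continuous (fun t => f t ^+ n)}.
Proof.
move=> cf; elim: n => [|n ih]; first exact: contC.
have -> : (fun t => f t ^+ n.+1) = (fun t => f t * f t ^+ n).
  by apply/funext => t; rewrite exprS.
exact: contM.
Qed.

End Derivatives.

(** The derivative is found by unification from the shape of the function; [der_eq] then leaves an
    algebraic identity between the value found and the value wanted. *)
Ltac der_step := first
  [ eassumption
  | match goal with
    | H : forall x, has_der x ?f _ |- has_der _ ?f _ => exact: H
    | H : forall x, has_der x _ _ |- _ => solve [apply: H]
    end
  | exact: derX | exact: derC
  | eapply derD | eapply derN | eapply derM
  | eapply derXn | exact: der_sin | exact: der_cos | exact: der_expR
  | eapply derV | eapply der_sqrt ].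
Ltac der := repeat der_step.

(** * Monotonicity, quotients at a common zero, Gronwall *)

Section Monotone.
Context {R : realType}.
Implicit Types (f g h : R -> R) (x a b c d : R).

Lemma seg_cont f a b : (forall x, a <= x <= b -> {for x, continuous f}) ->
  {within `[a, b], continuous f}.
Proof.
move=> H; apply: continuous_in_subspaceT => x.
by rewrite inE /= in_itv /=; exact: H.
Qed.

Lemma mean_value f df a b : a < b ->
  (forall x, a <= x <= b -> {for x, continuous f}) ->
  (forall x, a < x < b -> has_der x f (df x)) ->
  exists2 c, a < c < b & f b - f a = df c * (b - a).
Proof.
move=> ab cf H.
have [c cab E] : exists2 c, c \in `]a, b[ & f b - f a = df c * (b - a).
  by apply: MVT => //; exact: seg_cont.
by exists c => //; move: cab; rewrite in_itv.
Qed.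

Lemma mono_le f df a b : a <= b ->
  (forall x, a <= x <= b -> {for x, continuous f}) ->
  (forall x, a < x < b -> has_der x f (df x)) ->
  (forall x, a < x < b -> 0 <= df x) -> f a <= f b.
Proof.
rewrite le_eqVlt => /predU1P[-> //|ab] cf H pos.
have [c cab E] := mean_value ab cf H.
by rewrite -subr_ge0 E mulr_ge0 ?pos// subr_ge0 ltW.
Qed.

Lemma mono_lt f df a b : a < b ->
  (forall x, a <= x <= b -> {for x, continuous f}) ->
  (forall x, a < x < b -> has_der x f (df x)) ->
  (forall x, a < x < b -> 0 < df x) -> f a < f b.
Proof.
move=> ab cf H pos.
have [c cab E] := mean_value ab cf H.
by rewrite -subr_gt0 E mulr_gt0 ?pos// subr_gt0.
Qed.

Lemma antider_le f df a b : a <= b ->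
  (forall x, a <= x <= b -> has_der x f (df x)) ->
  (forall x, a < x < b -> 0 <= df x) -> f a <= f b.
Proof.
move=> ab H pos; apply: (@mono_le _ df) => // x xab.
  exact: der_cont (H x xab).
by apply: H; case/andP: xab => /ltW -> /ltW ->.
Qed.

Lemma antider_lt f df a b : a < b ->
  (forall x, a <= x <= b -> has_der x f (df x)) ->
  (forall x, a < x < b -> 0 < df x) -> f a < f b.
Proof.
move=> ab H pos; apply: (@mono_lt _ df) => // x xab.
  exact: der_cont (H x xab).
by apply: H; case/andP: xab => /ltW -> /ltW ->.
Qed.

Lemma der0_cst f a b : a <= b ->
  (forall x, a <= x <= b -> has_der x f 0) -> f a = f b.
Proof.
move=> ab H; apply/eqP; rewrite eq_le; apply/andP; split.
  exact: (@antider_le f (fun=> 0)).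
rewrite -lerN2; apply: (@antider_le (fun t => - f t) (fun=> 0)) => // x xab.
by apply: der_eq; [exact/derN/H|rewrite oppr0].
Qed.

Lemma antider_uniq f g df : f 0 = g 0 ->
  (forall x, has_der x f (df x)) ->
  (forall x, has_der x g (df x)) -> f = g.
Proof.
move=> fg0 Hf Hg; apply/funext => x; apply/eqP; rewrite -subr_eq0.
have D y : has_der y (fun t => f t - g t) 0.
  by apply: der_eq; [exact: derD (Hf y) (derN (Hg y))|rewrite subrr].
have [x0|x0] := leP 0 x.
  by rewrite -(der0_cst x0 (fun y _ => D y)) fg0 subrr.
by rewrite (der0_cst (ltW x0) (fun y _ => D y)) fg0 subrr.
Qed.

Lemma antider_eq f g df x : f 0 = g 0 ->
  (forall x, has_der x f (df x)) -> (forall x, has_der x g (df x)) -> f x = g x.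
Proof. by move=> fg df' dg; rewrite (antider_uniq fg df' dg). Qed.

(* Junk values make [h * (f / g)] continuous at a common simple zero. *)
Lemma quot_cont f g h a (u v : R) : has_der a f u -> has_der a g v ->
  f a = 0 -> g a = 0 -> v != 0 -> {for a, continuous h} -> h a = 0 ->
  {for a, continuous (fun x => h x * (f x / g x))}.
Proof.
move=> df dg fa ga v0 ch ha.
(* Caratheodory: a function differentiable at its zero [a] is x - a times a function continuous at
   [a], whose value there is the derivative. The factors x - a then cancel in the quotient. *)
have [F [cF EF Fa]] : exists F, [/\ {for a, continuous F}, (forall x, f x = (x - a) * F x) & F a = u].
  have [k [kE ck ka]] := (is_derive1_caratheodory f a u).1 df.
  by exists k; split => // x; have := kE x; rewrite fa subr0 mulrC.
have [G [cG EG Ga]] : exists F, [/\ {for a, continuous F}, (forall x, g x = (x - a) * F x) & F a = v].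
  have [k [kE ck ka]] := (is_derive1_caratheodory g a v).1 dg.
  by exists k; split => // x; have := kE x; rewrite ga subr0 mulrC.
have E : (fun x => h x * (f x / g x)) = (fun x => h x * (F x / G x)).
  apply/funext => x; rewrite EF EG; have [->|xa] := eqVneq x a.
    by rewrite ha !mul0r.
  have xa0 : x - a != 0 by rewrite subr_eq0.
  by rewrite -mulf_div divff// mul1r.
rewrite E; apply: continuousM => //; apply: continuousM => //.
by apply: continuousV => //; rewrite Ga.
Qed.

(** The function B t - E t exp(-K t) is nondecreasing, its derivative being at least B (1 - exp(-K
    t)). *)
Lemma gronwall (E dE : R -> R) (K B X : R) : 0 <= K -> 0 <= B ->
  (forall x, 0 <= x <= X -> has_der x E (dE x)) ->
  (forall x, 0 <= x <= X -> dE x <= K * E x + B) ->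
  forall x, 0 <= x <= X -> E x <= (E 0 + B * x) * expR (K * x).
Proof.
move=> K0 B0 dEE le x /andP[x0 xX].
pose f t := B * t - E t * expR (- K * t).
pose df t := B - (dE t * expR (- K * t) + E t * (- K * expR (- K * t))).
have : f 0 <= f x.
  apply: (@antider_le _ df) => [//|t /andP[t0 tx]|t /andP[t0 tx]].
    have tX : 0 <= t <= X by rewrite t0 (le_trans tx).
    have dt := dEE t tX.
    have d1 : has_der t (fun t => expR (- K * t)) (- K * expR (- K * t)).
      apply: der_eq; first by apply: derComp; [exact: der_expR|der].
      by rewrite /=; ring.
    apply: der_eq; first by der.
    by rewrite /df /=; ring.
  have tX : 0 <= t <= X by rewrite (ltW t0) (le_trans (ltW tx)).
  rewrite /df.
  have e1 : expR (- K * t) <= 1.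
    by rewrite -[leRHS](@expR0 R) ler_expR mulNr oppr_le0 mulr_ge0 // ltW.
  have e0 := expR_gt0 (- K * t).
  have := le t tX; nra.
rewrite /f !mulr0 expR0 mulr1 sub0r => H.
have e0 := expR_gt0 (K * x).
have e1 : expR (- K * x) * expR (K * x) = 1.
  by rewrite -expRD mulNr addNr expR0.
rewrite -[leLHS]mulr1 -e1 mulrA ler_pM2r //.
by move: H; lra.
Qed.

End Monotone.

(** * Primitives of continuous functions *)

Section Primitive.
Context {R : realType}.
Notation mu := (@lebesgue_measure R).
Implicit Types (f g h : R -> R) (x a b c d : R).

(** Oriented in the same way as [elliptic_F], so that [elliptic_F k] is convertible to [prim] of its
    integrand. *)
Definition prim f x : R :=
  if 0 <= x then \int[mu]_(t in `[0, x]) f t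
  else - \int[mu]_(t in `[x, 0]) f t.

Lemma cont_integrable f a b : continuous f -> mu.-integrable `[a, b] (EFin \o f).
Proof.
move=> cf; apply: continuous_compact_integrable; first exact: segment_compact.
exact: continuous_subspaceT.
Qed.

Lemma prim0 f : prim f 0 = 0.
Proof. by rewrite /prim lexx set_itv1 Rintegral_set1. Qed.

Lemma Rintegral_split f a b c : a <= b -> b <= c ->
  mu.-integrable `[a, c] (EFin \o f) ->
  \int[mu]_(t in `[a, c]) f t = \int[mu]_(t in `[a, b]) f t + \int[mu]_(t in `[b, c]) f t.
Proof.
move=> ab bc fi.
have := @Rintegral_itvB R f (BLeft a) (BRight c) b fi.
rewrite !bnd_simp => /(_ ab bc) /eqP; rewrite subr_eq => /eqP ->.
rewrite addrC; congr (_ + _); apply: Rintegral_itv_obnd_cbnd.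
by apply: integrableS fi => //; apply: subset_itv; rewrite bnd_simp.
Qed.

Lemma primE f a x : continuous f -> a <= x -> a <= 0 ->
  prim f x = \int[mu]_(t in `[a, x]) f t - \int[mu]_(t in `[a, 0]) f t.
Proof.
move=> cf ax a0; rewrite /prim; case: leP => x0.
  by rewrite (Rintegral_split a0 x0 (cont_integrable a x cf)) addrAC subrr add0r.
rewrite (Rintegral_split ax (ltW x0) (cont_integrable a 0 cf)).
by rewrite opprD addrA subrr add0r.
Qed.

Lemma prim_der f x : continuous f -> has_der x (prim f) (f x).
Proof.
(* A base point to the left of both x and 0: the fundamental theorem applies to the integral from
   [a], from which [prim f] differs by a constant near x. *)
move=> cf; pose a := Num.min (x - 1) (-1).
have ax : a < x by rewrite /a gt_min ltrBlDr ltrDl ltr01.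
have a0 : a <= 0 by rewrite /a ge_min lerN10 orbT.
have := @continuous_FTC1_closed R f a x (x + 1).
rewrite ltrDl => /(_ ltr01 (cont_integrable _ _ cf) ax (cf x)) [dF dFE].
have D : has_der x (fun y => \int[mu]_(t in `[a, y]) f t - \int[mu]_(t in `[a, 0]) f t) (f x).
  apply: der_eq; first by apply: derD; [split; [exact: dF|reflexivity]|exact: derC].
  by rewrite addr0 -dFE derive1E.
apply: der_near D; near=> t; rewrite (@primE f a)//.
by apply/ltW; near: t; exact: lt_nbhsr.
Unshelve. all: by end_near. Qed.

Lemma prim_cont f : continuous f -> continuous (prim f).
Proof. by move=> cf x; exact: der_cont (prim_der x cf). Qed.

Lemma prim_antider f F : continuous f -> (forall x, has_der x F (f x)) ->
  forall x, prim f x = F x - F 0.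
Proof.
move=> cf dF x; have -> : prim f = (fun x => F x - F 0); last by [].
apply: (antider_uniq (df := f)).
- by rewrite prim0 subrr.
- by move=> y; exact: prim_der.
- by move=> y; apply: der_eq; [exact: derD (dF y) (derC _ _)|rewrite addr0].
Qed.

(** Integration reproduces the weight exp(B |x|) with the factor 1 / B; this makes Picard iteration
    contract on the whole line. The comparison [aux] serves for both signs of x and of the
    primitive. *)
Lemma prim_bound f A B : 0 <= A -> 0 < B -> continuous f ->
  (forall t, `|f t| <= A * expR (B * `|t|)) ->
  forall x, `|prim f x| <= A / B * expR (B * `|x|).
Proof.
move=> A0 B0 cf le x.
have aux (F f' : R -> R) y : 0 <= y -> F 0 = 0 ->
    (forall t, has_der t F (f' t)) ->
    (forall t, 0 <= t -> `|f' t| <= A * expR (B * t)) ->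
    F y <= A / B * expR (B * y).
  move=> y0 F0 dF leF.
  pose k t := A / B * expR (B * t) - F t.
  have : k 0 <= k y.
    apply: (@antider_le _ _ (fun t => A * expR (B * t) - f' t)) => [//|t tE|t tE].
      have d1 : has_der t (fun t => expR (B * t)) (B * expR (B * t)).
        apply: der_eq; first by apply: derComp; [exact: der_expR|der].
        by rewrite /=; ring.
      rewrite /k; apply: der_eq; first by der.
      by rewrite /=; field; rewrite gt_eqF.
    rewrite subr_ge0; apply: le_trans (leF t _) => //; first exact: ler_norm.
    by case/andP: tE => /ltW.
  rewrite /k F0 mulr0 expR0 mulr1 subr0 => H.
  have : 0 <= A / B by rewrite divr_ge0 // ltW.
  by move: H; lra.
have [x0|x0] := leP 0 x.
  rewrite (ger0_norm x0) ler_norml; apply/andP; split; last first.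
    apply: (@aux _ f) => //; first exact: prim0.
      by move=> t; exact: prim_der.
    by move=> t t0; have := le t; rewrite (ger0_norm t0).
  rewrite lerNl; apply: (@aux (fun t => - prim f t) (fun t => - f t)) => //.
  - by rewrite prim0 oppr0.
  - by move=> t; exact: derN (prim_der _ cf).
  - by move=> t t0; have := le t; rewrite normrN (ger0_norm t0).
rewrite (ltr0_norm x0); have Nx0 : 0 <= - x by rewrite oppr_ge0 ltW.
have dN t : has_der t (fun t => prim f (- t)) (- f (- t)).
  apply: der_eq; first by apply: derComp; [exact: prim_der|der].
  by rewrite mulrN1.
rewrite ler_norml; apply/andP; split; last first.
  rewrite -[X in prim f X]opprK.
  apply: (@aux (fun t => prim f (- t)) (fun t => - f (- t))) => //.
    by rewrite oppr0 prim0.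
  by move=> t t0; have := le (- t); rewrite !normrN (ger0_norm t0).
rewrite lerNl -[X in prim f X]opprK.
apply: (@aux (fun t => - prim f (- t)) (fun t => f (- t))) => //.
- by rewrite oppr0 prim0 oppr0.
- by move=> t; apply: der_eq; [exact: derN (dN t)|rewrite opprK].
- by move=> t t0; have := le (- t); rewrite !normrN (ger0_norm t0).
Qed.

End Primitive.

Ltac neq0 := repeat (apply/andP; split); first [assumption | by apply: lt0r_neq0; lra | by apply: ltr0_neq0; lra].

(** * Linear systems of differential equations *)

Section LinearODE.
Context {R : realType}.

(** The intervals of radius 2 c / 2^k around u k are nested, and the supremum of their left ends
    lies in all of them. *)
Lemma geometric_limit (u : nat -> R) (c : R) : 0 <= c ->
  (forall k, `|u k.+1 - u k| <= c * 2^-1 ^+ k) ->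
  exists l, forall k, `|u k - l| <= 2 * c * 2^-1 ^+ k.
Proof.
move=> c0 H.
pose lo k := u k - 2 * c * 2^-1 ^+ k.
pose hi k := u k + 2 * c * 2^-1 ^+ k.
have lohi k : lo k <= hi k.
  have : 0 <= 2^-1 ^+ k :> R by rewrite exprn_ge0.
  by rewrite /lo /hi; nra.
have loS k : lo k <= lo k.+1.
  by have := H k; rewrite /lo exprS ler_norml => /andP[]; lra.
have hiS k : hi k.+1 <= hi k.
  by have := H k; rewrite /hi exprS ler_norml => /andP[]; lra.
have loD j k : lo k <= lo (k + j)%N.
  by elim: j => [|j ih]; rewrite ?addn0// addnS (le_trans ih).
have hiD j k : hi (k + j)%N <= hi k.
  by elim: j => [|j ih]; rewrite ?addn0// addnS (le_trans (hiS _)).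
have le j k : lo j <= hi k.
  by rewrite (le_trans (loD k j))// (le_trans (lohi _))// addnC hiD.
exists (sup (range lo)) => k.
have H1 : lo k <= sup (range lo).
  apply: ub_le_sup; last by exists k.
  by exists (hi 0%N) => _ [j _ <-]; exact: le.
have H2 : sup (range lo) <= hi k.
  by apply: ge_sup; [exists (lo 0%N), 0%N|move=> _ [j _ <-]; exact: le].
by move: H1 H2; rewrite /lo /hi ler_norml => ? ?; apply/andP; split; lra.
Qed.

Lemma le_geometric0 (x c : R) : (forall k, x <= c * 2^-1 ^+ k) -> x <= 0.
Proof.
move=> H; rewrite leNgt; apply/negP => x0.
have c0 : 0 < c by have := H 0%N; rewrite expr0 mulr1; exact: lt_le_trans.
have [k] : exists k, c / x < 2 ^+ k.
  exists (Num.truncn (c / x)).+1.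
  have := truncnS_gt (c / x); move/lt_le_trans; apply.
  by rewrite -natrX ler_nat ltnW // ltn_expl.
rewrite ltr_pdivrMr // => Hk.
have := H k; rewrite exprVn leNgt => /negP; apply.
by rewrite ltr_pdivrMr ?exprn_gt0 // mulrC.
Qed.

Lemma sum_ord_le (n : nat) (F : 'I_n -> R) c : (forall j, F j <= c) ->
  \sum_j F j <= n%:R * c.
Proof.
by move=> H; rewrite mulr_natl -[n in _ *+ n]card_ord -sumr_const ler_sum.
Qed.

Variable n : nat.
Implicit Types (M : 'I_n -> 'I_n -> R -> R) (b Y : 'I_n -> R -> R).

Definition ode_at M b Y x := forall i, has_der x (Y i) (\sum_j M i j x * Y j x + b i x).

Section Exists.
Variables (M : 'I_n -> 'I_n -> R -> R) (b : 'I_n -> R -> R) (m beta : R).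
Hypothesis cM : forall i j, continuous (M i j).
Hypothesis cb : forall i, continuous (b i).
Hypothesis bM : forall i j t, `|M i j t| <= m.
Hypothesis bb : forall i t, `|b i t| <= beta.

Fixpoint picard (a : 'I_n -> R) (k : nat) : 'I_n -> R -> R :=
  if k is k'.+1 then
    fun i x => a i + prim (fun t => \sum_j M i j t * picard a k' j t + b i t) x
  else fun i _ => a i.

Lemma cont_lin Y i : (forall j, continuous (Y j)) ->
  continuous (fun t => \sum_j M i j t * Y j t).
Proof.
move=> cY x.
have -> : (fun t => \sum_j M i j t * Y j t) = \sum_j (fun t => M i j t * Y j t).
  by apply/funext => t; rewrite fct_sumE.
elim/big_ind : _ => [|f g cf cg|j _].
- exact: contC.
- exact: (contD cf cg).
- exact: (contM (@cM i j x) (cY j x)).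
Qed.

Lemma cont_field Y i : (forall j, continuous (Y j)) ->
  continuous (fun t => \sum_j M i j t * Y j t + b i t).
Proof. by move=> cY x; exact: (contD (@cont_lin Y i cY x) (@cb i x)). Qed.

Lemma prim_field_sub Y Z i x : (forall j, continuous (Y j)) -> (forall j, continuous (Z j)) ->
  prim (fun t => \sum_j M i j t * Y j t + b i t) x - prim (fun t => \sum_j M i j t * Z j t + b i t) x =
  prim (fun t => \sum_j M i j t * (Y j t - Z j t)) x.
Proof.
move=> cY cZ.
have cf : continuous (fun t => \sum_j M i j t * (Y j t - Z j t)).
  by apply: (@cont_lin (fun j t => Y j t - Z j t)) => j t; exact: (contB (@cY j t) (@cZ j t)).
rewrite (@prim_antider _ _ (fun x => prim (fun t => \sum_j M i j t * Y j t + b i t) x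
  - prim (fun t => \sum_j M i j t * Z j t + b i t) x) cf) ?prim0 ?subrr ?subr0 // => t.
apply: (der_eq (derD (prim_der t (@cont_field Y i cY)) (derN (prim_der t (@cont_field Z i cZ))))).
by rewrite opprD addrACA subrr addr0 -sumrB; apply: eq_bigr => j _; rewrite mulrBr.
Qed.

Lemma picard_cont a k i : continuous (picard a k i).
Proof.
elim: k i => [|k ih] i x /=; first exact: contC.
by apply: contD; [exact: contC|apply/prim_cont/cont_field].
Qed.

(** Distances are weighted by exp(2 K |x|) with K = n m + 1. One Picard step multiplies them by at
    most n m / (2 K) <= 1/2, so the bounded coefficients give a solution on the whole line without
    continuation. *)
Lemma ode_exists (a : 'I_n -> R) :
  exists Y, (forall i, Y i 0 = a i) /\ forall x, ode_at M b Y x.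
Proof.
(* An index is needed to read [0 <= m] and [0 <= beta] off the bounds; for n = 0 every family is a
   solution. *)
case: (pselect (exists i : 'I_n, True)) => [[i0 _]|nI]; last first.
  exists (fun i _ => a i); split => // x i.
  by case: nI; exists i.
have m0 : 0 <= m by apply: le_trans (bM i0 i0 0).
have beta0 : 0 <= beta by apply: le_trans (bb i0 0).
pose K := n%:R * m + 1.
have K0 : 0 < K by rewrite ltr_wpDl // mulr_ge0.
pose S := \sum_i `|a i|.
have aS i : `|a i| <= S.
  by rewrite /S (bigD1 i) //= lerDl sumr_ge0.
have S0 : 0 <= S by apply: le_trans (aS i0).
pose C := (n%:R * (m * S) + beta) / K.
have C0 : 0 <= C by rewrite divr_ge0 ?(ltW K0)// addr_ge0 // !mulr_ge0.
pose w (x : R) := expR (2 * K * `|x|).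
have w1 x : 1 <= w x.
  by rewrite -[leLHS](@expR0 R) ler_expR mulr_ge0 // mulr_ge0 // ltW.
have K20 : 0 < 2 * K by rewrite mulr_gt0.
pose Y_ := picard a.
have cY_ k i : continuous (Y_ k i) by exact: picard_cont.
have step k i x : `|Y_ k.+1 i x - Y_ k i x| <= C * 2^-1 ^+ k * w x.
  elim: k i x => [|k ih] i x.
    rewrite expr0 mulr1 /Y_ /= addrAC subrr add0r.
    apply: (@le_trans _ _ ((n%:R * (m * S) + beta) / (2 * K) * w x)).
      apply: prim_bound => //.
      - by rewrite addr_ge0 // !mulr_ge0.
      - by apply: cont_field => j t; exact: contC.
      move=> t; apply: (@le_trans _ _ (n%:R * (m * S) + beta)); last first.
        by rewrite ler_peMr ?w1 // addr_ge0 // !mulr_ge0.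
      apply: le_trans (ler_normD _ _) _; apply: lerD => //.
      apply: le_trans (ler_norm_sum _ _ _) _.
      by apply: sum_ord_le => j; rewrite normrM ler_pM.
    apply: ler_wpM2r; first exact: (le_trans ler01).
    rewrite /C invfM; apply: ler_wpM2l; first by rewrite addr_ge0 // !mulr_ge0.
    by apply: ler_piMl; [rewrite invr_ge0 ltW|lra].
  have -> : Y_ k.+2 i x - Y_ k.+1 i x =
      prim (fun t => \sum_j M i j t * (Y_ k.+1 j t - Y_ k j t)) x.
    by rewrite -(prim_field_sub _ _ (cY_ k.+1) (cY_ k)) /Y_ /= opprD addrACA subrr add0r.
  apply: (@le_trans _ _ (n%:R * (m * (C * 2^-1 ^+ k)) / (2 * K) * w x)).
    have Ck : 0 <= C * 2^-1 ^+ k by rewrite mulr_ge0 // exprn_ge0.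
    apply: prim_bound => //.
    - by rewrite mulr_ge0 // mulr_ge0.
    - apply: (@cont_lin (fun j t => Y_ k.+1 j t - Y_ k j t)) => j t.
      exact: (contB (cY_ k.+1 j t) (cY_ k j t)).
    move=> t; apply: le_trans (ler_norm_sum _ _ _) _.
    rewrite -[leRHS]mulrA; apply: sum_ord_le => j.
    by rewrite normrM -mulrA ler_pM // ih.
  apply: ler_wpM2r; first exact: (le_trans ler01).
  rewrite exprS invfM.
  have -> : n%:R * (m * (C * 2^-1 ^+ k)) * (2^-1 * K^-1) =
     (n%:R * m / K) * (C * (2^-1 * 2^-1 ^+ k)) by ring.
  apply: ler_piMl; first by rewrite mulr_ge0 // mulr_ge0 // exprn_ge0.
  by rewrite ler_pdivrMr // mul1r /K lerDl.
have step' i x k : `|Y_ k.+1 i x - Y_ k i x| <= (C * w x) * 2^-1 ^+ k.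
  by rewrite mulrAC; exact: step.
have Cw0 x : 0 <= C * w x by rewrite mulr_ge0 // (le_trans ler01).
pose Y i x := projT1 (cid (geometric_limit (Cw0 x) (step' i x))).
have YE i x k : `|Y_ k i x - Y i x| <= 2 * (C * w x) * 2^-1 ^+ k.
  by rewrite /Y; case: cid.
have cY i : continuous (Y i).
  move=> x; apply/cvgrPdist_le => e e0.
  (* On the ball of radius 1 about x the weight is at most [W], so the iterates converge uniformly
     there and a continuous iterate transfers its continuity within three times e / 3. *)
  pose W := expR (2 * K * (`|x| + 1)).
  have W0 : 0 < W by exact: expR_gt0.
  have [k kE] : exists k, 2 * (C * W) * 2^-1 ^+ k <= e / 3.
    apply: contrapT => /forallNP Hk.
    have : e / 3 <= 0.
      apply: (@le_geometric0 _ (2 * (C * W))) => k.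
      by apply: ltW; rewrite ltNge; apply/negP; exact: Hk.
    by apply/negP; rewrite -ltNge divr_gt0.
  have /cvgrPdist_le/(_ (e / 3)) := cY_ k i x.
  rewrite divr_gt0 // => /(_ isT) near_k.
  near=> t.
  have wt s : `|s| <= `|x| + 1 -> `|Y_ k i s - Y i s| <= e / 3.
    move=> s1; apply: le_trans (YE i s k) (le_trans _ kE).
    rewrite ler_wpM2r ?exprn_ge0 // ler_wpM2l // ler_wpM2l //.
    by rewrite ler_expR ler_pM2l.
  have -> : Y i x - Y i t = (Y i x - Y_ k i x) + (Y_ k i x - Y_ k i t) + (Y_ k i t - Y i t).
    by ring.
  have -> : e = e / 3 + e / 3 + e / 3 by field.
  apply: le_trans (ler_normD _ _) _; apply: lerD; last first.
    apply: wt; rewrite -[t](addrNK x) (le_trans (ler_normD _ _)) // addrC lerD2l.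
    by rewrite distrC; near: t; apply: cvgr_dist_le.
  apply: le_trans (ler_normD _ _) _; apply: lerD; last by near: t.
  by rewrite distrC; apply: wt; rewrite lerDl.
exists Y.
have YI i x : Y i x = a i + prim (fun t => \sum_j M i j t * Y j t + b i t) x.
  apply/eqP; rewrite -subr_eq0 -normr_le0.
  pose D := 2 * (C * w x) + n%:R * (m * (2 * C)) / (2 * K) * w x.
  apply: (@le_geometric0 _ D) => k.
  have -> : Y i x - (a i + prim (fun t => \sum_j M i j t * Y j t + b i t) x) =
     (Y i x - Y_ k.+1 i x) +
     prim (fun t => \sum_j M i j t * (Y_ k j t - Y j t)) x.
    by rewrite -(prim_field_sub _ _ (cY_ k) cY) /Y_ /=; ring.
  rewrite mulrDl; apply: le_trans (ler_normD _ _) _; apply: lerD.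
    rewrite distrC; apply: le_trans (YE i x k.+1) _.
    rewrite ler_wpM2l //; first by rewrite mulr_ge0.
    by rewrite exprS ler_piMl ?exprn_ge0 //; lra.
  apply: (@le_trans _ _ (n%:R * (m * (2 * C * 2^-1 ^+ k)) / (2 * K) * w x)); last first.
    by rewrite le_eqVlt; apply/orP; left; apply/eqP; ring.
  have Ck : 0 <= 2 * C * 2^-1 ^+ k by rewrite mulr_ge0 ?exprn_ge0 // mulr_ge0.
  apply: prim_bound => //.
  - by rewrite mulr_ge0 // mulr_ge0.
  - apply: (@cont_lin (fun j t => Y_ k j t - Y j t)) => j t.
    exact: (contB (cY_ k j t) (cY j t)).
  move=> t; apply: le_trans (ler_norm_sum _ _ _) _.
  rewrite -[leRHS]mulrA; apply: sum_ord_le => j; rewrite normrM -[leRHS]mulrA ler_pM //.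
  by apply: le_trans (YE j t k) _; rewrite -/(w t) le_eqVlt; apply/orP; left; apply/eqP; ring.
split=> [i|x i]; first by rewrite YI prim0 addr0.
have D : has_der x (fun x => a i + prim (fun t => \sum_j M i j t * Y j t + b i t) x)
    (\sum_j M i j x * Y j x + b i x).
  apply: der_eq; first by apply: derD; [exact: derC|apply: prim_der; exact: cont_field].
  by rewrite add0r.
have -> // : Y i = (fun x => a i + prim (fun t => \sum_j M i j t * Y j t + b i t) x).
by apply/funext => t; exact: YI.
Unshelve. all: by end_near. Qed.

End Exists.

(** * A priori bounds and periodic boundary values *)

Section Gronwall.
Variables (M : 'I_n -> 'I_n -> R -> R) (m X : R).
Hypothesis bM : forall i j t, `|M i j t| <= m.

Lemma ode_le b Y (B : R) : 0 <= m ->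
  (forall x, 0 <= x <= X -> ode_at M b Y x) ->
  (forall i x, 0 <= x <= X -> `|b i x| <= B) ->
  forall x, 0 <= x <= X ->
  \sum_i Y i x ^+ 2 <= (\sum_i Y i 0 ^+ 2 + n%:R * B ^+ 2 * x) * expR ((2 * n%:R * m + 1) * x).
Proof.
move=> m0 odeY bb x xX.
pose dE x := \sum_i 2 * Y i x * (\sum_j M i j x * Y j x + b i x).
apply: (@gronwall _ (fun x => \sum_i Y i x ^+ 2) dE _ _ X) => //.
- by rewrite addr_ge0 // !mulr_ge0.
- by rewrite mulr_ge0 // sqr_ge0.
- move=> t tX; apply: der_sum => i; apply: der_eq; first exact: derXn (odeY t tX i).
  by rewrite expr1.
move=> t tX; rewrite /dE.
apply: (@le_trans _ _ (\sum_i (\sum_j m * (Y i t ^+ 2 + Y j t ^+ 2) + (Y i t ^+ 2 + B ^+ 2)))).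
  apply: ler_sum => i _; rewrite mulrDr mulr_sumr; apply: lerD.
    apply: ler_sum => j _.
    have := bM i j t; rewrite ler_norml => /andP[m1 m2].
    set y := Y i t; set z := Y j t.
    have h1 : 0 <= (m - M i j t) * (y + z) ^+ 2 by rewrite mulr_ge0 ?sqr_ge0 // subr_ge0.
    have h2 : 0 <= (m + M i j t) * (y - z) ^+ 2.
      by rewrite mulr_ge0 ?sqr_ge0 // -lerBlDl sub0r.
    by nra.
  have := bb i t tX; rewrite ler_norml => /andP[m1 m2].
  set y := Y i t; set z := b i t.
  have h1 : 0 <= (y - z) ^+ 2 by rewrite sqr_ge0.
  have h2 : 0 <= (B - z) * (B + z) by apply: mulr_ge0; rewrite ?subr_ge0 // -lerBlDl sub0r.
  by nra.
have sum_const (c : R) : \sum_(k < n) c = n%:R * c.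
  by rewrite sumr_const card_ord mulr_natl.
have ring_id (E N : R) :
    m * (N * E + N * E) + (E + N * B ^+ 2) = (2 * N * m + 1) * E + N * B ^+ 2 by ring.
rewrite big_split /= big_split /= sum_const -ring_id lerD2r.
under eq_bigr do rewrite -mulr_sumr big_split /= sum_const.
by rewrite -mulr_sumr big_split /= sum_const -mulr_sumr.
Qed.

(** The constant is fixed before the data [b] and the solution; this uniformity is what finally
    bounds the inverse of A - z. *)
Lemma ode_bounded : 0 <= m -> 0 <= X -> exists2 C, 0 <= C & forall b Y (B : R), 0 <= B ->
  (forall x, 0 <= x <= X -> ode_at M b Y x) ->
  (forall i x, 0 <= x <= X -> `|b i x| <= B) ->
  (forall i, `|Y i 0| <= B) ->
  forall i x, 0 <= x <= X -> `|Y i x| <= C * B.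
Proof.
move=> m0 X0; pose K := 2 * n%:R * m + 1.
have K0 : 0 <= K by rewrite addr_ge0 // !mulr_ge0.
pose D := n%:R * (1 + X) * expR (K * X).
have D0 : 0 <= D.
  by rewrite mulr_ge0 ?expR_ge0 // mulr_ge0 // addr_ge0.
exists (Num.sqrt D) => [|b Y B B0 odeY bb Y0 i x xX]; first exact: sqrtr_ge0.
rewrite -ler_sqr ?nnegrE ?mulr_ge0 ?sqrtr_ge0 // exprMn sqr_sqrtr // real_normK ?num_real //.
apply: (@le_trans _ _ (\sum_i Y i x ^+ 2)).
  by rewrite (bigD1 i) //= lerDl sumr_ge0 // => j _; exact: sqr_ge0.
apply: le_trans (ode_le m0 odeY bb xX) _; rewrite -/K.
case/andP: xX => x0 xX.
have -> : D * B ^+ 2 = (n%:R * B ^+ 2 + n%:R * B ^+ 2 * X) * expR (K * X).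
  by rewrite /D; ring.
have nB : 0 <= n%:R * B ^+ 2 by rewrite mulr_ge0 // sqr_ge0.
apply: ler_pM.
- rewrite addr_ge0 //; last by rewrite mulr_ge0.
  by rewrite sumr_ge0 // => j _; exact: sqr_ge0.
- exact: expR_ge0.
- apply: lerD; last by rewrite ler_wpM2l.
  apply: sum_ord_le => j; rewrite -[Y j 0 ^+ 2]real_normK ?num_real //.
  by rewrite ler_sqr ?nnegrE.
- by rewrite ler_expR ler_wpM2l.
Qed.

Hypothesis cM : forall i j, continuous (M i j).

(* Fredholm alternative for the [X]-periodic boundary value problem: the rows of
   [T] are the increments over [0, X] of the solutions starting at the unit vectors. *)
Lemma ode_fredholm : 0 <= m -> 0 <= X ->
  (forall Y, (forall x, ode_at M (fun _ _ => 0) Y x) ->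
     (forall i, Y i X = Y i 0) -> forall i, Y i 0 = 0) ->
  (forall b beta (d : 'I_n -> R), (forall i, continuous (b i)) ->
     (forall i t, `|b i t| <= beta) ->
     exists Z, (forall x, ode_at M b Z x) /\ forall i, Z i X = Z i 0 + d i) /\
  (exists2 C, 0 <= C & forall b Z (d : 'I_n -> R) (B : R), 0 <= B ->
     (forall x, 0 <= x <= X -> ode_at M b Z x) ->
     (forall i, Z i X = Z i 0 + d i) ->
     (forall i x, 0 <= x <= X -> `|b i x| <= B) ->
     (forall i, `|d i| <= B) ->
     forall i x, 0 <= x <= X -> `|Z i x| <= C * B).
Proof.
move=> m0 X0 nonper.
have c0 (i : 'I_n) : continuous (fun _ : R => 0 : R) by move=> x; exact: contC.
have [E EP] : exists E : 'I_n -> 'I_n -> R -> R, forall k,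
    (forall i, E k i 0 = (k == i)%:R) /\ forall x, ode_at M (fun _ _ => 0) (E k) x.
  have ex k := @ode_exists M (fun _ _ => 0) m 0 cM c0 bM
    (fun _ _ => eq_ind_r (fun y => y <= 0) (lexx 0) (normr0 _)) (fun i => (k == i)%:R).
  by exists (fun k => projT1 (cid (ex k))) => k; case: cid.
have E0 k i : E k i 0 = (k == i)%:R by have [+ _] := EP k; exact.
have odeE k x : ode_at M (fun _ _ => 0) (E k) x by have [_ +] := EP k; exact.
pose T : 'M[R]_n := \matrix_(k, i) (E k i X - (k == i)%:R).
pose comb (v : 'rV[R]_n) i x := \sum_k v 0 k * E k i x.
have odeC v x : ode_at M (fun _ _ => 0) (comb v) x.
  move=> i; rewrite /comb; apply: der_eq.
    apply: der_sum => k; exact: derM (derC _ _) (odeE k x i).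
  rewrite addr0; under [RHS]eq_bigr do rewrite mulr_sumr.
  rewrite exchange_big /=; apply: eq_bigr => k _.
  rewrite mul0r add0r addr0 mulr_sumr; apply: eq_bigr => j _; ring.
have comb0 v i : comb v i 0 = v 0 i.
  rewrite /comb (bigD1 i) //= E0 eqxx mulr1 big1 ?addr0 // => k ki.
  by rewrite E0 (negbTE ki) mulr0.
have combX v i : comb v i X = comb v i 0 + (v *m T) 0 i.
  rewrite comb0 mxE.
  under [X in _ = _ + X]eq_bigr do rewrite mxE mulrBr.
  rewrite sumrB -/(comb v i X).
  have -> : \sum_(j < n) v 0 j * (j == i)%:R = v 0 i.
    by rewrite -comb0 /comb; apply: eq_bigr => k _; rewrite E0.
  by rewrite addrC subrK.
(* A row vector killed by [T] is the initial value of a periodic homogeneous solution, hence zero by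
   hypothesis. *)
have Tu : T \in unitmx.
  rewrite -row_free_unit; apply: inj_row_free => v vT; apply/rowP => i.
  rewrite mxE -comb0; apply: nonper => // j.
  by rewrite combX vT mxE addr0.
split.
  move=> b beta d cb bb.
  have [Z [Z0 odeZ]] := ode_exists cM cb bM bb (fun=> 0).
  (* [Z] starts at 0 and increases by its value at [X]; the homogeneous part has to supply the rest
     of the prescribed increment. *)
  pose v := (\row_i (d i - Z i X)) *m invmx T.
  exists (fun i x => comb v i x + Z i x); split => [x i|i].
    apply: der_eq; first exact: derD (odeC v x i) (odeZ x i).
    rewrite addr0 addrA -big_split /=; congr (_ + _).
    by apply: eq_bigr => j _; rewrite mulrDr.
  by rewrite combX /v mulmxKV // mxE Z0; ring.
have [C C0 H] := ode_bounded m0 X0.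
pose S := \sum_k \sum_i `|invmx T k i|.
have S0 : 0 <= S by rewrite sumr_ge0 // => k _; rewrite sumr_ge0.
have TS k i : `|invmx T k i| <= S.
  rewrite /S (bigD1 k) //= (bigD1 i) //= -addrA lerDl addr_ge0 ?sumr_ge0 // => j _.
  by rewrite sumr_ge0.
pose C' := n%:R * ((n%:R * ((1 + C) * S)) * C) + C.
exists C'; first by rewrite addr_ge0 // !mulr_ge0 // addr_ge0.
move=> b Z d B B0 odeZ ZX bb db i x xX.
pose v := \row_i Z i 0.
(* Splitting off the homogeneous solution with the same initial value leaves [W], which starts at 0
   and is bounded by the data alone. The increments then determine the initial value through
   [invmx T], which bounds it too. *)
pose W i x := Z i x - comb v i x.
have W0 i' : W i' 0 = 0 by rewrite /W comb0 mxE subrr.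
have odeW t : 0 <= t <= X -> ode_at M b W t.
  move=> tX j; apply: der_eq; first exact: derD (odeZ t tX j) (derN (odeC v t j)).
  rewrite addr0 addrAC -sumrB; congr (_ + _).
  by apply: eq_bigr => k _; rewrite mulrBr.
have WB j t : 0 <= t <= X -> `|W j t| <= C * B.
  move=> tX; apply: (H b W B B0) => // k; by rewrite W0 normr0.
have vT : v *m T = \row_i (d i - W i X).
  apply/rowP => j; rewrite [RHS]mxE /W ZX combX comb0 [v 0 j]mxE; ring.
have vB k : `|v 0 k| <= n%:R * ((1 + C) * S) * B.
  have -> : v = (\row_i (d i - W i X)) *m invmx T by rewrite -vT mulmxK.
  rewrite mxE; apply: le_trans (ler_norm_sum _ _ _) _.
  rewrite -mulrA; apply: sum_ord_le => j; rewrite mxE normrM.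
  rewrite mulrAC; apply: ler_pM => //.
  apply: le_trans (ler_normB _ _) _; rewrite mulrDl mul1r lerD // WB //.
  by rewrite X0 lexx.
have EC k j t : 0 <= t <= X -> `|E k j t| <= C.
  move=> tX; rewrite -[leRHS]mulr1; apply: (H (fun _ _ => 0) (E k)) => //.
  - by move=> *; rewrite normr0.
  - by move=> l; rewrite E0; case: eqP; rewrite ?normr1 ?normr0.
have -> : Z i x = comb v i x + W i x by rewrite /W addrC subrK.
apply: le_trans (ler_normD _ _) _; rewrite /C' mulrDl; apply: lerD; last exact: WB.
apply: le_trans (ler_norm_sum _ _ _) _; rewrite -mulrA; apply: sum_ord_le => k.
by rewrite normrM mulrAC ler_pM // EC.
Qed.

End Gronwall.
End LinearODE.

(** * The elliptic amplitude *)

Section Elliptic.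
Context {R : realType}.
Notation mu := (@lebesgue_measure R).
Variable k : R.
Hypothesis k1 : k ^+ 2 < 1.

Let g (t : R) : R := (Num.sqrt (1 - k ^+ 2 * sin t ^+ 2))^-1.

Lemma modulus_rad_gt0 (S : R) : 0 <= S <= 1 -> 0 < 1 - k ^+ 2 * S.
Proof.
move=> /andP[S0 S1]; rewrite subr_gt0 (le_lt_trans _ k1) //.
by rewrite ler_piMr // sqr_ge0.
Qed.

Lemma sin2_itv (t : R) : 0 <= sin t ^+ 2 <= 1.
Proof. by rewrite sqr_ge0 /= -(cos2Dsin2 t) lerDr sqr_ge0. Qed.

Let rad_gt0 t : 0 < 1 - k ^+ 2 * sin t ^+ 2.
Proof. exact/modulus_rad_gt0/sin2_itv. Qed.

Let g_gt0 t : 0 < g t.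
Proof. by rewrite /g invr_gt0 sqrtr_gt0. Qed.

Let g_ge1 t : 1 <= g t.
Proof.
rewrite /g -[leLHS]invr1 lef_pV2 ?posrE // ?sqrtr_gt0 //.
rewrite -[leRHS]sqrtr1 ler_wsqrtr // gerBl mulr_ge0 ?sqr_ge0 //.
Qed.

Let g_cont : continuous g.
Proof.
move=> t; apply: der_cont; apply: derV; last by rewrite gt_eqF ?sqrtr_gt0.
by apply: der_sqrt => //; der.
Qed.

Let F_der t : has_der t (elliptic_F k) (g t).
Proof. exact: prim_der. Qed.

Lemma elliptic_F0 : elliptic_F k 0 = 0.
Proof. exact: prim0. Qed.

Lemma elliptic_F_cont : continuous (elliptic_F k).
Proof. by move=> t; exact: der_cont (F_der t). Qed.

Lemma elliptic_F_incr : {mono elliptic_F k : x y / x < y}.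
Proof.
apply: leW_mono; apply: le_mono => x y xy.
exact: (antider_lt xy (fun t _ => F_der t) (fun t _ => g_gt0 t)).
Qed.

(** The integrand is at least 1, so the integral outgrows t on both sides and the intermediate value
    theorem applies on [-|u|, |u|]. *)
Lemma elliptic_F_surj u : exists t, elliptic_F k t = u.
Proof.
have ge t : 0 <= t -> t <= elliptic_F k t.
  move=> t0; rewrite -subr_ge0 -[leLHS](_ : elliptic_F k 0 - 0 = 0); last first.
    by rewrite elliptic_F0 subrr.
  apply: (@antider_le _ (fun t => elliptic_F k t - t) (fun t => g t - 1)) => // s _.
    exact: derD (F_der s) (derN (derX s)).
  by rewrite subr_ge0.
have le t : t <= 0 -> elliptic_F k t <= t.
  move=> t0; rewrite -subr_le0 -[leRHS](_ : elliptic_F k 0 - 0 = 0); last first.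
    by rewrite elliptic_F0 subrr.
  apply: (@antider_le _ (fun t => elliptic_F k t - t) (fun t => g t - 1)) => // s _.
    exact: derD (F_der s) (derN (derX s)).
  by rewrite subr_ge0.
have [] := @IVT R (elliptic_F k) (- `|u|) `|u| u.
- by rewrite (@le_trans _ _ 0) // oppr_le0.
- exact/continuous_subspaceT/elliptic_F_cont.
- rewrite ge_min le_max; apply/andP; split; apply/orP; [left|right].
    rewrite (le_trans (le _ _)) ?oppr_le0 //.
    by rewrite lerNl -normrN ler_norm.
  by rewrite (le_trans _ (ge _ _)) // ler_norm.
by move=> t _ <-; exists t.
Qed.

Lemma elliptic_F_inj : injective (elliptic_F k).
Proof.
by move=> x y xy; case: (ltgtP x y) => //; rewrite -elliptic_F_incr xy ltxx.
Qed.

Lemma jacobi_amK u : elliptic_F k (jacobi_am u k) = u.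
Proof.
have [t tE] := elliptic_F_surj u.
exact: (@getPex _ [set theta | elliptic_F k theta = u] (ex_intro _ t tE)).
Qed.

Lemma elliptic_FK t : jacobi_am (elliptic_F k t) k = t.
Proof. by apply: elliptic_F_inj; rewrite jacobi_amK. Qed.

Lemma jacobi_am_der u :
  has_der u (jacobi_am ^~ k) (jacobi_dn u k).
Proof.
rewrite -{1}(jacobi_amK u) /jacobi_dn /jacobi_sn.
rewrite -[Num.sqrt _]invrK.
apply: (@is_derive_inverse R (elliptic_F k)).
- by near=> z; exact: elliptic_FK.
- by near=> z; exact: elliptic_F_cont.
- exact: F_der.
- by rewrite gt_eqF // g_gt0.
Unshelve. all: by end_near. Qed.

Lemma elliptic_FN t : elliptic_F k (- t) = - elliptic_F k t.
Proof.
apply: (@antider_eq _ (fun t => elliptic_F k (- t)) (fun t => - elliptic_F k t) (fun t => - g t)).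
- by rewrite oppr0 elliptic_F0 oppr0.
- move=> s; apply: der_eq; first by apply: derComp; [exact: F_der|der].
  by rewrite /g sinN sqrrN mulrN1.
- by move=> s; exact/derN/F_der.
Qed.

Lemma elliptic_FDpi t : elliptic_F k (t + pi) = elliptic_F k t + elliptic_F k pi.
Proof.
apply: (@antider_eq _ (fun t => elliptic_F k (t + pi)) (fun t => elliptic_F k t + elliptic_F k pi) g).
- by rewrite add0r elliptic_F0 add0r.
- move=> s; apply: der_eq; first by apply: derComp; [exact: F_der|der].
  by rewrite /g sinDpi sqrrN addr0 mulr1.
- by move=> s; apply: der_eq; [exact: derD (F_der s) (derC _ _)|rewrite addr0].
Qed.

Lemma elliptic_F_pi : elliptic_F k pi = 2 * elliptic_F k (pi / 2).
Proof.
have : elliptic_F k (- (pi / 2) + pi) = - elliptic_F k (pi / 2) + elliptic_F k pi.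
  by rewrite elliptic_FDpi elliptic_FN.
have -> : - (pi / 2) + pi = pi / 2 :> R by field.
by lra.
Qed.

(** The integrand of [elliptic_K] blows up at 1. The substitution t = sin theta is made on
    [0, sin(th n)] with th n increasing to pi / 2; monotone convergence gives the integral over the
    half-open interval, and the endpoint is a null set. *)
Lemma elliptic_KE : elliptic_K k = elliptic_F k (pi / 2).
Proof.
pose h (t : R) : R := (Num.sqrt ((1 - k ^+ 2 * t ^+ 2) * (1 - t ^+ 2)))^-1.
(* [harmonic n.+1] is 1 / (n + 2), so that th 0 = pi / 4 is already positive. *)
pose th (n : nat) : R := pi / 2 * (1 - harmonic n.+1).
have pi2 : 0 < pi / 2 :> R by rewrite divr_gt0 // pi_gt0.
have thB n : 0 < th n < pi / 2.
  rewrite /th /harmonic /= mulr_gt0 //; last first.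
    by rewrite subr_gt0 invf_lt1 // ltr1n.
  by rewrite gtr_pMr // gtrBl invr_gt0 ltr0n.
have asin_th n : asin (sin (th n)) = th n.
  have /andP[t0 t1] := thB n.
  rewrite sinK // in_itv /= (ltW t1) andbT (le_trans _ (ltW t0)) // oppr_le0.
  exact: ltW.
have sinB n : 0 < sin (th n) < 1.
  have /andP[t0 t1] := thB n.
  rewrite sin_gt0_pihalf ?t0 //= -(@sin_pihalf R) ltr_sin //.
    rewrite in_itv /= (ltW t1) andbT (le_trans _ (ltW t0)) // oppr_le0; exact: ltW.
  by rewrite in_itv /= lexx andbT (le_trans _ (ltW pi2)) // oppr_le0 ltW.
pose G x := elliptic_F k (asin x).
have G_der x : 0 <= x < 1 -> has_der x G (h x).
  move=> /andP[x0 x1].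
  have xB : -1 < x < 1 by rewrite x1 andbT (lt_le_trans _ x0).
  have xB' : -1 <= x <= 1 by rewrite !ltW //; case/andP: xB.
  apply: der_eq; first by apply: derComp; [exact: F_der|exact: is_derive1_asin].
  rewrite /g /h asinK; last by rewrite in_itv.
  rewrite -invfM -sqrtrM // ltW // modulus_rad_gt0 // sqr_ge0 /=.
  by rewrite exprn_ile1 // ltW.
have h_cont x : 0 <= x < 1 -> {for x, continuous h}.
  move=> /andP[x0 x1]; have x2 : x ^+ 2 < 1 by rewrite exprn_ilt1.
  have r0 : 0 < (1 - k ^+ 2 * x ^+ 2) * (1 - x ^+ 2).
    by rewrite mulr_gt0 ?subr_gt0 // -subr_gt0 modulus_rad_gt0 // sqr_ge0 ltW.
  apply: der_cont; apply: derV; last by rewrite gt_eqF ?sqrtr_gt0.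
  by apply: der_sqrt => //; der.
have int_n n : (\int[mu]_(x in `[0%R, (sin (th n))%R]) (h x)%:E = (elliptic_F k (th n))%:E)%E.
  have /andP[s0 s1] := sinB n.
  rewrite (@continuous_FTC2 _ _ G) //.
  - by rewrite /G asin_th (_ : asin 0 = 0) ?elliptic_F0 ?sube0 // -{1}(@sin0 R) sinK // in_itv /= oppr_le0 (ltW pi2).
  - by apply: seg_cont => x /andP[x0 x1]; apply: h_cont; rewrite x0 (le_lt_trans x1).
  - split.
    + move=> x; rewrite in_itv /= => /andP[x0 x1].
      have xB : 0 <= x < 1 by rewrite (ltW x0) (lt_trans x1).
      by case: (G_der x xB).
    + have xB : 0 <= (0 : R) < 1 by rewrite lexx ltr01.
      by apply: cvg_at_right_filter; exact: (der_cont (G_der 0 xB)).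
    + have xB : 0 <= sin (th n) < 1 by rewrite (ltW s0).
      by apply: cvg_at_left_filter; exact: (der_cont (G_der _ xB)).
  - move=> x; rewrite in_itv /= => /andP[x0 x1].
    have xB : 0 <= x < 1 by rewrite (ltW x0) (lt_trans x1).
    exact: der_derive1 (G_der x xB).
have th_cvg : th @ \oo --> pi / 2.
  rewrite -[X in _ --> X]mulr1; apply: cvgM; first exact: cvg_cst.
  rewrite -[X in _ --> X]subr0; apply: cvgB; first exact: cvg_cst.
  have := @cvg_harmonic R; rewrite -(cvg_shiftS (harmonic : R^nat)); exact.
have cup : \bigcup_n `[0, sin (th n)]%classic = `[0, 1[%classic.
  apply/seteqP; split=> x; rewrite /= in_itv /=.
    move=> [n _]; rewrite /= in_itv /= => /andP[-> xs] /=.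
    by rewrite (le_lt_trans xs) //; case/andP: (sinB n).
  move=> /andP[x0 x1].
  have xB : -1 <= x < 1 by rewrite x1 andbT (le_trans _ x0) // lerN10.
  have xB' : -1 <= x <= 1 by case/andP: xB => -> /ltW ->.
  have : \forall n \near \oo, asin x < th n.
    by apply: (cvgr_gt (pi / 2)) => //; rewrite asin_ltpi2.
  case=> n _ /(_ n (leqnn n)) /= an; exists n => //=; rewrite in_itv /= x0 /=.
  have /andP[t0 t1] := thB n.
  apply: ltW; rewrite -[ltLHS](@asinK R) ?in_itv //= ltr_sin //.
    by rewrite in_itv /= asin_geNpi2 // asin_lepi2.
  by rewrite in_itv /= (ltW t1) andbT (le_trans _ (ltW t0)) // oppr_le0 ltW.
have lim : (fun n => \int[mu]_(x in `[0%R, (sin (th n))%R]) (h x)%:E)%E @ \oo -->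
    (\int[mu]_(x in `[0%R, 1%R[) (h x)%:E)%E.
  rewrite -cup; apply: ge0_nondecreasing_set_cvg_integral.
  - apply/nondecreasing_seqP => n; rewrite subsetEset.
    have /andP[t0 t1] := thB n; have /andP[t0' t1'] := thB n.+1.
    have tB (t : R) : 0 < t < pi / 2 -> t \in `[- (pi / 2), pi / 2].
      move=> /andP[a b]; rewrite in_itv /= (ltW b) andbT (le_trans _ (ltW a)) //.
      by rewrite oppr_le0; exact: (ltW pi2).
    apply: subset_itvl; rewrite bnd_simp; apply: ltW; rewrite ltr_sin ?tB //.
    by rewrite /th ltr_pM2l // ltrD2l ltrN2 /harmonic /= ltf_pV2 ?posrE ?ltr0n // ltr_nat.
  - by [].
  - move=> n; apply/measurable_EFinP; apply: subspace_continuous_measurable_fun => //.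
    by apply: seg_cont => x /andP[x0 x1]; apply: h_cont; rewrite x0 (le_lt_trans x1) //; case/andP: (sinB n).
  - by move=> n x _; rewrite lee_fin invr_ge0 sqrtr_ge0.
have lim2 : (fun n => \int[mu]_(x in `[0%R, (sin (th n))%R]) (h x)%:E)%E @ \oo --> (elliptic_F k (pi / 2))%:E.
  under eq_fun do rewrite int_n.
  apply: cvg_EFin; first by near=> n.
  exact: (@continuous_cvg _ _ _ _ _ th (elliptic_F k) (pi / 2) (@elliptic_F_cont (pi / 2)) th_cvg).
have mh : measurable_fun (`[0, 1[%classic : set R) (EFin \o h).
  apply/measurable_EFinP; apply: subspace_continuous_measurable_fun => //.
  apply: continuous_in_subspaceT => x.
  by rewrite inE /= in_itv /=; exact: h_cont.
have intE : (\int[mu]_(x in `[0%R, 1%R]) (h x)%:E = (elliptic_F k (pi / 2))%:E)%E.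
  rewrite -(integral_itv_bndo_bndc mh).
  exact: (cvg_unique (@ereal_hausdorff R) lim lim2).
have -> : elliptic_K k = fine (\int[mu]_(x in `[0%R, 1%R]) (h x)%:E)%E by [].
by rewrite intE.
Unshelve. all: by end_near. Qed.

Lemma elliptic_K_gt0 : 0 < elliptic_K k.
Proof.
rewrite elliptic_KE -elliptic_F0 elliptic_F_incr divr_gt0 //; exact: pi_gt0.
Qed.

Lemma jacobi_am_shift u : jacobi_am (u + 2 * elliptic_K k) k = jacobi_am u k + pi.
Proof.
by apply: elliptic_F_inj; rewrite jacobi_amK elliptic_FDpi jacobi_amK elliptic_F_pi elliptic_KE.
Qed.

Lemma jacobi_amN u : jacobi_am (- u) k = - jacobi_am u k.
Proof. by apply: elliptic_F_inj; rewrite jacobi_amK elliptic_FN jacobi_amK. Qed.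

Lemma jacobi_am_itv u : 0 < u < elliptic_K k -> 0 < jacobi_am u k < pi / 2.
Proof.
move=> /andP[u0 uK].
apply/andP; split; rewrite -elliptic_F_incr jacobi_amK.
  by rewrite elliptic_F0.
by rewrite -elliptic_KE.
Qed.

Lemma jacobi_am0 : jacobi_am 0 k = 0.
Proof. by rewrite -{1}elliptic_F0 elliptic_FK. Qed.

Lemma jacobi_amK' : jacobi_am (elliptic_K k) k = pi / 2.
Proof. by rewrite elliptic_KE elliptic_FK. Qed.

End Elliptic.

(** * The dnoidal wave *)

Section Roots.
Context {R : realType}.
Variables (c a : R).
Hypothesis adm : admissible c a.

Let sqrt_lt_sqr (x y : R) : 0 < y -> Num.sqrt x < y -> x < y ^+ 2.
Proof.
move=> y0 xy; have [x0|x0] := leP 0 x; last by rewrite (lt_trans x0) // exprn_gt0.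
by rewrite -(sqr_sqrtr x0) ltr_sqr ?nnegrE ?sqrtr_ge0 // ltW.
Qed.

Let lt_sqrt_sqr (x y : R) : 0 <= y -> y < Num.sqrt x -> y ^+ 2 < x.
Proof.
move=> y0 xy; have [x0|x0] := leP 0 x.
  by rewrite -(sqr_sqrtr x0) ltr_sqr ?nnegrE ?sqrtr_ge0.
by move: xy; rewrite ltr0_sqrtr // ltNge y0.
Qed.

Lemma admissible_bounds :
  [/\ 0 < a, rc c < a ^+ 2 + a & 2 * a ^+ 2 + 3 * a < 6 * rc c].
Proof.
have [h1 h2] := adm.
have q0 := sqrtr_ge0 (1 + 4 * rc c).
have a1 : 0 < 2 * a + 1 by lra.
have /(sqrt_lt_sqr a1) r1 : Num.sqrt (1 + 4 * rc c) < 2 * a + 1 by lra.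
have a3 : 0 <= 4 * a + 3 by lra.
have /(lt_sqrt_sqr a3) r2 : 4 * a + 3 < Num.sqrt (9 + 48 * rc c) by lra.
by split; nra.
Qed.

(** After squaring, the upper bound on [a] says exactly that [alpha3] is positive and the lower
    bound that [alpha3] is less than [a]: both compare sqrt(3 beta) with an affine function of
    [a]. *)
Lemma alpha_order : [/\ alpha1 c a < 0, 0 < alpha3 c a & alpha3 c a < a].
Proof.
have [a0 r1 r2] := admissible_bounds.
have b0 : 0 < betac c a by rewrite /betac; nra.
pose q := Num.sqrt 3 * Num.sqrt (betac c a).
have q0 : 0 <= q by rewrite mulr_ge0 ?sqrtr_ge0.
have q2 : q ^+ 2 = 3 * betac c a by rewrite exprMn !sqr_sqrtr // ltW.
have q2' : q ^+ 2 = 3 * (- 4 * a ^+ 2 - 4 * a + 3 + 16 * rc c) by [].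
have lo : 2 * a + 3 < q.
  by rewrite -ltr_sqr ?nnegrE // ?q2'; [nra|lra].
have hi : q < 6 * a + 3.
  by rewrite -ltr_sqr ?nnegrE // ?q2'; [nra|lra].
rewrite /alpha1 /alpha3 -/q; split; lra.
Qed.

(** This and [alpha_rc] are Vieta's formulas for the cubic 3 r Y - (3/2) Y^2 - Y^3 + const of the
    energy identity: the roots add up to -3/2 and their pairwise products to -3 r. *)
Lemma alpha1E : alpha1 c a = - (3 / 2) - alpha3 c a - a.
Proof. by rewrite /alpha1 /alpha3; field. Qed.

Lemma alpha_rc : 3 * rc c = (3 / 2 + alpha3 c a + a) * (alpha3 c a + a) - alpha3 c a * a.
Proof.
have [a0 r1 r2] := admissible_bounds.
have b0 : 0 < betac c a by rewrite /betac; nra.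
rewrite /alpha3; set q := Num.sqrt 3 * Num.sqrt (betac c a).
have q2 : q ^+ 2 = 3 * betac c a by rewrite exprMn !sqr_sqrtr // ltW.
have {}q2 : q ^+ 2 = 3 * (- 4 * a ^+ 2 - 4 * a + 3 + 16 * rc c) by [].
by move: q2; move: (rc c) q => r q q2; lra.
Qed.

End Roots.

(* [y = phi ^ 2] moves between [x3] and [a], the two positive roots of the cubic
   in the energy identity; the third root is [- 3/2 - x3 - a]. *)
Record wave {R : realType} (s r x3 a l : R) (phi p : R -> R) : Prop := Wave {
  wave_s : 0 < s;
  wave_x3 : 0 < x3;
  wave_a : x3 < a;
  wave_l : 0 < l;
  wave_r : 3 * r = (3 / 2 + x3 + a) * (x3 + a) - x3 * a;
  wave_der : forall x, has_der x phi (p x);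
  wave_eq : forall x, has_der x p ((r * phi x - phi x ^+ 3 - phi x ^+ 5) / s);
  wave_energy : forall x,
    3 * s * p x ^+ 2 = (phi x ^+ 2 + 3 / 2 + x3 + a) * (phi x ^+ 2 - x3) * (a - phi x ^+ 2);
  wave_gt0 : forall x, 0 < phi x;
  wave_ge : forall x, x3 <= phi x ^+ 2;
  wave_le : forall x, phi x ^+ 2 <= a;
  wave_even : forall x, phi (- x) = phi x;
  wave_per : forall x, phi (x + 2 * l) = phi x;
  wave_p_lt0 : forall x, 0 < x < l -> p x < 0;
  wave_p0 : p 0 = 0;
  wave_pl : p l = 0;
  wave_phi0 : phi 0 ^+ 2 = a;
  wave_phil : phi l ^+ 2 = x3 }.

Section Dnoidal.
Context {R : realType}.
Variables (c a : R).
Hypothesis s_gt0 : 0 < sc c.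
Hypothesis adm : admissible c a.

Local Notation x1 := (alpha1 c a).
Local Notation x3 := (alpha3 c a).
Let k := modulus c a.
Let gam := gammac c a.

Let k2E : k ^+ 2 = - x1 * (a - x3) / (a * (x3 - x1)).
Proof.
have [x10 x30 x3a] := alpha_order adm.
rewrite sqr_sqrtr // divr_ge0 // mulr_ge0 //; lra.
Qed.

Let k2_lt1 : k ^+ 2 < 1.
Proof.
have [x10 x30 x3a] := alpha_order adm.
have d0 : 0 < a * (x3 - x1) by rewrite mulr_gt0 //; lra.
rewrite k2E ltr_pdivrMr // mul1r; nra.
Qed.

Let gam2E : gam ^+ 2 = a * (x3 - x1) / (3 * sc c).
Proof.
have [x10 x30 x3a] := alpha_order adm.
by rewrite sqr_sqrtr // ltW // divr_gt0 // mulr_gt0 //; lra.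
Qed.

Let gam_gt0 : 0 < gam.
Proof.
have [x10 x30 x3a] := alpha_order adm.
by rewrite sqrtr_gt0 divr_gt0 // mulr_gt0 //; lra.
Qed.

Let gam_period : gam * wave_period c a = 2 * elliptic_K k.
Proof.
have [x10 x30 x3a] := alpha_order adm.
have d0 : 0 < a * (x3 - x1) by rewrite mulr_gt0 //; lra.
have s3 : 0 < 3 * sc c by rewrite mulr_gt0.
have e1 : Num.sqrt (3 * sc c) != 0 by rewrite gt_eqF // sqrtr_gt0.
have e2 : Num.sqrt (a * (x3 - x1)) != 0 by rewrite gt_eqF // sqrtr_gt0.
rewrite /gam /gammac /wave_period -/k sqrtrM ?(ltW d0) // sqrtrV ?(ltW s3) //.
by field; rewrite e1 e2.
Qed.

Let m := a * k ^+ 2 / (- x1).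
Let mE : m = (a - x3) / (x3 - x1).
Proof.
have [x10 x30 x3a] := alpha_order adm.
rewrite /m k2E; field; neq0.
Qed.

Let th x := jacobi_am (gam * x) k.
Let S x := sin (th x) ^+ 2.
Let D x := Num.sqrt (1 - k ^+ 2 * S x).
Let Q x := Num.sqrt (1 + m * S x).

Let S01 x : 0 <= S x <= 1. Proof. exact: sin2_itv. Qed.
Let m_gt0 : 0 < m.
Proof.
have [x10 x30 x3a] := alpha_order adm.
by rewrite mE divr_gt0 //; lra.
Qed.
Let D2_gt0 x : 0 < 1 - k ^+ 2 * S x.
Proof. exact: modulus_rad_gt0. Qed.
Let Q2_gt0 x : 0 < 1 + m * S x.
Proof. by case/andP: (S01 x) => S0 _; rewrite ltr_pwDl // mulr_ge0 // ltW. Qed.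
Let D_gt0 x : 0 < D x. Proof. by rewrite sqrtr_gt0. Qed.
Let Q_gt0 x : 0 < Q x. Proof. by rewrite sqrtr_gt0. Qed.
Let D2 x : D x ^+ 2 = 1 - k ^+ 2 * S x. Proof. by rewrite sqr_sqrtr // ltW. Qed.
Let Q2 x : Q x ^+ 2 = 1 + m * S x. Proof. by rewrite sqr_sqrtr // ltW. Qed.

Let phiE x : dnoidal c a x = Num.sqrt a * D x / Q x.
Proof. by []. Qed.

Let th_der x : has_der x th (gam * D x).
Proof.
have dg : has_der x (fun x => gam * x) gam.
  by apply: der_eq; [exact: derM (derC _ _) (derX x)|rewrite mul0r add0r mulr1].
apply: der_eq; first exact: (derComp (jacobi_am_der k2_lt1 (gam * x)) dg).
exact: mulrC.
Qed.

Definition dnoidal' x : R :=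
  - (Num.sqrt a * (k ^+ 2 + m) * gam * sin (th x) * cos (th x)) / Q x ^+ 3.

Let sin_der x : has_der x (fun x => sin (th x)) (cos (th x) * (gam * D x)).
Proof. by apply: derComp; [exact: der_sin|exact: th_der]. Qed.
Let cos_der x : has_der x (fun x => cos (th x)) (- sin (th x) * (gam * D x)).
Proof. by apply: derComp; [exact: der_cos|exact: th_der]. Qed.

Let Q_der x : has_der x Q (m * sin (th x) * cos (th x) * gam * D x / Q x).
Proof.
have H := der_sqrt (derD (derC x 1) (derM (derC x m) (derXn 2 (sin_der x)))) (Q2_gt0 x).
apply: (der_eq H); rewrite -/(S x) -/(Q x) /=.
by field; rewrite gt_eqF.
Qed.

Let D_der x : has_der x D (- k ^+ 2 * sin (th x) * cos (th x) * gam).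
Proof.
have H := der_sqrt (derD (derC x 1) (derN (derM (derC x (k ^+ 2)) (derXn 2 (sin_der x))))) (D2_gt0 x).
apply: (der_eq H); rewrite -/(S x) -/(D x) /=.
by field; rewrite gt_eqF.
Qed.

Lemma dnoidal_der x : has_der x (dnoidal c a) (dnoidal' x).
Proof.
have Qn0 : Q x != 0 by rewrite gt_eqF.
apply: der_eq; first by apply: (derM (derM (derC _ _) (D_der x)) (derV (Q_der x) Qn0)).
(* The quotient rule produces k^2 Q^2 + m D^2, in which the terms with sn^2 cancel. *)
rewrite /dnoidal' -[k ^+ 2 + m](_ : k ^+ 2 * Q x ^+ 2 + m * D x ^+ 2 = _); last first.
  by rewrite Q2 D2; ring.
by field.
Qed.

Let cos2E x : cos (th x) ^+ 2 = 1 - S x.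
Proof. by rewrite /S cos2sin2. Qed.

Let YE x : dnoidal c a x ^+ 2 = a * (1 - k ^+ 2 * S x) / (1 + m * S x).
Proof.
have [x10 x30 x3a] := alpha_order adm.
by rewrite phiE !exprMn exprVn D2 Q2 sqr_sqrtr // ltW // (lt_trans x30).
Qed.

Lemma dnoidal_eq x : has_der x dnoidal'
  ((rc c * dnoidal c a x - dnoidal c a x ^+ 3 - dnoidal c a x ^+ 5) / sc c).
Proof.
have [x10 x30 x3a] := alpha_order adm.
have Qn0 : Q x != 0 by rewrite gt_eqF.
have Q3n0 : Q x ^+ 3 != 0 by rewrite expf_neq0.
have H := derM (derN (derM (derM (derC x (Num.sqrt a * (k ^+ 2 + m) * gam)) (sin_der x)) (cos_der x)))
    (derV (derXn 3 (Q_der x)) Q3n0).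
apply: (der_eq H) => {H}; rewrite /=.
(* Both sides are brought to the form phi times an expression even in sn and cn. After cancelling
   phi, everything is rational in S = sn^2 and the parameters, and the square roots have
   disappeared. *)
transitivity (dnoidal c a x * (- (k ^+ 2 + m) * gam ^+ 2 *
   ((cos (th x) ^+ 2 - sin (th x) ^+ 2) / Q x ^+ 2 - 3 * m * sin (th x) ^+ 2 * cos (th x) ^+ 2 / (Q x ^+ 2) ^+ 2))).
  by rewrite phiE; field.
transitivity (dnoidal c a x * ((rc c - dnoidal c a x ^+ 2 - (dnoidal c a x ^+ 2) ^+ 2) / sc c)); last first.
  by field; rewrite gt_eqF.
congr (_ * _); rewrite cos2E -/(S x) Q2 YE gam2E.
have rE : rc c = ((3 / 2 + x3 + a) * (x3 + a) - x3 * a) / 3.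
  by rewrite -(alpha_rc adm); field.
have := Q2_gt0 x; rewrite mE k2E rE => q0.
have n1 : 1 + (a - x3) / (x3 - x1) * S x = (x3 - x1 + (a - x3) * S x) / (x3 - x1).
  by field; neq0.
have n2 : 0 < x3 - x1 + (a - x3) * S x.
  case/andP: (S01 x) => S0 _; have : 0 <= (a - x3) * S x by rewrite mulr_ge0 //; lra.
  by lra.
rewrite n1; move: n2 s_gt0 x30 x10 x3a; rewrite (alpha1E c a).
move: (S x) (sc c) (x3) => T s y n2 s0 y0 y1 y2.
by field; neq0.
Qed.

Lemma dnoidal_energy x : 3 * sc c * dnoidal' x ^+ 2 =
  (dnoidal c a x ^+ 2 + 3 / 2 + x3 + a) * (dnoidal c a x ^+ 2 - x3) * (a - dnoidal c a x ^+ 2).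
Proof.
have [x10 x30 x3a] := alpha_order adm.
have Qn0 : Q x != 0 by rewrite gt_eqF.
rewrite YE.
transitivity (3 * sc c * (Num.sqrt a ^+ 2 * (k ^+ 2 + m) ^+ 2 * gam ^+ 2 * S x * cos (th x) ^+ 2 / (Q x ^+ 2) ^+ 3)).
  by rewrite /dnoidal' /S; field.
rewrite cos2E Q2 sqr_sqrtr ?(ltW (lt_trans x30 x3a)) // gam2E mE k2E.
have n1 : 1 + (a - x3) / (x3 - x1) * S x = (x3 - x1 + (a - x3) * S x) / (x3 - x1).
  by field; neq0.
have n2 : 0 < x3 - x1 + (a - x3) * S x.
  case/andP: (S01 x) => S0 _; have : 0 <= (a - x3) * S x by rewrite mulr_ge0 //; lra.
  by lra.
rewrite n1; move: n2 s_gt0 x30 x10 x3a; rewrite (alpha1E c a).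
move: (S x) (sc c) (x3) => T s y n2 s0 y0 y1 y2.
by field; neq0.
Qed.

Lemma dnoidal_wave l : wave_period c a = 2 * l ->
  wave (sc c) (rc c) x3 a l (dnoidal c a) dnoidal'.
Proof.
move=> lE.
have [x10 x30 x3a] := alpha_order adm.
have a0 : 0 < a by rewrite (lt_trans x30).
have gl : gam * l = elliptic_K k by have := gam_period; rewrite lE; lra.
have K0 := elliptic_K_gt0 k2_lt1.
have l0 : 0 < l by rewrite -(pmulr_rgt0 _ gam_gt0) gl.
have th0 : th 0 = 0 by rewrite /th mulr0 jacobi_am0.
have thl : th l = pi / 2 by rewrite /th gl jacobi_amK'.
have km0 : 0 < k ^+ 2 + m by rewrite ltr_wpDl // sqr_ge0.
(* The distances of phi^2 to [x3] and to [a] carry the factors cos^2 and sin^2 of the amplitude,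
   which runs from 0 to pi / 2 over [0, l]; hence the bounds on phi^2 and its values at the two
   ends. *)
have Yx3 x : dnoidal c a x ^+ 2 - x3 = (a - x3) * cos (th x) ^+ 2 / (1 + m * S x).
  have n2 : 0 < x3 - x1 + (a - x3) * S x.
    case/andP: (S01 x) => S0 _; have : 0 <= (a - x3) * S x by rewrite mulr_ge0 //; lra.
    by lra.
  have n1 : 1 + (a - x3) / (x3 - x1) * S x = (x3 - x1 + (a - x3) * S x) / (x3 - x1).
    by field; neq0.
  rewrite YE cos2E mE k2E n1; field; neq0.
have Ya x : a - dnoidal c a x ^+ 2 = a * (k ^+ 2 + m) * sin (th x) ^+ 2 / (1 + m * S x).
  by rewrite YE /S; field; rewrite gt_eqF // Q2_gt0.
split.
- exact: s_gt0.
- exact: x30.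
- exact: x3a.
- exact: l0.
- exact: alpha_rc.
- exact: dnoidal_der.
- exact: dnoidal_eq.
- exact: dnoidal_energy.
- by move=> x; rewrite phiE divr_gt0 // mulr_gt0 // sqrtr_gt0.
- move=> x; rewrite -subr_ge0 Yx3 divr_ge0 ?(ltW (Q2_gt0 x)) //.
  by rewrite mulr_ge0 ?sqr_ge0 // subr_ge0 ltW.
- move=> x; rewrite -subr_ge0 Ya divr_ge0 ?(ltW (Q2_gt0 x)) //.
  by rewrite mulr_ge0 ?sqr_ge0 // mulr_ge0 // ltW.
- by move=> x; rewrite !phiE /D /Q /S /th mulrN jacobi_amN // sinN sqrrN.
- move=> x; have gx : gam * (x + 2 * l) = gam * x + 2 * elliptic_K k by rewrite -gl; ring.
  rewrite !phiE /D /Q /S /th gx jacobi_am_shift //.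
  by rewrite sinDpi sqrrN.
- move=> x /andP[x0 xl].
  have /andP[t0 t1] : 0 < th x < pi / 2.
    by apply: jacobi_am_itv => //; rewrite mulr_gt0 //= -gl ltr_pM2l.
  rewrite /dnoidal' mulNr oppr_lt0 divr_gt0 ?exprn_gt0 //.
  rewrite mulr_gt0 ?cos_gt0_pihalf ?t1 ?(lt_trans _ t0) // ?oppr_lt0 ?divr_gt0 ?pi_gt0 //.
  rewrite mulr_gt0 ?sin_gt0_pihalf ?t0 //.
  by rewrite mulr_gt0 // mulr_gt0 // sqrtr_gt0.
- by rewrite /dnoidal' th0 sin0 mulr0 mul0r oppr0 mul0r.
- by rewrite /dnoidal' thl cos_pihalf mulr0 oppr0 mul0r.
- by apply/esym/eqP; rewrite -subr_eq0 Ya th0 sin0 expr0n mulr0 mul0r.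
- by apply/eqP; rewrite -subr_eq0 Yx3 thl cos_pihalf expr0n mulr0 mul0r.
Qed.

End Dnoidal.

(** * A second solution of the linearized equation *)

Ltac positivity := repeat match goal with
  | H : is_true (0 < ?x) |- is_true (0 < ?x) => exact: H
  | |- is_true (0 < _ + _) => apply: addr_gt0
  | |- is_true (0 < _ * _) => apply: mulr_gt0
  | |- is_true (0 < _ ^+ _) => apply: exprn_gt0
  | |- is_true (0 < _ %:R) => by rewrite ltr0n
  end.

(* [second_num] at [x + p], divided by [q / 72], for the roots [x] and [x + p + q]. *)
Definition second_poly {R : realType} (x p q : R) : R :=
  720 * x ^+ 4 * p ^+ 2 + 960 * x ^+ 4 * p * q + 240 * x ^+ 4 * q ^+ 2 + 2208 * x ^+ 3 * p ^+ 3 +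
  4800 * x ^+ 3 * p ^+ 2 * q + 1008 * x ^+ 3 * p ^+ 2 + 3072 * x ^+ 3 * p * q ^+ 2 +
  1200 * x ^+ 3 * p * q + 480 * x ^+ 3 * q ^+ 3 + 192 * x ^+ 3 * q ^+ 2 +
  2448 * x ^+ 2 * p ^+ 4 + 7360 * x ^+ 2 * p ^+ 3 * q + 2376 * x ^+ 2 * p ^+ 3 +
  7680 * x ^+ 2 * p ^+ 2 * q ^+ 2 + 4920 * x ^+ 2 * p ^+ 2 * q + 486 * x ^+ 2 * p ^+ 2 +
  3072 * x ^+ 2 * p * q ^+ 3 + 2832 * x ^+ 2 * p * q ^+ 2 + 522 * x ^+ 2 * p * q +
  304 * x ^+ 2 * q ^+ 4 + 288 * x ^+ 2 * q ^+ 3 + 36 * x ^+ 2 * q ^+ 2 + 1152 * x * p ^+ 5 +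
  4416 * x * p ^+ 4 * q + 1800 * x * p ^+ 4 + 6400 * x * p ^+ 3 * q ^+ 2 +
  5280 * x * p ^+ 3 * q + 810 * x * p ^+ 3 + 4224 * x * p ^+ 2 * q ^+ 3 +
  5256 * x * p ^+ 2 * q ^+ 2 + 1620 * x * p ^+ 2 * q + 81 * x * p ^+ 2 + 1152 * x * p * q ^+ 4 +
  1872 * x * p * q ^+ 3 + 846 * x * p * q ^+ 2 + 81 * x * p * q + 64 * x * q ^+ 5 +
  96 * x * q ^+ 4 + 36 * x * q ^+ 3 + 192 * p ^+ 6 + 896 * p ^+ 5 * q + 432 * p ^+ 5 +
  1664 * p ^+ 4 * q ^+ 2 + 1632 * p ^+ 4 * q + 324 * p ^+ 4 + 1536 * p ^+ 3 * q ^+ 3 +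
  2304 * p ^+ 3 * q ^+ 2 + 936 * p ^+ 3 * q + 81 * p ^+ 3 + 704 * p ^+ 2 * q ^+ 4 +
  1440 * p ^+ 2 * q ^+ 3 + 900 * p ^+ 2 * q ^+ 2 + 162 * p ^+ 2 * q + 128 * p * q ^+ 5 +
  336 * p * q ^+ 4 + 288 * p * q ^+ 3 + 81 * p * q ^+ 2.

(** All coefficients are positive: the arguments x3, Y - x3 and a - Y turn the condition x3 < Y < a
    into positivity of the variables. *)
Lemma second_poly_gt0 {R : realType} (x p q : R) : 0 < x -> 0 < p -> 0 < q -> 0 < second_poly x p q.
Proof. by move=> x0 p0 q0; rewrite /second_poly; positivity. Qed.

(* [u = A(phi) - tau * p] with [tau' = B(phi)] solves [s u'' = (r - 3 phi^2 - 5 phi^4) u];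
   [A] is the odd quintic polynomial for which [B] is a quotient of polynomials in
   [Y = phi^2] without poles and positive between [x3] and [a]. *)
Section SecondSolution.
Context {R : realType}.
Variables (x3 a : R).

Let sg := x3 + a.
Let pp := x3 * a.
Let r := ((3 / 2 + sg) * sg - pp) / 3.
Let e := - (3 / 2 + sg) * pp / 3.
(** Let w = s p^2 as a function of phi. The equation for B integrates to w B = A' w - A w' / 2 +
    const, with primes for d/dphi. The cubic - cb phi + ca phi^3 is chosen so that its product with
    w' / 2 = r phi - phi^3 - phi^5 has the same value at Y = x3 and Y = a; one constant then cancels
    both values, and dividing by (Y - x3) (a - Y) / 3 leaves the linear [Bn]. *)
Let ca := sg / 2 + 2 / 3 * (sg ^+ 2 - pp).
Let cb := 2 / 3 * sg ^+ 3 + sg ^+ 2 / 2 - 5 / 3 * pp * sg - pp.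
Let lin := - 2 * cb / 3 - ca / 2.
Let con := - cb / 2 + 2 * r * ca + lin * sg.
Let Bn Y := - 3 * (lin * Y + con).
(** Along the wave, N1 / (Y + 3/2 + sg) is the derivative of s phi p / (Y + 3/2 + sg), and the
    matching part of A is s phi p^2 / (Y + 3/2 + sg): this pair adds nothing to A - tau p. The
    weights [dd] and [kap] make [second_num] vanish at Y = a, whence the factor a - Y in its
    factorization. *)
Let N1 Y := e + 2 * r * Y - 3 / 2 * Y ^+ 2 - 4 / 3 * Y ^+ 3 + 2 / 3 * Y * (Y - x3) * (Y - a).
Let dd := - N1 a.
Let kap := Bn a.

Definition second_num Y : R := dd * Bn Y + kap * N1 Y.
Definition second_B f : R := second_num (f ^+ 2) / (f ^+ 2 + 3 / 2 + sg).
Definition second_A f : R :=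
  dd * (- cb * f + ca * f ^+ 3) - kap / 3 * (f ^+ 5 - sg * f ^+ 3 + pp * f).
Definition second_A1 f : R := dd * (- cb + 3 * ca * f ^+ 2) - kap / 3 * (5 * f ^+ 4 - 3 * sg * f ^+ 2 + pp).
Definition second_A2 f : R := dd * (6 * ca * f) - kap / 3 * (20 * f ^+ 3 - 6 * sg * f).
Definition second_dnum Y : R :=
  dd * (- 3 * lin) + kap * (2 * r - 3 * Y - 4 * Y ^+ 2 + 2 / 3 * (3 * Y ^+ 2 - 2 * sg * Y + pp)).
Definition second_B1 f : R :=
  2 * f * (second_dnum (f ^+ 2) * (f ^+ 2 + 3 / 2 + sg) - second_num (f ^+ 2))
  / (f ^+ 2 + 3 / 2 + sg) ^+ 2.

Lemma second_A_der f : has_der f second_A (second_A1 f).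
Proof.
have H := derD (derM (derC f dd) (derD (derM (derC f (- cb)) (derX f)) (derM (derC f ca) (derXn 3 (derX f)))))
  (derN (derM (derC f (kap / 3)) (derD (derD (derXn 5 (derX f))
    (derN (derM (derC f sg) (derXn 3 (derX f))))) (derM (derC f pp) (derX f))))).
by apply: (der_eq H); rewrite /second_A1 /=; ring.
Qed.

Lemma second_A1_der f : has_der f second_A1 (second_A2 f).
Proof.
have H := derD (derM (derC f dd) (derD (derC f (- cb)) (derM (derC f (3 * ca)) (derXn 2 (derX f)))))
  (derN (derM (derC f (kap / 3)) (derD (derD (derM (derC f 5) (derXn 4 (derX f)))
    (derN (derM (derC f (3 * sg)) (derXn 2 (derX f))))) (derC f pp)))).
by apply: (der_eq H); rewrite /second_A2 /=; ring.
Qed.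

Lemma second_num_der Y : has_der Y second_num (second_dnum Y).
Proof.
have hB : has_der Y Bn (- 3 * lin).
  have H := derM (derC Y (- 3)) (derD (derM (derC Y lin) (derX Y)) (derC Y con)).
  by apply: (der_eq H); ring.
have hN : has_der Y N1 (2 * r - 3 * Y - 4 * Y ^+ 2 + 2 / 3 * (3 * Y ^+ 2 - 2 * sg * Y + pp)).
  have H := derD (derD (derD (derD (derC Y e) (derM (derC Y (2 * r)) (derX Y)))
     (derN (derM (derC Y (3 / 2)) (derXn 2 (derX Y))))) (derN (derM (derC Y (4 / 3)) (derXn 3 (derX Y)))))
     (derM (derM (derM (derC Y (2 / 3)) (derX Y)) (derD (derX Y) (derN (derC Y x3))))
     (derD (derX Y) (derN (derC Y a)))).
  by apply: (der_eq H); rewrite /pp /sg /=; field.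
apply: (der_eq (derD (derM (derC Y dd) hB) (derM (derC Y kap) hN))).
by rewrite /second_dnum; ring.
Qed.

Lemma second_B_der f : f ^+ 2 + 3 / 2 + sg != 0 -> has_der f second_B (second_B1 f).
Proof.
move=> n0; have h2 := derXn 2 (derX f).
have hN : has_der f (fun f => second_num (f ^+ 2)) (second_dnum (f ^+ 2) * (2 * f)).
  by apply: (der_eq (derComp (second_num_der _) h2)); rewrite /= mulr1.
have hV := derV (derD (derD h2 (derC f (3 / 2))) (derC f sg)) n0.
apply: (der_eq (derM hN hV)); rewrite /second_B1 /=.
field; have -> : f ^+ 2 * 2 + 3 + sg * 2 = 2 * (f ^+ 2 + 3 / 2 + sg) by field.
by rewrite mulf_neq0.
Qed.

(** In s u'' - V u the terms with tau cancel because p solves the equation; this is what remains,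
    with [p2] standing for s p^2. *)
Lemma second_identity f (p2 : R) : f ^+ 2 + 3 / 2 + sg != 0 ->
  3 * p2 = (f ^+ 2 + 3 / 2 + sg) * (f ^+ 2 - x3) * (a - f ^+ 2) ->
  (second_A2 f - second_B1 f) * p2 + (second_A1 f - 2 * second_B f) * (r * f - f ^+ 3 - f ^+ 5) =
  (r - 3 * f ^+ 2 - 5 * f ^+ 4) * second_A f.
Proof.
move=> n0 p2E.
have -> : p2 = (f ^+ 2 + 3 / 2 + sg) * (f ^+ 2 - x3) * (a - f ^+ 2) / 3 by rewrite -p2E; field.
rewrite /second_A2 /second_B1 /second_A1 /second_B /second_A /second_dnum /second_num /Bn /N1 /dd /kap.
rewrite /N1 /Bn /con /lin /ca /cb /r /e /pp; move: n0; rewrite /sg => n0.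
field.
have -> : f ^+ 2 * 2 + 3 + (x3 + a) * 2 = 2 * (f ^+ 2 + 3 / 2 + (x3 + a)) by field.
by rewrite mulf_neq0.
Qed.

Lemma second_num_gt0 Y : 0 < x3 -> x3 < Y -> Y < a -> 0 < second_num Y.
Proof.
move=> x0 xY Ya.
have [p p0 pE] : exists2 p, 0 < p & Y = x3 + p by exists (Y - x3); [rewrite subr_gt0|ring].
have [q q0 qE] : exists2 q, 0 < q & a = x3 + p + q.
  by exists (a - Y); [rewrite subr_gt0|rewrite pE; ring].
have -> : second_num Y = q / 72 * second_poly x3 p q.
  rewrite /second_num /Bn /N1 /dd /kap /N1 /Bn /con /lin /ca /cb /r /e /pp /sg pE qE /second_poly.
  by field.
apply: mulr_gt0; first by rewrite divr_gt0.
exact: second_poly_gt0.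
Qed.

Hypothesis x3_gt0 : 0 < x3.
Hypothesis x3a : x3 < a.

Let ad : exists2 d, 0 < d & a = x3 + d.
Proof. by exists (a - x3); [rewrite subr_gt0|ring]. Qed.

Lemma second_dd_gt0 : 0 < dd.
Proof.
have [d d0 aE] := ad; pose x := x3; have x0 : 0 < x by [].
have -> : dd = (6 * x ^+ 2 * d + 10 * x * d ^+ 2 + 3 * x * d + 4 * d ^+ 3 + 3 * d ^+ 2) / 6.
  by rewrite /dd /N1 /r /e /pp /sg aE /x; field.
by apply: divr_gt0; positivity.
Qed.

(** At Y = a, as at Y = x3, the part of A with the factor [kap] vanishes; in the variables x3 and d
    = a - x3 the remaining factor has positive coefficients. *)
Lemma second_A_hi f : 0 < f -> f ^+ 2 = a -> 0 < second_A f.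
Proof.
move=> f0 fa.
have -> : second_A f = dd * f * (- cb + ca * f ^+ 2) - kap / 3 * f * (f ^+ 2 - x3) * (f ^+ 2 - a).
  by rewrite /second_A /pp /sg; ring.
rewrite fa subrr mulr0 subr0 !mulr_gt0 ?second_dd_gt0 //.
have [d d0 aE] := ad; pose x := x3; have x0 : 0 < x by [].
have -> : - cb + ca * a = (6 * x ^+ 2 * d + 2 * x * d ^+ 2 + 3 * x * d) / 6.
  by rewrite /ca /cb /pp /sg aE /x; field.
by apply: divr_gt0; positivity.
Qed.

Lemma second_A_lo f : 0 < f -> f ^+ 2 = x3 -> second_A f < 0.
Proof.
move=> f0 fa.
have -> : second_A f = - (dd * f * (cb - ca * f ^+ 2)) - kap / 3 * f * (f ^+ 2 - x3) * (f ^+ 2 - a).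
  by rewrite /second_A /pp /sg; ring.
rewrite fa subrr mulr0 mul0r subr0 oppr_lt0 !mulr_gt0 ?second_dd_gt0 //.
have [d d0 aE] := ad; pose x := x3; have x0 : 0 < x by [].
have -> : cb - ca * x3 = (6 * x ^+ 2 * d + 10 * x * d ^+ 2 + 3 * x * d + 4 * d ^+ 3 + 3 * d ^+ 2) / 6.
  by rewrite /ca /cb /pp /sg aE /x; field.
by apply: divr_gt0; positivity.
Qed.

End SecondSolution.

(** * The second solution along the wave and its endpoint signs *)

Section WaveSecond.
Context {R : realType}.
Variables (s r x3 a l : R) (phi p : R -> R).
Hypothesis W : wave s r x3 a l phi p.

Definition potential x : R := r - 3 * phi x ^+ 2 - 5 * phi x ^+ 4.

Lemma wave_p_der x : has_der x (fun x => (r * phi x - phi x ^+ 3 - phi x ^+ 5) / s)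
  (potential x / s * p x).
Proof.
have d := wave_der W x.
have H := derM (derD (derD (derM (derC x r) d) (derN (derXn 3 d))) (derN (derXn 5 d))) (derC x s^-1).
by apply: (der_eq H); rewrite /potential /=; ring.
Qed.

(** Where p vanishes, u equals A(phi) and u1 equals - tau p'. At 0 also tau = 0; at l, tau is the
    integral of the positive B, and p' is positive because phi has its minimum there. *)
Lemma wave_second : exists u u1 : R -> R,
  [/\ forall x, has_der x u (u1 x),
      forall x, has_der x u1 (potential x / s * u x),
      0 < u 0 /\ u1 0 = 0 & u l < 0 /\ u1 l < 0].
Proof.
have s0 := wave_s W; have x30 := wave_x3 W; have x3a := wave_a W; have l0 := wave_l W.
have rE : r = ((3 / 2 + (x3 + a)) * (x3 + a) - x3 * a) / 3.
  by have := wave_r W; lra.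
have den0 x : phi x ^+ 2 + 3 / 2 + (x3 + a) != 0.
  by rewrite gt_eqF // !addr_gt0 // ?divr_gt0 // ?exprn_gt0 ?(wave_gt0 W) // (lt_trans x30).
pose A f := second_A x3 a f; pose A1 f := second_A1 x3 a f; pose A2 f := second_A2 x3 a f.
pose B f := second_B x3 a f; pose B1 f := second_B1 x3 a f.
pose f x := (r * phi x - phi x ^+ 3 - phi x ^+ 5) / s.
have dphi := wave_der W.
have dA x : has_der x (fun x => A (phi x)) (A1 (phi x) * p x).
  exact: derComp (second_A_der _ _ _) (dphi x).
have dA1 x : has_der x (fun x => A1 (phi x)) (A2 (phi x) * p x).
  exact: derComp (second_A1_der _ _ _) (dphi x).
have dB x : has_der x (fun x => B (phi x)) (B1 (phi x) * p x).
  exact: derComp (second_B_der (den0 x)) (dphi x).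
have cB : continuous (fun x => B (phi x)) by move=> x; exact: der_cont (dB x).
pose tau := prim (fun x => B (phi x)).
have dtau x : has_der x tau (B (phi x)) by exact: prim_der.
have dp : forall x, has_der x p (f x) := wave_eq W.
exists (fun x => A (phi x) - tau x * p x).
exists (fun x => (A1 (phi x) - B (phi x)) * p x - tau x * f x).
have tau0 : tau 0 = 0 by exact: prim0.
have phi0 := wave_phi0 W; have phil := wave_phil W.
have pos := wave_gt0 W.
have inner x : 0 < x < l -> x3 < phi x ^+ 2 < a.
  move=> xl; have px := wave_p_lt0 W xl.
  have E := wave_energy W x.
  have : p x != 0 by rewrite lt_eqF.
  rewrite !lt_neqAle (wave_ge W) (wave_le W) !andbT; apply: contraR.
  rewrite negb_and !negbK => h.
  have : 3 * s * p x ^+ 2 = 0.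
    by rewrite E; case/orP: h => /eqP ->; rewrite subrr ?mulr0 ?mul0r.
  by move/eqP; rewrite -mulrA mulf_eq0 pnatr_eq0 /= mulf_eq0 (gt_eqF s0) /= sqrf_eq0.
have taul : 0 < tau l.
  rewrite -tau0; apply: (antider_lt l0 (fun x _ => dtau x)) => x xl.
  rewrite /B /second_B divr_gt0 //.
    by apply: second_num_gt0 => //; case/andP: (inner x xl).
  by rewrite lt_neqAle eq_sym den0 /= !addr_ge0 // ?sqr_ge0 ?divr_ge0 // ltW // (lt_trans x30).
split.
- move=> x; apply: (der_eq (derD (dA x) (derN (derM (dtau x) (dp x))))).
  by ring.
- move=> x; have H := derD (derM (derD (dA1 x) (derN (dB x))) (dp x)) (derN (derM (dtau x) (wave_p_der x))).
  apply: (der_eq H).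
  have id := @second_identity R x3 a (phi x) (s * p x ^+ 2) (den0 x).
  have {id} := id _; rewrite mulrA (wave_energy W) -rE => /(_ _) id.
  have {id} id : (A2 (phi x) - B1 (phi x)) * (s * p x ^+ 2) +
      (A1 (phi x) - 2 * B (phi x)) * (r * phi x - phi x ^+ 3 - phi x ^+ 5) =
      potential x * A (phi x).
    by apply: id; ring.
  have -> : potential x / s * (A (phi x) - tau x * p x) =
    (potential x * A (phi x)) / s - tau x * (potential x / s * p x) by ring.
  rewrite -id /f; field.
  by rewrite gt_eqF.
- split; first by rewrite tau0 mul0r subr0; exact: second_A_hi.
  by rewrite (wave_p0 W) tau0 mulr0 mul0r subr0.
- rewrite (wave_pl W) !mulr0 !subr0 sub0r oppr_lt0; split; first exact: second_A_lo.
  rewrite mulr_gt0 // /f divr_gt0 //.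
  have -> : r * phi l - phi l ^+ 3 - phi l ^+ 5 = phi l * (r - x3 - x3 ^+ 2).
    by rewrite -phil; ring.
  (* With d = a - x3, the remaining factor is d (3 + 6 x3 + 2 d) / 6. *)
  rewrite mulr_gt0 // rE.
  have : 0 < a - x3 by rewrite subr_gt0.
  have : 0 < x3 * (a - x3) by rewrite mulr_gt0 // subr_gt0.
  have : 0 <= (a - x3) ^+ 2 by rewrite sqr_ge0.
  by nra.
Qed.

End WaveSecond.

(** * Second-order equations *)

Section SecondOrder.
Context {R : realType}.
Implicit Types q y z : R -> R.

Definition sol2 q X y y1 : Prop := forall x, 0 <= x <= X ->
  has_der x y (y1 x) /\ has_der x y1 (q x * y x).

Lemma cont_eq0_right (f : R -> R) a b : a < b -> {for a, continuous f} ->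
  (forall x, a < x < b -> f x = 0) -> f a = 0.
Proof.
move=> ab cf f0; apply/eqP; apply: contraT => fa.
have fa0 : 0 < `|f a| by rewrite normr_gt0.
have /cvgrPdist_lt/(_ _ fa0) [e e0 H] := cf.
pose x := a + Num.min (e / 2) ((b - a) / 2).
have ba : 0 < b - a by rewrite subr_gt0.
have m0 : 0 < Num.min (e / 2) ((b - a) / 2) by rewrite lt_min !divr_gt0.
have m1 : Num.min (e / 2) ((b - a) / 2) <= e / 2 by rewrite ge_min lexx.
have m2 : Num.min (e / 2) ((b - a) / 2) <= (b - a) / 2 by rewrite ge_min lexx orbT.
have e0' : 0 < e by [].
have /= := H x; rewrite (f0 x) ?subr0 ?ltxx; last by rewrite /x; lra.
by apply; rewrite /= /x opprD addrA subrr add0r normrN gtr0_norm //; lra.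
Qed.

Lemma sys2_bound q b X y y1 (m B : R) : 0 <= m -> 0 <= B ->
  (forall x, 0 <= x <= X -> has_der x y (y1 x) /\ has_der x y1 (q x * y x + b x)) ->
  (forall x, 0 <= x <= X -> `|q x| <= m) ->
  (forall x, 0 <= x <= X -> `|b x| <= B) ->
  forall x, 0 <= x <= X ->
  y x ^+ 2 + y1 x ^+ 2 <= (y 0 ^+ 2 + y1 0 ^+ 2 + B ^+ 2 * x) * expR ((2 + m) * x).
Proof.
move=> m0 B0 H qm bB.
apply: (@gronwall R (fun x => y x ^+ 2 + y1 x ^+ 2)
  (fun x => 2 * y x * y1 x + 2 * y1 x * (q x * y x + b x))) => //.
- by rewrite addr_ge0.
- exact: sqr_ge0.
- move=> x xX; have [dy dy1] := H x xX.
  by apply: (der_eq (derD (derXn 2 dy) (derXn 2 dy1))); rewrite /= !expr1.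
move=> x xX; have := qm x xX; rewrite ler_norml => /andP[q1 q2].
have := bB x xX; rewrite ler_norml => /andP[b1 b2].
have h1 : 0 <= (m - q x) * (y x + y1 x) ^+ 2 by rewrite mulr_ge0 ?sqr_ge0 // subr_ge0.
have h2 : 0 <= (m + q x) * (y x - y1 x) ^+ 2.
  by rewrite mulr_ge0 ?sqr_ge0 // -lerBlDl sub0r.
have h3 : 0 <= (y1 x - b x) ^+ 2 by rewrite sqr_ge0.
have h4 : 0 <= (B - b x) * (B + b x).
  by apply: mulr_ge0; rewrite ?subr_ge0 // -lerBlDl sub0r.
have h5 : 0 <= (y x - y1 x) ^+ 2 by rewrite sqr_ge0.
have h6 : 0 <= y x ^+ 2 by rewrite sqr_ge0.
move: (q x) (b x) (y x) (y1 x) h1 h2 h3 h4 h5 h6 => Q b' Y Y1; lra.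
Qed.

(** The product of y^2 + y1^2 with exp((1 + m) x) is nondecreasing, so a normalized solution stays
    uniformly away from 0 in the phase plane; [sturm_separation] needs this lower bound. *)
Lemma sys2_lower q X y y1 (m : R) : 0 <= m -> sol2 q X y y1 ->
  (forall x, 0 <= x <= X -> `|q x| <= m) ->
  forall x, 0 <= x <= X ->
  (y 0 ^+ 2 + y1 0 ^+ 2) * expR (- (1 + m) * x) <= y x ^+ 2 + y1 x ^+ 2.
Proof.
move=> m0 H qm x /andP[x0 xX].
pose k := 1 + m.
have ex t : has_der t (fun t => expR (k * t)) (k * expR (k * t)).
  have dk := derM (derC t k) (derX t).
  by apply: (der_eq (derComp (der_expR _) dk)); rewrite /=; ring.
have : (y 0 ^+ 2 + y1 0 ^+ 2) * expR (k * 0) <= (y x ^+ 2 + y1 x ^+ 2) * expR (k * x).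
  apply: (@antider_le _ (fun x => (y x ^+ 2 + y1 x ^+ 2) * expR (k * x))
    (fun x => (k * (y x ^+ 2 + y1 x ^+ 2) + 2 * y x * y1 x + 2 * y1 x * (q x * y x)) * expR (k * x))) => [//|t|t].
    move=> /andP[t0 tx]; have [|dy dy1] := H t; first by rewrite t0 (le_trans tx).
    by apply: (der_eq (derM (derD (derXn 2 dy) (derXn 2 dy1)) (ex t))); rewrite /=; ring.
  move=> /andP[t0 tx]; have tX : 0 <= t <= X by rewrite (ltW t0) (le_trans (ltW tx)).
  rewrite mulr_ge0 ?expR_ge0 //.
  have := qm t tX; rewrite ler_norml => /andP[q1 q2].
  have h1 : 0 <= (m - q t) * (y t - y1 t) ^+ 2 by rewrite mulr_ge0 ?sqr_ge0 // subr_ge0.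
  have h2 : 0 <= (m + q t) * (y t + y1 t) ^+ 2.
    by rewrite mulr_ge0 ?sqr_ge0 // -lerBlDl sub0r.
  have h5 : 0 <= (y t + y1 t) ^+ 2 by rewrite sqr_ge0.
  by rewrite /k; move: (q t) (y t) (y1 t) h1 h2 h5 => Q Y Y1; lra.
rewrite mulr0 expR0 mulr1 mulNr -/k expRN => h.
by rewrite ler_pdivrMr ?expR_gt0.
Qed.

Lemma sol2_uniq q X y y1 z z1 (m : R) : 0 <= m ->
  (forall x, 0 <= x <= X -> `|q x| <= m) ->
  sol2 q X y y1 -> sol2 q X z z1 -> y 0 = z 0 -> y1 0 = z1 0 ->
  forall x, 0 <= x <= X -> y x = z x /\ y1 x = z1 x.
Proof.
move=> m0 qm Hy Hz e0 e1 x xX.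
have H : y x - z x = 0 /\ y1 x - z1 x = 0.
  have := @sys2_bound q (fun=> 0) X (fun x => y x - z x) (fun x => y1 x - z1 x) m 0 m0 (lexx 0) _ qm _ x xX.
  rewrite e0 e1 !subrr expr0n /= !add0r mul0r mul0r => le.
  have {le} le : (y x - z x) ^+ 2 + (y1 x - z1 x) ^+ 2 <= 0.
    apply: le => [t tX|t _]; last by rewrite normr0.
    have [dy dy1] := Hy t tX; have [dz dz1] := Hz t tX.
    split; first exact: derD dy (derN dz).
    by apply: (der_eq (derD dy1 (derN dz1))); ring.
  have : (y x - z x) ^+ 2 + (y1 x - z1 x) ^+ 2 == 0.
    by rewrite eq_le le addr_ge0 ?sqr_ge0.
  by rewrite paddr_eq0 ?sqr_ge0 // !sqrf_eq0 => /andP[/eqP -> /eqP ->].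
by case: H => /subr0_eq -> /subr0_eq ->.
Qed.

Lemma sol2_comb q X y y1 z z1 a b : sol2 q X y y1 -> sol2 q X z z1 ->
  sol2 q X (fun x => a * y x + b * z x) (fun x => a * y1 x + b * z1 x).
Proof.
move=> Hy Hz x xX; have [dy dy1] := Hy x xX; have [dz dz1] := Hz x xX.
split.
  by apply: (der_eq (derD (derM (derC x a) dy) (derM (derC x b) dz))); ring.
by apply: (der_eq (derD (derM (derC x a) dy1) (derM (derC x b) dz1))); ring.
Qed.

Lemma sol2_exists q (m : R) a b : continuous q -> (forall x, `|q x| <= m) ->
  exists y y1, [/\ y 0 = a, y1 0 = b &
    forall x, has_der x y (y1 x) /\ has_der x y1 (q x * y x)].
Proof.
move=> cq qm.
pose M (i j : 'I_2) (t : R) : R :=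
  if i == 0 then (if j == 0 then 0 else 1) else (if j == 0 then q t else 0).
have cM i j : continuous (M i j).
  by rewrite /M; case: (i == 0); case: (j == 0) => x; first [exact: contC|exact: cq].
have m0 : 0 <= m by apply: le_trans (qm 0).
have bM i j t : `|M i j t| <= m + 1.
  rewrite /M; do 2 case: ifP => _; rewrite ?normr0 ?normr1 ?addr_ge0 ?lerDr //.
  by rewrite (le_trans (qm t)) // lerDl.
have b0 (i : 'I_2) (t : R) : `|0 : R| <= 0 by rewrite normr0.
have [Y [Y0 odeY]] := @ode_exists R 2 M (fun _ _ => 0) (m + 1) 0 cM
  (fun _ x => @contC R 0 x) bM b0
  (fun i => if i == 0 then a else b).
exists (Y 0), (Y 1); split; rewrite ?Y0 // => x.
have H0 := odeY x 0; have H1 := odeY x 1.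
split; [apply: (der_eq H0)|apply: (der_eq H1)]; rewrite !big_ord_recl big_ord0 /M /= !addr0.
  by rewrite mul0r mul1r add0r; congr (Y _ x); apply/val_inj.
by rewrite mul0r addr0; congr (_ * Y _ x); apply/val_inj.
Qed.

End SecondOrder.

(** * Sturm comparison on a half period *)

(* [p] and [u] span the kernel of [- s d^2/dx^2 + V]; [p] is the Dirichlet ground state
   on [0, l], and the signs of [u] and [u1] at [l] make the second Neumann eigenvalue
   positive. *)
Record sturm_pair {R : realType} (s l m : R) (V p p1 u u1 : R -> R) : Prop := SturmPair {
  sturm_s : 0 < s;
  sturm_l : 0 < l;
  sturm_cont : continuous V;
  sturm_bound : forall x, `|V x| <= m;
  sturm_p : forall x, has_der x p (p1 x) /\ has_der x p1 (V x / s * p x);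
  sturm_u : forall x, has_der x u (u1 x) /\ has_der x u1 (V x / s * u x);
  sturm_p0 : p 0 = 0;
  sturm_pl : p l = 0;
  sturm_p_lt0 : forall x, 0 < x < l -> p x < 0;
  sturm_p10 : p1 0 != 0;
  sturm_p1l : p1 l != 0;
  sturm_u0 : 0 < u 0;
  sturm_u10 : u1 0 = 0;
  sturm_ul : u l < 0;
  sturm_u1l : u1 l < 0 }.

Section Sturm.
Context {R : realType}.
Variables (s l m : R) (V p p1 u u1 : R -> R).
Hypothesis H : sturm_pair s l m V p p1 u u1.

Let s0 := sturm_s H.
Let l0 := sturm_l H.
Let sn0 : s != 0. Proof. by rewrite gt_eqF // s0. Qed.

Definition sturm_q (lam x : R) : R := (V x - lam) / s.

Lemma sturm_m_ge0 : 0 <= m.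
Proof. exact: le_trans (normr_ge0 (V 0)) (sturm_bound H 0). Qed.

Lemma sturm_q_bound lam x : `|sturm_q lam x| <= (m + `|lam|) / s.
Proof.
rewrite normrM [`|s^-1|]gtr0_norm ?invr_gt0 // ler_pM2r ?invr_gt0 //.
by rewrite (le_trans (ler_normB _ _)) // lerD2r (sturm_bound H).
Qed.

Let qm_ge0 (lam : R) : 0 <= (m + `|lam|) / s.
Proof. by rewrite divr_ge0 ?(ltW s0) // addr_ge0 // sturm_m_ge0. Qed.

Lemma sturm_q_cont lam : continuous (sturm_q lam).
Proof.
suff cq : continuous (fun x => (V x - lam) * s^-1) by exact: cq.
move=> x; apply: (@contM _ (fun x => V x - lam)); last exact: contC.
by apply: contB; [exact: (sturm_cont H)|exact: contC].
Qed.

Let sol_p X : sol2 (sturm_q 0) X p p1.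
Proof. by move=> x _; rewrite /sturm_q subr0; exact: (sturm_p H x). Qed.
Let sol_u X : sol2 (sturm_q 0) X u u1.
Proof. by move=> x _; rewrite /sturm_q subr0; exact: (sturm_u H x). Qed.

Lemma sturm_uniq lam X y y1 z z1 : sol2 (sturm_q lam) X y y1 -> sol2 (sturm_q lam) X z z1 ->
  y 0 = z 0 -> y1 0 = z1 0 -> forall x, 0 <= x <= X -> y x = z x /\ y1 x = z1 x.
Proof. by apply: sol2_uniq (qm_ge0 lam) _ => x _; exact: sturm_q_bound. Qed.

Lemma sturm_zero lam X y y1 : sol2 (sturm_q lam) X y y1 ->
  y 0 = 0 -> y1 0 = 0 -> forall x, 0 <= x <= X -> y x = 0 /\ y1 x = 0.
Proof.
move=> Hy e0 e1; apply: (sturm_uniq Hy (z := fun=> 0) (z1 := fun=> 0)) => //.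
by move=> x _; split; [exact: derC|apply: (der_eq (derC _ _)); rewrite mulr0].
Qed.

(* Picone's identity *)
Lemma dirichlet_neg lam d d1 : lam < 0 -> sol2 (sturm_q lam) l d d1 ->
  d 0 = 0 -> d l = 0 -> forall x, 0 < x < l -> d x = 0.
Proof.
move=> lam0 Hd d0 dl.
pose W x := d1 x * p x - d x * p1 x.
(* The derivative of [K] is W^2 / p^2 - (lam / s) d^2, a sum of two nonnegative terms. Since [K]
   vanishes at both ends it is identically 0, and so is d. At the ends d and p vanish together, W
   vanishes as well, and [quot_cont] applies. *)
pose K x := W x * (d x / p x).
have dW x : 0 <= x <= l -> has_der x W (- (lam / s) * (d x * p x)).
  move=> xl; have [hd hd1] := Hd x xl; have [hp hp1] := sturm_p H x.
  apply: (der_eq (derD (derM hd1 hp) (derN (derM hd hp1)))).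
  by rewrite /sturm_q; field.
have pn0 x : 0 < x < l -> p x != 0 by move=> xl; rewrite lt_eqF ?(sturm_p_lt0 H).
have dK x : 0 < x < l -> has_der x K (W x ^+ 2 / p x ^+ 2 - lam / s * d x ^+ 2).
  move=> xl; have xl' : 0 <= x <= l by case/andP: xl => /ltW -> /ltW ->.
  have [hd hd1] := Hd x xl'; have [hp hp1] := sturm_p H x.
  apply: (der_eq (derM (dW x xl') (derM hd (derV hp (pn0 x xl))))).
  by rewrite /W; field; rewrite ?sn0 ?pn0.
have cK x : 0 <= x <= l -> {for x, continuous K}.
  move=> xl; have [hd hd1] := Hd x xl; have [hp hp1] := sturm_p H x.
  have cW := der_cont (dW x xl).
  case/andP: (xl) => x0 xl'.
  have [xe|xn0] := eqVneq x 0.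
    by rewrite xe in hd hp cW *; apply: (quot_cont hd hp); rewrite ?(sturm_p0 H) ?(sturm_p10 H) //
      /W d0 (sturm_p0 H) mul0r mulr0 subrr.
  have [xe|xnl] := eqVneq x l.
    by rewrite xe in hd hp cW *; apply: (quot_cont hd hp); rewrite ?(sturm_pl H) ?(sturm_p1l H) //
      /W dl (sturm_pl H) mul0r mulr0 subrr.
  apply: der_cont (dK x _); rewrite !lt_neqAle eq_sym xn0 x0 xnl xl'.
  by [].
have K'0 x : 0 < x < l -> 0 <= W x ^+ 2 / p x ^+ 2 - lam / s * d x ^+ 2.
  move=> xl; rewrite addr_ge0 ?divr_ge0 ?sqr_ge0 // -mulNr mulr_ge0 ?sqr_ge0 //.
  by rewrite -mulNr divr_ge0 ?(ltW s0) // oppr_ge0 ltW.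
have K0 : K 0 = 0 by rewrite /K d0 mul0r mulr0.
have Kl : K l = 0 by rewrite /K dl mul0r mulr0.
have Kx x : 0 < x < l -> K x = 0.
  move=> /andP[x0 xl]; apply/eqP; rewrite eq_le; apply/andP; split.
    rewrite -Kl; apply: (mono_le (ltW xl)) => [t /andP[tx tl]|t /andP[tx tl]|t /andP[tx tl]].
    - by apply: cK; rewrite tl (le_trans (ltW x0)).
    - by apply: dK; rewrite tl (lt_trans x0).
    - by apply: K'0; rewrite tl (lt_trans x0).
  rewrite -K0; apply: (mono_le (ltW x0)) => [t /andP[t0 tx]|t /andP[t0 tx]|t /andP[t0 tx]].
  - by apply: cK; rewrite t0 (le_trans tx) // ltW.
  - by apply: dK; rewrite t0 (lt_trans tx).
  - by apply: K'0; rewrite t0 (lt_trans tx).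
move=> x xl; have := dK x xl.
have D0 : has_der x K 0.
  apply: (der_near _ (derC x 0)); near=> t; apply/esym/Kx.
  by apply/andP; split; near: t; [apply: lt_nbhsr|apply: lt_nbhsl]; case/andP: xl.
move/(der_uniq D0)/esym/eqP; rewrite paddr_eq0 ?divr_ge0 ?sqr_ge0 //; last first.
  by rewrite -mulNr mulr_ge0 ?sqr_ge0 // -mulNr divr_ge0 ?(ltW s0) // oppr_ge0 ltW.
case/andP => _; rewrite oppr_eq0 mulf_eq0 sqrf_eq0 => /orP[|/eqP //].
by rewrite mulf_eq0 invr_eq0 (negbTE sn0) (lt_eqF lam0).
Unshelve. all: by end_near. Qed.

Lemma dirichlet_zero d d1 X : sol2 (sturm_q 0) X d d1 -> d 0 = 0 ->
  forall x, 0 <= x <= X -> d x = d1 0 / p1 0 * p x.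
Proof.
move=> Hd d0 x xX.
have := sturm_uniq Hd (sol2_comb (d1 0 / p1 0) 0 (@sol_p X) (@sol_p X)).
rewrite /= d0 (sturm_p0 H) !mulr0 mul0r addr0 addr0 divfK ?(sturm_p10 H) //.
by move=> /(_ erefl erefl x xX) [-> _]; rewrite mul0r addr0.
Qed.

(** A solution with w1 0 = 0 is a multiple of u, and u1 does not vanish at l. *)
Lemma neumann_zero w w1 : sol2 (sturm_q 0) l w w1 -> w1 0 = 0 -> w1 l = 0 ->
  w 0 = 0.
Proof.
move=> Hw w0 wl.
have := sturm_uniq Hw (sol2_comb (w 0 / u 0) 0 (@sol_u l) (@sol_u l)).
have u0 : u 0 != 0 by rewrite gt_eqF ?(sturm_u0 H).
rewrite /= (sturm_u10 H) w0 !mulr0 mul0r addr0 addr0 divfK //.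
move=> /(_ erefl erefl l); rewrite (ltW l0) lexx => /(_ isT) [_].
rewrite wl mul0r addr0 => /esym/eqP; rewrite !mulf_eq0 invr_eq0 (negbTE u0) orbF.
by rewrite (lt_eqF (sturm_u1l H)) orbF => /eqP.
Qed.

Lemma sturm_u_root : exists x0, [/\ 0 < x0 < l, u x0 = 0, u1 x0 != 0 &
  forall x, 0 <= x <= l -> x != x0 -> u x != 0].
Proof.
have du x := (sturm_u H x).1; have du1 x := (sturm_u H x).2.
have dp x := (sturm_p H x).1; have dp1 x := (sturm_p H x).2.
have ul := sturm_ul H; have u0 := sturm_u0 H.
have [x0 x0l ux0] : exists2 x0, x0 \in `[0, l] & u x0 = 0.
  apply: IVT; first exact: ltW.
    by apply: seg_cont => x _; exact: der_cont (du x).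
  by rewrite ge_min le_max (ltW ul) (ltW u0) orbT.
move: x0l; rewrite in_itv /= => /andP[x00 x0l].
have x0i : 0 < x0 < l.
  rewrite !lt_neqAle x00 x0l !andbT; apply/andP; split.
    by apply: contraTneq u0 => e; rewrite [X in u X]e ux0 ltxx.
  by apply: contraTneq ul => e; rewrite -e ux0 ltxx.
(* The Wronskian is a nonzero constant; at a zero of u it reduces to u1 p, so that zero is
   simple. *)
pose C x := u1 x * p x - u x * p1 x.
have C0 x : 0 <= x -> C x = - u 0 * p1 0.
  move=> x1; have -> : - u 0 * p1 0 = C 0 by rewrite /C (sturm_p0 H) mulr0 sub0r mulNr.
  apply/esym; apply: (der0_cst x1) => t _.
  by apply: (der_eq (derD (derM (du1 t) (dp t)) (derN (derM (du t) (dp1 t))))); ring.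
have Cn0 : - u 0 * p1 0 != 0 by rewrite mulf_neq0 ?oppr_eq0 ?(gt_eqF u0) ?(sturm_p10 H).
have pn0 x : 0 < x < l -> p x != 0 by move=> xl; rewrite lt_eqF ?(sturm_p_lt0 H).
exists x0; split => //.
  have := C0 x0 x00; rewrite /C ux0 mul0r subr0 => E.
  by apply: contraNneq Cn0 => e; rewrite -E e mul0r.
(* [u / p] is strictly monotone, its derivative being a constant over [p ^ 2] *)
have two x y : 0 < x -> x < y -> y < l -> u x = 0 -> u y = 0 -> False.
  move=> x1 xy yl ux uy.
  have inn t : x <= t <= y -> 0 < t < l.
    by move=> /andP[xt ty]; rewrite (lt_le_trans x1) // (le_lt_trans ty).
  have dup t : x <= t <= y -> has_der t (fun t => u t / p t) (- u 0 * p1 0 / p t ^+ 2).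
    move=> /inn ti; have ti' := pn0 t ti.
    have t0 : 0 <= t by case/andP: ti => /ltW.
    apply: (der_eq (derM (du t) (derV (dp t) ti'))).
    by rewrite -(C0 t t0) /C; field.
  have [c xcy] : exists2 c, x < c < y & u y / p y - u x / p x = - u 0 * p1 0 / p c ^+ 2 * (y - x).
    apply: (@mean_value _ (fun t => u t / p t) (fun t => - u 0 * p1 0 / p t ^+ 2) x y xy)
      => t ht; first exact: der_cont (dup t ht).
    by apply: dup; case/andP: ht => /ltW -> /ltW ->.
  rewrite ux uy !mul0r subrr => /esym/eqP; rewrite mulf_eq0 subr_eq0 (gt_eqF xy) orbF.
  rewrite mulf_eq0 (negbTE Cn0) /= invr_eq0 sqrf_eq0.
  have cB : x <= c <= y by case/andP: xcy => /ltW -> /ltW ->.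
  by rewrite (negbTE (pn0 c (inn c cB))).
move=> x /andP[x1 xl] xx0; apply/eqP => ux.
have x2 : 0 < x by rewrite lt_neqAle x1 andbT; apply: contraTneq u0 => e; rewrite [X in u X]e ux ltxx.
have x3 : x < l by rewrite lt_neqAle xl andbT; apply: contraTneq ul => e; rewrite -e ux ltxx.
case/andP: x0i => x01 x02.
by case: (ltgtP x x0) xx0 => // h _; [apply: (two x x0)|apply: (two x0 x)].
Qed.

(* On the span of two Neumann eigenfunctions the energy is negative definite, while
   it is nonnegative on the functions vanishing at the zero of [u]. *)
Lemma neumann_neg_uniq lam mu w w1 v v1 : lam < 0 -> mu < 0 -> lam != mu ->
  sol2 (sturm_q lam) l w w1 -> sol2 (sturm_q mu) l v v1 ->
  w1 0 = 0 -> w1 l = 0 -> v1 0 = 0 -> v1 l = 0 -> w 0 != 0 -> v 0 != 0 -> False.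
Proof.
move=> lam0 mu0 lm Hw Hv w10 w1l v10 v1l wn vn.
have [x0 [x0i ux0 u1x0 unz]] := sturm_u_root.
case/andP: (x0i) => x00 x0l.
have ul := sturm_ul H; have u1l := sturm_u1l H; have u0 := sturm_u0 H.
(* Two eigenfunctions span a plane, and one linear condition leaves a nontrivial combination z that
   vanishes at the zero of u. *)
have [a [b [ab zx0]]] : exists a b, (a != 0) || (b != 0) /\ a * w x0 + b * v x0 = 0.
  have [v0|v0] := eqVneq (v x0) 0.
    by exists 0, 1; rewrite oner_neq0 orbT v0 mul0r mulr0 addr0.
  by exists (v x0), (- w x0); rewrite v0; split => //; ring.
pose z x := a * w x + b * v x; pose z1 x := a * w1 x + b * v1 x.
(* The Wronskian of w and v has derivative (lam - mu) w v / s; with this factor it cancels the mixed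
   term a b (lam + mu) w v in the derivative of [N]. *)
pose c := a * b * (lam + mu) / (lam - mu).
pose g x := z x * (z x / u x).
(* Jacobi's completion of the square: subtracting s u1 z^2 / u turns s z1^2 + V z^2 into s (z1 - z
   u1 / u)^2. The quotient z^2 / u is continuous at the zero of u because z vanishes there and this
   zero is simple. *)
pose N x := s * (z x * z1 x) - s * (u1 x * g x) + c * (s * (w x * v1 x - w1 x * v x)).
pose N1 x := s * (z1 x - z x * u1 x / u x) ^+ 2 - lam * (a * w x) ^+ 2 - mu * (b * v x) ^+ 2.
have lm0 : lam - mu != 0 by rewrite subr_eq0.
have dz x : 0 <= x <= l -> has_der x z (z1 x).
  move=> xl; have [dw _] := Hw x xl; have [dv _] := Hv x xl.
  by apply: (der_eq (derD (derM (derC x a) dw) (derM (derC x b) dv))); rewrite /z1; ring.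
have dz1 x : 0 <= x <= l -> has_der x z1 ((V x * z x - lam * (a * w x) - mu * (b * v x)) / s).
  move=> xl; have [_ dw] := Hw x xl; have [_ dv] := Hv x xl.
  apply: (der_eq (derD (derM (derC x a) dw) (derM (derC x b) dv))).
  by rewrite /z /sturm_q; field.
have dQ x : 0 <= x <= l -> has_der x (fun x => w x * v1 x - w1 x * v x) ((lam - mu) / s * (w x * v x)).
  move=> xl; have [dw dw1] := Hw x xl; have [dv dv1] := Hv x xl.
  apply: (der_eq (derD (derM dw dv1) (derN (derM dw1 dv)))).
  by rewrite /sturm_q; field.
have dN x : 0 <= x <= l -> x != x0 -> has_der x N (N1 x).
  move=> xl xn; have un := unz x xl xn; have [du du1] := sturm_u H x.
  have dg := derM (dz x xl) (derM (dz x xl) (derV du un)).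
  apply: (der_eq (derD (derD (derM (derC x s) (derM (dz x xl) (dz1 x xl)))
    (derN (derM (derC x s) (derM du1 dg))))
    (derM (derC x c) (derM (derC x s) (dQ x xl))))).
  rewrite /N1 /c; have -> : z x = a * w x + b * v x by [].
  by field; rewrite un sn0 lm0.
have cN x : 0 <= x <= l -> {for x, continuous N}.
  move=> xl; have [xe|xn] := eqVneq x x0; last exact: der_cont (dN x xl xn).
  have cg : {for x, continuous g}.
    rewrite xe in xl *; have [du _] := sturm_u H x0.
    exact: (quot_cont (dz x0 xl) du zx0 ux0 u1x0 (der_cont (dz x0 xl)) zx0).
  have [_ du1] := sturm_u H x.
  have c1 := contM (@contC R s x) (contM (der_cont (dz x xl)) (der_cont (dz1 x xl))).
  have c2 := contM (@contC R s x) (contM (der_cont du1) cg).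
  have c3 := contM (@contC R c x) (contM (@contC R s x) (der_cont (dQ x xl))).
  exact: (contD (contB c1 c2) c3).
have N1ge x : 0 <= N1 x.
  have h0 : 0 <= s * (z1 x - z x * u1 x / u x) ^+ 2 by rewrite mulr_ge0 ?sqr_ge0 // ltW.
  have h1 : 0 <= - lam * (a * w x) ^+ 2 by rewrite mulr_ge0 ?sqr_ge0 // oppr_ge0 ltW.
  have h2 : 0 <= - mu * (b * v x) ^+ 2 by rewrite mulr_ge0 ?sqr_ge0 // oppr_ge0 ltW.
  by move: h0 h1 h2; rewrite /N1 !mulNr; move: (s * _) (lam * _) (mu * _) => ? ? ?; lra.
have N0 : N 0 = 0.
  by rewrite /N /z1 w10 v10 (sturm_u10 H); ring.
(* Here u and u1 having the same sign at l is decisive: the Neumann conditions leave only - s z^2 u1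
   / u. *)
have Nl : N l <= 0.
  rewrite /N /z1 /g w1l v1l !mulr0 !mul0r addr0 mulr0 mulr0 subrr mulr0 mulr0 sub0r addr0.
  rewrite oppr_le0 mulr_ge0 ?(ltW s0) //.
  rewrite [u1 l * _](_ : _ = z l ^+ 2 * (u1 l / u l)); last by ring.
  rewrite mulr_ge0 ?sqr_ge0 // -mulrNN -invrN ltW // divr_gt0 // oppr_gt0 //.
(* [N] need not be differentiable at x0, so the interval has to lie on one side of it; continuity
   joins the two sides. *)
have mono x y : 0 <= x -> x <= y -> y <= l -> y <= x0 \/ x0 <= x -> N x <= N y.
  move=> x1 xy yl side; apply: (mono_le (df := N1) xy) => [t /andP[xt ty]|t /andP[xt ty]|t _ //].
    by apply: cN; rewrite (le_trans x1) // (le_trans ty).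
  apply: dN; first by rewrite (le_trans x1 (ltW xt)) (le_trans (ltW ty)).
  by case: side => h; [rewrite lt_eqF // (lt_le_trans ty)|rewrite gt_eqF // (le_lt_trans h)].
have Nx x : 0 <= x <= x0 -> N x = 0.
  move=> /andP[x1 xx0]; apply/eqP; rewrite eq_le; apply/andP; split.
    apply: (le_trans (mono x x0 x1 xx0 (ltW x0l) (or_introl (lexx _)))).
    exact: (le_trans (mono x0 l (ltW x00) (ltW x0l) (lexx _) (or_intror (lexx _)))).
  by rewrite -N0; apply: mono => //; [exact: le_trans (ltW x0l)|left].
have aw_bv x : 0 < x < x0 -> a * w x = 0 /\ b * v x = 0.
  move=> /andP[x1 xx0].
  have D0 : has_der x N 0.
    apply: (der_near _ (derC x 0)); near=> t; apply/esym/Nx.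
    by apply/andP; split; apply: ltW; near: t; [apply: lt_nbhsr|apply: lt_nbhsl].
  have xl : 0 <= x <= l by rewrite (ltW x1) (ltW (lt_trans xx0 x0l)).
  have := der_uniq D0 (dN x xl (negbT (lt_eqF xx0))).
  have h0 : 0 <= s * (z1 x - z x * u1 x / u x) ^+ 2 by rewrite mulr_ge0 ?sqr_ge0 // ltW.
  have h1 : 0 <= - lam * (a * w x) ^+ 2 by rewrite mulr_ge0 ?sqr_ge0 // oppr_ge0 ltW.
  have h2 : 0 <= - mu * (b * v x) ^+ 2 by rewrite mulr_ge0 ?sqr_ge0 // oppr_ge0 ltW.
  move: h0 h1 h2; rewrite /N1 !mulNr; move: (s * _) => S h0 h1 h2 N0'.
  have : lam * (a * w x) ^+ 2 = 0.
    by move: (lam * _) (mu * _) h1 h2 N0' => ? ? ? ?; lra.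
  have : mu * (b * v x) ^+ 2 = 0.
    by move: (lam * _) (mu * _) h1 h2 N0' => ? ? ? ?; lra.
  move=> /eqP; rewrite mulf_eq0 (lt_eqF mu0) sqrf_eq0 => /eqP ->.
  by move=> /eqP; rewrite mulf_eq0 (lt_eqF lam0) sqrf_eq0 => /eqP ->.
have l00 : 0 <= (0 : R) <= l by rewrite lexx ltW.
have [dw _] := Hw 0 l00; have [dv _] := Hv 0 l00.
case/orP: ab => [an|bn].
  have := @cont_eq0_right R (fun x => a * w x) 0 x0 x00
    (contM (@contC R a 0) (der_cont dw)) (fun x hx => (aw_bv x hx).1).
  by move/eqP; rewrite mulf_eq0 (negbTE an) (negbTE wn).
have := @cont_eq0_right R (fun x => b * v x) 0 x0 x00
  (contM (@contC R b 0) (der_cont dv)) (fun x hx => (aw_bv x hx).2).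
by move/eqP; rewrite mulf_eq0 (negbTE bn) (negbTE vn).
Unshelve. all: by end_near. Qed.

End Sturm.

(** * Periodic solutions *)

Section Periodic.
Context {R : realType}.
Variables (s l m : R) (V p p1 u u1 : R -> R).
Hypothesis H : sturm_pair s l m V p p1 u u1.
Hypothesis Vsym : forall x, V (2 * l - x) = V x.

Let s0 := sturm_s H.
Let l0 := sturm_l H.
Let m0 := sturm_m_ge0 H.
Notation q := (sturm_q s V).

Definition psol lam y y1 : Prop :=
  [/\ sol2 (q lam) (2 * l) y y1, y (2 * l) = y 0 & y1 (2 * l) = y1 0].

Definition neumann_type lam : Prop := exists f f1,
  [/\ sol2 (q lam) l f f1, f 0 = 1, f1 0 = 0 & f1 l = 0].
Definition dirichlet_type lam : Prop := exists f f1,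
  [/\ sol2 (q lam) l f f1, f 0 = 0, f1 0 = 1 & f l = 0].

Lemma sol2_reflect lam y y1 : sol2 (q lam) (2 * l) y y1 ->
  sol2 (q lam) (2 * l) (fun x => y (2 * l - x)) (fun x => - y1 (2 * l - x)).
Proof.
move=> Hy x /andP[x0 xl].
have rl : 0 <= 2 * l - x <= 2 * l by rewrite subr_ge0 xl gerBl x0.
have [dy dy1] := Hy _ rl.
have dr := derD (derC x (2 * l)) (derN (derX x)).
split; first by apply: (der_eq (derChain dr dy)); ring.
apply: (der_eq (derN (derChain dr dy1))).
by rewrite /sturm_q Vsym; ring.
Qed.

Lemma sol2_sub (f : R -> R) X X' y y1 : X' <= X -> sol2 f X y y1 -> sol2 f X' y y1.
Proof. by move=> XX Hy x /andP[x0 xX]; apply: Hy; rewrite x0 (le_trans xX). Qed.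

Let l_le : l <= 2 * l. Proof. by rewrite ler_peMl ?ler1n // ltW. Qed.
Let ll : 2 * l - l = l. Proof. by ring. Qed.

(** The even part of y under x -> 2 l - x has zero derivative at 0 and l, and is normalized by its
    value y 0. *)
Lemma psol_neumann lam y y1 : psol lam y y1 -> y 0 != 0 -> neumann_type lam.
Proof.
move=> [Hy yp yp1] y0; pose a := (2 * y 0)^-1.
have He := sol2_comb a a (sol2_sub l_le Hy) (sol2_sub l_le (sol2_reflect Hy)).
exists (fun x => a * y x + a * y (2 * l - x)), (fun x => a * y1 x + a * - y1 (2 * l - x)).
split => //; rewrite ?subr0 ?yp ?yp1 ?ll.
- by rewrite /a; field.
- by ring.
- by ring.
Qed.

(** The odd part of y under x -> 2 l - x vanishes at 0 and l, and is normalized by its derivative y1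
    0. *)
Lemma psol_dirichlet lam y y1 : psol lam y y1 -> y1 0 != 0 -> dirichlet_type lam.
Proof.
move=> [Hy yp yp1] y0; pose a := (2 * y1 0)^-1.
have He := sol2_comb a (- a) (sol2_sub l_le Hy) (sol2_sub l_le (sol2_reflect Hy)).
exists (fun x => a * y x + - a * y (2 * l - x)), (fun x => a * y1 x + - a * - y1 (2 * l - x)).
split => //; rewrite ?subr0 ?yp ?yp1 ?ll.
- by ring.
- by rewrite /a; field.
- by ring.
Qed.

Lemma psol_type lam y y1 : psol lam y y1 -> (exists2 x, 0 <= x <= 2 * l & y x != 0) ->
  neumann_type lam \/ dirichlet_type lam.
Proof.
move=> py [x xl yx]; have [Hy yp yp1] := py.
have [y0|y0] := eqVneq (y 0) 0; last by left; exact: psol_neumann py y0.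
have [y10|y10] := eqVneq (y1 0) 0; last by right; exact: psol_dirichlet py y10.
by move: yx; rewrite (sturm_zero H Hy y0 y10 xl).1 eqxx.
Qed.

Lemma dirichlet_type_nonneg lam : dirichlet_type lam -> 0 <= lam.
Proof.
move=> [f [f1 [Hf f0 f10 fl]]]; rewrite leNgt; apply/negP => lam0.
have fx := dirichlet_neg H lam0 Hf f0 fl.
have l00 : 0 <= (0 : R) <= l by rewrite lexx ltW.
have [_ df1] := Hf 0 l00.
suff : f1 0 = 0 by rewrite f10 => /eqP; rewrite oner_eq0.
apply: (cont_eq0_right l0 (der_cont df1)) => x xl.
have xl' : 0 <= x <= l by case/andP: xl => /ltW -> /ltW ->.
have [df _] := Hf x xl'; apply: (der_uniq df).
apply: (der_near _ (derC x 0)); near=> t; apply/esym/fx.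
by apply/andP; split; near: t; [apply: lt_nbhsr|apply: lt_nbhsl]; case/andP: xl.
Unshelve. all: by end_near. Qed.

Lemma psol_neg lam y y1 : lam < 0 -> psol lam y y1 -> y1 0 = 0.
Proof.
move=> lam0 py; apply: contraPeq lam0 => y10.
by apply/negP; rewrite -leNgt; exact: dirichlet_type_nonneg (psol_dirichlet py y10).
Qed.

Lemma neumann_type_uniq lam mu : lam < 0 -> mu < 0 ->
  neumann_type lam -> neumann_type mu -> lam = mu.
Proof.
move=> lam0 mu0 [f [f1 [Hf f0 f10 f1l]]] [g [g1 [Hg g0 g10 g1l]]].
apply/eqP; apply: contraT => lm; exfalso.
apply: (neumann_neg_uniq H lam0 mu0 lm Hf Hg) => //; by rewrite ?f0 ?g0 oner_neq0.
Qed.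

Lemma psol_zero y y1 : psol 0 y y1 ->
  forall x, 0 <= x <= 2 * l -> y x = y1 0 / p1 0 * p x.
Proof.
move=> py; have [Hy yp yp1] := py.
apply: dirichlet_zero H _ _ _ Hy _.
have [//|y0] := eqVneq (y 0) 0.
have [f [f1 [Hf f0 f10 f1l]]] := psol_neumann py y0.
by have := neumann_zero H Hf f10 f1l; rewrite f0 => /eqP; rewrite oner_eq0.
Qed.

Lemma cont_lip (f : R -> R) x (C : R) : (forall t, `|t - x| <= 1 -> `|f t - f x| <= C * `|t - x|) ->
  {for x, continuous f}.
Proof.
move=> fC; apply/cvgrPdist_le => e e0; near=> t.
have t1 : `|t - x| <= 1 by rewrite distrC; near: t; exact: cvgr_dist_le.
have te : `|t - x| <= e / (`|C| + 1).
  by rewrite distrC; near: t; apply: cvgr_dist_le => //; rewrite divr_gt0 // ltr_wpDl.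
rewrite distrC (le_trans (fC t t1)) //.
apply: (@le_trans _ _ ((`|C| + 1) * `|t - x|)).
  by rewrite ler_wpM2r // (le_trans (ler_norm C)) // lerDl.
by rewrite mulrC -ler_pdivlMr // ltr_wpDl.
Unshelve. all: by end_near. Qed.

Let half_bound (M x : R) : 0 <= M -> 0 <= x <= l -> expR ((2 + M) * x) <= expR ((2 + M) * l).
Proof. by move=> M0 /andP[_ xl]; rewrite ler_expR ler_wpM2l // addr_ge0. Qed.

Lemma sol2_le lam (M : R) f f1 : 0 <= M -> (forall x, `|q lam x| <= M) ->
  sol2 (q lam) l f f1 -> f 0 ^+ 2 + f1 0 ^+ 2 = 1 ->
  forall x, 0 <= x <= l -> f x ^+ 2 <= expR ((2 + M) * l).
Proof.
move=> M0 bq Hf f01 x xl.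
have := @sys2_bound R (q lam) (fun=> 0) l f f1 _ 0 M0 (lexx 0) _ (fun x _ => bq x) _ x xl.
rewrite f01 expr0n /= mul0r addr0 mul1r => h.
apply: (@le_trans _ _ (f x ^+ 2 + f1 x ^+ 2)); first by rewrite lerDl sqr_ge0.
apply: le_trans (h _ _) (half_bound M0 xl) => t tl; last by rewrite normr0.
by rewrite addr0; exact: Hf tl.
Qed.

(** The difference solves the equation for [lam] with the forcing (nu - lam) g / s and zero initial
    data, so Gronwall bounds it by a multiple of |lam - nu|. *)
Lemma sol2_diff lam nu (M : R) f f1 g g1 (E := expR ((2 + M) * l)) : 0 <= M ->
  (forall x, `|q lam x| <= M) -> (forall x, `|q nu x| <= M) ->
  sol2 (q lam) l f f1 -> sol2 (q nu) l g g1 -> f 0 = g 0 -> f1 0 = g1 0 ->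
  g 0 ^+ 2 + g1 0 ^+ 2 = 1 -> forall x, 0 <= x <= l ->
  (f x - g x) ^+ 2 + (f1 x - g1 x) ^+ 2 <= `|lam - nu| ^+ 2 * (s^-1 ^+ 2 * E * l * E).
Proof.
move=> M0 bl bn Hf Hg fg0 fg10 g01 x xl; pose B := `|lam - nu| / s * Num.sqrt E.
have B0 : 0 <= B by rewrite mulr_ge0 ?sqrtr_ge0 // divr_ge0 // ltW.
have := @sys2_bound R (q lam) (fun x => (nu - lam) / s * g x) l
  (fun x => f x - g x) (fun x => f1 x - g1 x) _ B M0 B0 _ (fun x _ => bl x) _ x xl.
rewrite fg0 fg10 !subrr expr0n /= !add0r => h; apply: le_trans (h _ _) _.
- move=> t tl; have [df df1] := Hf t tl; have [dg dg1] := Hg t tl.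
  split; first exact: derD df (derN dg).
  by apply: (der_eq (derD df1 (derN dg1))); rewrite /sturm_q; ring.
- move=> t tl; rewrite normrM /B normrM [`|s^-1|]gtr0_norm ?invr_gt0 // distrC ler_wpM2l //.
    by rewrite divr_ge0 // ltW.
  by rewrite -sqrtr_sqr ler_wsqrtr // (sol2_le M0 bn Hg g01).
have -> : `|lam - nu| ^+ 2 * (s^-1 ^+ 2 * E * l * E) = (B ^+ 2 * l) * E.
  by rewrite /B !exprMn sqr_sqrtr ?expR_ge0 //; ring.
have xx := xl; case/andP: xx => x0 xx; apply: ler_pM (half_bound M0 xl).
- by rewrite mulr_ge0 ?sqr_ge0.
- exact: expR_ge0.
- by rewrite ler_wpM2l ?sqr_ge0.
Qed.

(** Shooting: the derivative at l of the solution starting with value 1 and slope 0 depends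
    continuously on lam, is a positive multiple of [u1 l < 0] at lam = 0, and is positive far to the
    left. *)
Lemma neumann_exists : exists2 lam, lam < 0 & exists y y1,
  [/\ y 0 = 1, y1 0 = 0, y1 l = 0 & forall x, has_der x y (y1 x) /\ has_der x y1 (q lam x * y x)].
Proof.
have ex lam : exists Y : (R -> R) * (R -> R), [/\ Y.1 0 = 1, Y.2 0 = 0 &
    forall x, has_der x Y.1 (Y.2 x) /\ has_der x Y.2 (q lam x * Y.1 x)].
  have [y [y1 [y0 y10 Hy]]] := @sol2_exists R (q lam) ((m + `|lam|) / s) 1 0
     (@sturm_q_cont _ _ _ _ _ _ _ _ _ H lam) (sturm_q_bound H lam).
  by exists (y, y1).
have [Y HY] := choice ex.
have Y0 lam : (Y lam).1 0 = 1 by case: (HY lam).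
have Y10 lam : (Y lam).2 0 = 0 by case: (HY lam).
have sY lam X : sol2 (q lam) X (Y lam).1 (Y lam).2 by case: (HY lam) => _ _ h x _; exact: h.
pose G lam := (Y lam).2 l.
have ll0 : 0 <= l <= l by rewrite lexx ltW.
have cG : continuous G.
  move=> mu.
  pose M := (m + (`|mu| + 1)) / s; pose E := expR ((2 + M) * l).
  have M0 : 0 <= M by rewrite divr_ge0 ?(ltW s0) // !addr_ge0.
  have bq lam : `|lam| <= `|mu| + 1 -> forall x, `|q lam x| <= M.
    by move=> h x; rewrite (le_trans (sturm_q_bound H lam x)) // ler_pM2r ?invr_gt0 // lerD2l.
  apply: (@cont_lip _ _ (Num.sqrt (s^-1 ^+ 2 * E * l * E))) => lam lm.
  have bl : `|lam| <= `|mu| + 1.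
    by rewrite -(subrK mu lam) (le_trans (ler_normD _ _)) // addrC lerD2l.
  have bm : `|mu| <= `|mu| + 1 by rewrite lerDl.
  have := sol2_diff M0 (bq _ bl) (bq _ bm) (sY lam l) (sY mu l); rewrite !Y0 !Y10 expr1n expr0n addr0.
  move=> /(_ erefl erefl erefl l ll0) h.
  have E1 : 0 <= s^-1 ^+ 2 * E * l * E.
    by rewrite mulr_ge0 ?expR_ge0 // mulr_ge0 ?(ltW l0) // mulr_ge0 ?expR_ge0 ?sqr_ge0.
  rewrite -[leLHS]sqrtr_sqr -[`|lam - mu|]sqrtr_sqr -sqrtrM // ler_wsqrtr // mulrC.
  rewrite -[(lam - mu) ^+ 2]real_normK ?num_real //.
  by apply: le_trans h; rewrite lerDr sqr_ge0.
have G0 : G 0 < 0.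
  have un : u 0 != 0 by rewrite gt_eqF ?(sturm_u0 H).
  have su : sol2 (q 0) l u u1 by move=> x _; rewrite /sturm_q subr0; exact: (sturm_u H x).
  have := sturm_uniq H (sY 0 l) (sol2_comb (u 0)^-1 0 su su).
  rewrite Y0 Y10 /= (sturm_u10 H) !mulr0 mul0r !addr0 mulVf // => /(_ erefl erefl l ll0) [_].
  rewrite mul0r addr0 /G => ->.
  by rewrite pmulr_rlt0 ?invr_gt0 ?(sturm_u0 H) // (sturm_u1l H).
(* Below the range of V by at least 1, so the coefficient (V - lam0) / s is positive. *)
pose lam0 := - (m + 1).
have lam00 : lam0 < 0 by rewrite /lam0 oppr_lt0 ltr_wpDl.
have Glam0 : 0 < G lam0.
  pose y := (Y lam0).1; pose y1 := (Y lam0).2.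
  have q1 x : 0 < q lam0 x.
    have := sturm_bound H x; rewrite ler_norml => /andP[h _].
    by rewrite /sturm_q divr_gt0 // /lam0; lra.
  have dy x : has_der x y (y1 x) by case: (HY lam0) => _ _ h; case: (h x).
  have dy1 x : has_der x y1 (q lam0 x * y x) by case: (HY lam0) => _ _ h; case: (h x).
  (* The product y y1 starts at 0 and does not decrease, so y^2 stays above 1, y keeps its sign, and
     y1 increases strictly from 0. *)
  have yy1 x : 0 <= x -> 0 <= y x * y1 x.
    move=> x0; have <- : y 0 * y1 0 = 0 by rewrite /y1 Y10 mulr0.
    apply: (antider_le x0 (fun t _ => derM (dy t) (dy1 t))) => t _.
    have := q1 t; move: (q lam0 t) => Q Q0.
    have h1 : 0 <= y1 t ^+ 2 by exact: sqr_ge0.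
    have h2 : 0 <= Q * y t ^+ 2 by rewrite mulr_ge0 ?sqr_ge0 // ltW.
    by nra.
  have y2 x : 0 <= x -> 1 <= y x ^+ 2.
    move=> x0; have <- : y 0 ^+ 2 = 1 by rewrite /y Y0 expr1n.
    apply: (antider_le x0 (fun t _ => derXn 2 (dy t))) => t /andP[t0 _].
    by rewrite /= expr1 -mulrA mulr_ge0 // yy1 // ltW.
  have ypos x : 0 <= x -> 0 < y x.
    move=> x0; rewrite ltNge; apply/negP => yx.
    have [c c0 yc] : exists2 c, c \in `[0, x] & y c = 0.
      apply: IVT => //; first by apply: seg_cont => t _; exact: der_cont (dy t).
      by rewrite ge_min le_max yx /y Y0 ler01 orbT.
    move: c0; rewrite in_itv /= => /andP[c0 _].
    by have := y2 c c0; rewrite yc expr0n /= leNgt ltr01.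
  rewrite /G -/y1 -[ltLHS](Y10 lam0) -/y1.
  apply: (antider_lt l0 (fun t _ => dy1 t)) => t /andP[t0 _].
  by rewrite mulr_gt0 // ypos // ltW.
have [lam] : exists2 lam, lam \in `[lam0, 0] & G lam = 0.
  apply: IVT; [exact: ltW|exact: continuous_subspaceT|].
  by rewrite ge_min le_max (ltW G0) (ltW Glam0) orbT.
rewrite in_itv /= => /andP[_ lamle] Glam.
exists lam; last by exists (Y lam).1, (Y lam).2; split => //; case: (HY lam).
by rewrite lt_neqAle lamle andbT; apply: contraTneq G0 => e; rewrite -[X in G X]e Glam ltxx.
Qed.

(** The difference y(l + x) - y(l - x) solves an equation of the same form with zero initial data,
    so y is even about l; at x = l this gives periodicity. *)
Lemma neumann_psol lam y y1 : (forall x, has_der x y (y1 x) /\ has_der x y1 (q lam x * y x)) ->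
  y1 0 = 0 -> y1 l = 0 -> psol lam y y1.
Proof.
move=> Hy y10 y1l.
pose z x := y (l + x) - y (l - x); pose z1 x := y1 (l + x) + y1 (l - x).
pose ql x := q lam (l + x).
have zz : sol2 ql l z z1.
  move=> x _.
  have dp := derD (derC x l) (derX x); have dm := derD (derC x l) (derN (derX x)).
  have [a1 a2] := Hy (l + x); have [b1 b2] := Hy (l - x).
  split; first by apply: (der_eq (derD (derChain dp a1) (derN (derChain dm b1)))); rewrite /z1; ring.
  apply: (der_eq (derD (derChain dp a2) (derChain dm b2))); rewrite /z /ql /sturm_q.
  by have -> : V (l - x) = V (l + x); [rewrite -Vsym; congr V|]; ring.
have z00 : sol2 ql l (fun=> 0) (fun=> 0).
  by move=> x _; split; [exact: derC|apply: (der_eq (derC _ _)); rewrite mulr0].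
have mm : 0 <= (m + `|lam|) / s by rewrite divr_ge0 ?(ltW s0) // addr_ge0.
have := sol2_uniq mm (fun x _ => sturm_q_bound H lam (l + x)) zz z00.
rewrite /z /z1 !addr0 !subr0 subrr y1l addr0 => /(_ erefl erefl l).
rewrite lexx (ltW l0) => /(_ isT) []; rewrite subrr y10 addr0.
have -> : l + l = 2 * l by ring.
move=> /subr0_eq e1 e2; split; [by move=> x _; exact: Hy|exact: e1|].
by rewrite e2 y10.
Qed.

(** Solutions of the same type for different eigenvalues are orthogonal on [0, l], whereas for close
    eigenvalues the normalized solutions f and g are close, which would make the energy of f plus a
    large multiple of f g integrate to something positive. *)
Lemma sturm_separation (Lam : R) : exists2 eps : R, 0 < eps &
  forall lam mu f f1 g g1, `|lam| <= Lam -> `|mu| <= Lam -> `|lam - mu| < eps -> lam != mu ->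
  sol2 (q lam) l f f1 -> sol2 (q mu) l g g1 ->
  f 0 = g 0 -> f1 0 = g1 0 -> f 0 ^+ 2 + f1 0 ^+ 2 = 1 -> f 0 * f1 0 = 0 ->
  f l * f1 l = 0 -> f l * g1 l - f1 l * g l = 0 -> False.
Proof.
pose m' := (m + `|Lam|) / s.
have m'0 : 0 <= m' by rewrite divr_ge0 ?(ltW s0) // addr_ge0.
pose E0 := expR (- (1 + m') * l); pose E1 := expR ((2 + m') * l).
(* Chosen so that V - lam >= s - K whenever |lam| <= Lam. *)
pose K := s + m + `|Lam|.
have K0 : 0 < K by rewrite /K -addrA ltr_wpDr // addr_ge0.
pose C := K * (s^-1 ^+ 2 * E1 * l * E1).
have C0 : 0 <= C.
  rewrite mulr_ge0 ?(ltW K0) // mulr_ge0 ?expR_ge0 // mulr_ge0 ?(ltW l0) // mulr_ge0 ?expR_ge0 //.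
  exact: sqr_ge0.
have E00 : 0 < s * E0 by rewrite mulr_gt0 // expR_gt0.
have C1 : 0 < C + 1 by rewrite ltr_wpDl.
(* The bound 1 gives dl^2 <= dl, hence C dl^2 <= C dl and the estimate C dl^2 < s E0. *)
exists (Num.min 1 (s * E0 / (C + 1))); first by rewrite lt_min ltr01 divr_gt0.
move=> lam mu f f1 g g1 lamL muL lm lmn Hf Hg fg0 fg10 norm0 bc0 bcl wl.
have LamE : Lam = `|Lam| by rewrite ger0_norm // (le_trans _ lamL).
have bq nu x : `|nu| <= Lam -> `|q nu x| <= m'.
  move=> h; rewrite (le_trans (sturm_q_bound H nu x)) // ler_pM2r ?invr_gt0 // lerD2l.
  by rewrite -LamE.
pose dl := `|lam - mu|.
have dl0 : 0 <= dl by exact: normr_ge0.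
have dlE : C * dl ^+ 2 < s * E0.
  move: lm; rewrite lt_min => /andP[d1]; rewrite ltr_pdivlMr // -/dl => d2.
  apply: le_lt_trans d2; rewrite mulrDr mulr1 -[leLHS]addr0 lerD //.
  rewrite mulrC expr2 -mulrA ler_wpM2l // ler_piMl //; exact: ltW.
have diff x : 0 <= x <= l -> (f x - g x) ^+ 2 <= dl ^+ 2 * (s^-1 ^+ 2 * E1 * l * E1).
  move=> xl; have norm0' : g 0 ^+ 2 + g1 0 ^+ 2 = 1 by rewrite -fg0 -fg10.
  have := sol2_diff m'0 (fun x => bq lam x lamL) (fun x => bq mu x muL) Hf Hg fg0 fg10 norm0' xl.
  by apply: le_trans; rewrite lerDl sqr_ge0.
have low x : 0 <= x <= l -> E0 <= f x ^+ 2 + f1 x ^+ 2.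
  move=> xl; apply: le_trans (sys2_lower m'0 Hf (fun x _ => bq lam x lamL) xl).
  rewrite norm0 mul1r ler_expR !mulNr lerN2 ler_wpM2l ?addr_ge0 //.
  by case/andP: xl.
have lmn0 : lam - mu != 0 by rewrite subr_eq0.
have sn0 : s != 0 by rewrite gt_eqF // s0.
(* [Th] vanishes at both ends by the boundary conditions and the Wronskian. Its derivative s f1^2 +
   (V - lam) f^2 + 2 K f g is at least s (f^2 + f1^2) - K (f - g)^2, since 2 f g = f^2 + g^2 - (f -
   g)^2, and this is positive. *)
pose Th x := s * (f x * f1 x) + 2 * K * (s / (lam - mu)) * (f x * g1 x - f1 x * g x).
have : Th 0 < Th l.
  apply: (@antider_lt _ Th (fun x => s * f1 x ^+ 2 + (V x - lam) * f x ^+ 2 + 2 * K * (f x * g x))) => //.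
    move=> x xl; have [df df1] := Hf x xl; have [dg dg1] := Hg x xl.
    apply: (der_eq (derD (derM (derC x s) (derM df df1))
      (derM (derC x (2 * K * (s / (lam - mu)))) (derD (derM df dg1) (derN (derM df1 dg)))))).
    by rewrite /sturm_q; field; rewrite sn0 lmn0.
  move=> x xl; have xl' : 0 <= x <= l by case/andP: xl => /ltW -> /ltW ->.
  have hd := diff x xl'; have hl := low x xl'.
  have V1 : s - K <= V x - lam.
    have := sturm_bound H x; rewrite ler_norml => /andP[v1 _].
    have : lam <= `|Lam| by rewrite -LamE (le_trans (ler_norm lam)).
    by rewrite /K; lra.
  have h1 : (s - K) * f x ^+ 2 <= (V x - lam) * f x ^+ 2 by rewrite ler_wpM2r ?sqr_ge0.
  have h2 : 0 <= K * g x ^+ 2 by rewrite mulr_ge0 ?sqr_ge0 // ltW.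
  have h3 : K * (f x - g x) ^+ 2 < s * E0.
    apply: le_lt_trans dlE; rewrite /C -mulrA ler_pM2l // [leRHS]mulrC; exact: hd.
  have h4 : s * E0 <= s * (f x ^+ 2 + f1 x ^+ 2) by rewrite ler_pM2l.
  move: (lt_le_trans h3 h4) h1 h2; move: (V x - lam) (f x) (f1 x) (g x) => v F F1 G; lra.
rewrite /Th bc0 bcl wl -fg0 -fg10 [f1 0 * f 0]mulrC bc0 subrr !mulr0 addr0 ltxx.
by [].
Qed.

Lemma type_separation (Lam : R) : exists2 eps : R, 0 < eps &
  forall lam mu, `|lam| <= Lam -> `|mu| <= Lam -> `|lam - mu| < eps ->
  (neumann_type lam /\ neumann_type mu \/ dirichlet_type lam /\ dirichlet_type mu) -> lam = mu.
Proof.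
have [eps eps0 sep] := sturm_separation Lam.
exists eps => // lam mu lamL muL lm ty; apply/eqP; apply: contraT => lmn; exfalso.
case: ty => [[[f [f1 [Hf f0 f10 fl]]] [g [g1 [Hg g0 g10 gl]]]]|[[f [f1 [Hf f0 f10 fl]]] [g [g1 [Hg g0 g10 gl]]]]].
  by apply: (sep _ _ _ _ _ _ lamL muL lm lmn Hf Hg); rewrite ?f0 ?f10 ?g0 ?g10 ?fl ?gl; ring.
by apply: (sep _ _ _ _ _ _ lamL muL lm lmn Hf Hg); rewrite ?f0 ?f10 ?g0 ?g10 ?fl ?gl; ring.
Qed.

End Periodic.

(** * Integrals over a period *)

Section Integrals.
Context {R : realType}.
Notation mu := (@lebesgue_measure R).
Variable L : R.
Hypothesis L0 : 0 < L.
Implicit Types u v w psi : R -> R.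

Definition intg v : Prop := mu.-integrable `[0, L] (EFin \o v).
Definition ip v x : R := \int[mu]_(t in `[0, x]) v t.

Lemma intg_cont v : continuous v -> intg v.
Proof. exact: cont_integrable. Qed.

Lemma intgD u v : intg u -> intg v -> intg (fun x => u x + v x).
Proof.
move=> iu iv; rewrite /intg; have -> : EFin \o (fun x => u x + v x) = (EFin \o u) \+ (EFin \o v).
  by apply/funext => x; rewrite /= EFinD.
exact: integrableD.
Qed.

Lemma intgZ (k : R) v : intg v -> intg (fun x => k * v x).
Proof.
move=> iv; rewrite /intg; have -> : EFin \o (fun x => k * v x) = (fun x => k%:E * (EFin \o v) x)%E.
  by apply/funext => x; rewrite /= EFinM.
exact: integrableZl.
Qed.

Lemma intgB u v : intg u -> intg v -> intg (fun x => u x - v x).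
Proof.
move=> iu iv; have := intgD iu (intgZ (-1) iv).
suff -> : (fun x => u x + -1 * v x) = (fun x => u x - v x) by [].
by apply/funext => x; rewrite mulN1r.
Qed.

Lemma intg_abs v : intg v -> intg (fun x => `|v x|).
Proof. by move=> iv; exact: integrable_norm. Qed.

Lemma intg_meas v : intg v -> measurable_fun (`[0, L]%classic : set R) v.
Proof. by move=> /measurable_int/measurable_EFinP. Qed.

Lemma cont_bounded v : continuous v -> exists2 M, 0 <= M & forall x, 0 <= x <= L -> `|v x| <= M.
Proof.
move=> cv; have cw := continuous_subspaceT (A := `[0, L]%classic) cv.
have [c1 _ h1] := EVT_max (ltW L0) cw; have [c2 _ h2] := EVT_min (ltW L0) cw.
exists (`|v c1| + `|v c2|) => [|x xL]; first by rewrite addr_ge0.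
have xI : x \in `[0, L] by rewrite in_itv.
have {}h1 := h1 x xI; have {}h2 := h2 x xI.
have n1 := ler_norm (v c1); have n2 : - v c2 <= `|v c2| by rewrite -normrN ler_norm.
have n3 := normr_ge0 (v c1); have n4 := normr_ge0 (v c2).
by rewrite ler_norml; apply/andP; split; lra.
Qed.

Lemma intg_le u v : measurable_fun (`[0, L]%classic : set R) u -> intg v ->
  (forall x, 0 <= x <= L -> `|u x| <= `|v x|) -> intg u.
Proof.
by move=> mu_ iv uv; apply: le_integrable iv => //; exact/measurable_EFinP.
Qed.

Lemma intgM v psi : intg v -> continuous psi -> intg (fun x => v x * psi x).
Proof.
move=> iv cp; have [M M0 pM] := cont_bounded cp.
apply: (@intg_le _ (fun x => M * v x)).
- by apply: measurable_funM; [exact: intg_meas|exact: intg_meas (intg_cont cp)].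
- exact: intgZ.
move=> x xL; rewrite !normrM mulrC (ger0_norm M0) ler_wpM2r //; exact: pM.
Qed.

Lemma intg_sub v x y : intg v -> 0 <= x -> y <= L -> mu.-integrable `[x, y] (EFin \o v).
Proof.
move=> iv x0 yL; apply: integrableS iv => //.
by apply: subset_itv; rewrite bnd_simp.
Qed.

Lemma ip0 v : ip v 0 = 0.
Proof. by rewrite /ip set_itv1 Rintegral_set1. Qed.

Lemma ipD u v x : intg u -> intg v -> x <= L -> ip (fun x => u x + v x) x = ip u x + ip v x.
Proof. by move=> iu iv xL; apply: RintegralD => //; exact: intg_sub. Qed.

Lemma ipB u v x : intg u -> intg v -> x <= L -> ip (fun x => u x - v x) x = ip u x - ip v x.
Proof. by move=> iu iv xL; apply: RintegralB => //; exact: intg_sub. Qed.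

Lemma ipZ k v x : intg v -> x <= L -> ip (fun x => k * v x) x = k * ip v x.
Proof. by move=> iv xL; apply: RintegralZl => //; exact: intg_sub. Qed.

Lemma ip_le u v x : intg u -> intg v -> x <= L ->
  (forall t, 0 <= t <= x -> u t <= v t) -> ip u x <= ip v x.
Proof.
by move=> iu iv xL uv; apply: le_Rintegral => //; exact: intg_sub.
Qed.

Lemma ip_mono v x : intg v -> (forall t, 0 <= v t) -> 0 <= x <= L -> ip v x <= ip v L.
Proof.
move=> iv v0 /andP[x0 xL]; rewrite /ip (Rintegral_split x0 xL iv) lerDl.
by apply: Rintegral_ge0 => t _.
Qed.

Lemma ip_abs v x : intg v -> 0 <= x <= L -> `|ip v x| <= ip (fun t => `|v t|) L.
Proof.
move=> iv xL; have xL' := xL; case/andP: xL' => x0 x1.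
apply: (@le_trans _ _ (ip (fun t => `|v t|) x)).
  by apply: le_normr_Rintegral => //; exact: intg_sub.
exact: ip_mono (intg_abs iv) (fun t => normr_ge0 (v t)) xL.
Qed.

Lemma ip_prim v x : 0 <= x -> ip v x = prim v x.
Proof. by move=> x0; rewrite /prim x0. Qed.

Lemma ip_eq u v x : (forall t, 0 <= t <= x -> u t = v t) -> ip u x = ip v x.
Proof.
by move=> uv; apply: eq_Rintegral => t; rewrite inE /= in_itv /=; exact: uv.
Qed.

Lemma ip_cst (k x : R) : 0 <= x -> ip (fun=> k) x = k * x.
Proof.
move=> x0; rewrite ip_prim // (prim_antider (F := fun x => k * x)) ?mulr0 ?subr0 //.
  exact: cst_continuous.
by move=> t; apply: (der_eq (derM (derC t k) (derX t))); ring.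
Qed.

(** Freezing the argument outside [0, L] makes the primitive of an integrable function continuous
    and bounded on the whole line, as the existence theorem for systems requires of its data. *)
Definition clamp (x : R) : R := Num.max 0 (Num.min x L).

Lemma clamp_itv x : 0 <= clamp x <= L.
Proof. by rewrite /clamp le_max lexx /= ge_max (ltW L0) /= ge_min lexx orbT. Qed.

Lemma clamp_id x : 0 <= x <= L -> clamp x = x.
Proof.
move=> /andP[x0 xL]; rewrite /clamp; have -> : Num.min x L = x by apply/min_idPl.
by apply/max_idPr.
Qed.

Lemma clamp_cont : continuous clamp.
Proof.
move=> x; rewrite /clamp; apply: (@continuous_max _ _ (fun=> 0) (fun x => Num.min x L)).
  exact: cst_continuous.
by apply: (@continuous_min _ _ (fun x => x) (fun=> L)) => //; exact: cst_continuous.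
Qed.

Lemma ip_clamp_cont v : intg v -> continuous (fun x => ip v (clamp x)).
Proof.
move=> iv x U.
have xI : (`[0, L]%classic : set R) (clamp x) by rewrite /= in_itv /= clamp_itv.
move/(parameterized_integral_continuous (ltW L0) iv) => /=.
rewrite /nbhs /= -(nbhs_subspace_in xI) => nU.
have h : nbhs x (fun t => (`[0, L]%classic : set R) (clamp t) -> U (ip v (clamp t))) := clamp_cont nU.
apply: filterS h => t; apply.
by rewrite /= in_itv /= clamp_itv.
Qed.

Lemma ip_ae_eq u v x : intg u -> intg v -> x <= L ->
  {ae mu, forall t, 0 <= t <= L -> u t = v t} -> ip u x = ip v x.
Proof.
move=> iu iv xL uv; congr fine; apply: ae_eq_integral => //.
- exact: measurable_int (intg_sub iu (lexx _) xL).
- exact: measurable_int (intg_sub iv (lexx _) xL).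
move: uv; apply: filterS; first exact: (ae_filter_ringOfSetsType mu).
move=> t uv /=; rewrite in_itv /= => /andP[t0 tx].
by rewrite uv // t0 (le_trans tx).
Qed.

Lemma intg_approx v (e : R) : intg v -> 0 < e ->
  exists2 g, continuous g & ip (fun x => `|v x - g x|) L <= e.
Proof.
move=> iv e0.
have fin : (mu (`[0%R, L]%classic : set R) < +oo)%E.
  by rewrite lebesgue_measure_itv /=; case: ifP => _; rewrite ?ltry // -EFinD ltry.
have [g [cg ig]] := approximation_continuous_integrable (measurable_itv _) fin iv.
move=> /fine_cvgP[_ /cvgrPdist_le /(_ e e0)] [n _ /(_ n (leqnn n))] /=.
rewrite sub0r normrN => h; exists (g n) => //.
by rewrite (le_trans _ h) // ler_norm.
Qed.

Lemma ip_bound v (M : R) : 0 <= M -> intg v -> (forall x, 0 <= x <= L -> `|v x| <= M) ->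
  `|ip v L| <= M * L.
Proof.
move=> M0 iv vM; have LL : 0 <= L <= L by rewrite lexx ltW.
apply: le_trans (ip_abs iv LL) _; rewrite -(ip_cst M (ltW L0)).
by apply: ip_le => //; [exact: intg_abs|apply: intg_cont; exact: cst_continuous].
Qed.

(** The defect [D] of the formula is linear, vanishes on continuous v by the product rule, and is
    bounded by the L^1 norm; continuous functions are dense in that norm. *)
Lemma ip_by_parts v psi dpsi : intg v -> (forall x, has_der x psi (dpsi x)) -> continuous dpsi ->
  ip (fun x => ip v (clamp x) * dpsi x) L = ip v L * psi L - ip (fun x => v x * psi x) L.
Proof.
move=> iv dp cd; have cp : continuous psi by move=> x; exact: der_cont (dp x).
have LL : 0 <= L <= L by rewrite lexx ltW.
pose D w := ip (fun x => ip w (clamp x) * dpsi x) L + ip (fun x => w x * psi x) L - ip w L * psi L.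
have iP w : intg w -> intg (fun x => ip w (clamp x) * dpsi x).
  by move=> iw; apply: intgM => //; apply: intg_cont; exact: ip_clamp_cont.
have Dg g : continuous g -> D g = 0.
  move=> cg; have ig := intg_cont cg.
  rewrite /D -ipD //; [|exact: iP|exact: intgM].
  have dg x : has_der x (fun x => prim g x * psi x) (prim g x * dpsi x + g x * psi x).
    by apply: (der_eq (derM (prim_der x cg) (dp x))); rewrite addrC.
  have cc : continuous (fun x => prim g x * dpsi x + g x * psi x).
    by move=> x; exact: (contD (contM (@prim_cont _ g cg x) (cd x)) (contM (cg x) (cp x))).
  rewrite (@ip_eq _ (fun x => prim g x * dpsi x + g x * psi x)); last first.
    by move=> t tL; rewrite clamp_id // ip_prim //; case/andP: tL.
  rewrite ip_prim ?(ltW L0) // (prim_antider cc dg) prim0 mul0r subr0 ip_prim ?(ltW L0) //.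
  by rewrite subrr.
have DB w g : intg w -> intg g -> D (fun x => w x - g x) = D w - D g.
  move=> iw ig; rewrite /D.
  have -> : (fun x => ip (fun x => w x - g x) (clamp x) * dpsi x) =
     (fun x => ip w (clamp x) * dpsi x - ip g (clamp x) * dpsi x).
    apply/funext => x; rewrite ipB //; first by rewrite mulrBl.
    by case/andP: (clamp_itv x).
  have -> : (fun x => (w x - g x) * psi x) = (fun x => w x * psi x - g x * psi x).
    by apply/funext => x; rewrite mulrBl.
  rewrite (ipB (iP w iw) (iP g ig) (lexx L)) (ipB (intgM iw cp) (intgM ig cp) (lexx L)).
  by rewrite (ipB iw ig (lexx L)); ring.
have [M M0 pM] := cont_bounded cp; have [M' M'0 pM'] := cont_bounded cd.
have Dle w : intg w -> `|D w| <= (M' * L + 2 * M) * ip (fun x => `|w x|) L.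
  move=> iw; set n := ip (fun x => `|w x|) L.
  have n0 : 0 <= n by apply: Rintegral_ge0.
  have h1 : `|ip (fun x => ip w (clamp x) * dpsi x) L| <= n * M' * L.
    apply: ip_bound; [exact: mulr_ge0|exact: iP|] => x xL.
    rewrite normrM ler_pM ?pM' //; apply: ip_abs => //; exact: clamp_itv.
  have h2 : `|ip (fun x => w x * psi x) L| <= M * n.
    apply: le_trans (ip_abs (intgM iw cp) LL) _; rewrite /n -ipZ //; last exact: intg_abs.
    apply: ip_le => //; [exact: intg_abs (intgM iw cp)|exact: intgZ (intg_abs iw)|].
    by move=> t tL; rewrite normrM mulrC ler_wpM2r // pM.
  have h3 : `|ip w L * psi L| <= n * M by rewrite normrM ler_pM // ?ip_abs // pM.
  apply: le_trans (ler_normB _ _) _; apply: le_trans (lerD (ler_normD _ _) (lexx _)) _.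
  by apply: le_trans (lerD (lerD h1 h2) h3) _; rewrite le_eqVlt; apply/orP; left; apply/eqP; ring.
suff : D v = 0 by rewrite /D; lra.
apply/eqP; rewrite -normr_le0 leNgt; apply/negP => Dv.
pose C := M' * L + 2 * M + 1.
have C0 : 0 < C by rewrite /C ltr_wpDl // addr_ge0 // mulr_ge0 // ltW.
have e0 : 0 < `|D v| / (2 * C) by rewrite divr_gt0 // mulr_gt0.
have [g cg gl] := intg_approx iv e0; have ig := intg_cont cg.
have := Dle _ (intgB iv ig); rewrite DB // (Dg g cg) subr0 => h.
have n0 : 0 <= ip (fun x => `|v x - g x|) L by apply: Rintegral_ge0.
have : `|D v| <= `|D v| / 2.
  apply: (le_trans h); apply: (@le_trans _ _ (C * (`|D v| / (2 * C)))).
    by rewrite ler_pM // ?lerDl // addr_ge0 // mulr_ge0 // ltW.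
  by rewrite le_eqVlt; apply/orP; left; apply/eqP; field; rewrite gt_eqF.
by apply/negP; rewrite -ltNge ltr_pdivrMr // ltr_pMr // ltr1n.
Qed.

End Integrals.

(** * Density of trigonometric polynomials *)

Section TestFunctions.
Context {R : realType}.
Variable L : R.
Hypothesis L0 : 0 < L.
Implicit Types f g psi rho : R -> R.

(** Closed under derivatives and products, hence made of test functions and containing the powers of
    a peaked kernel, so that no smooth bump functions have to be constructed. *)
Inductive trig : (R -> R) -> Prop :=
| trig_cst c : trig (fun=> c)
| trig_cos : trig (fun x => cos (2 * pi / L * x))
| trig_sin : trig (fun x => sin (2 * pi / L * x))
| trigD f g : trig f -> trig g -> trig (fun x => f x + g x)
| trigM f g : trig f -> trig g -> trig (fun x => f x * g x).

Lemma trig_der f : trig f -> exists2 g, trig g & forall x, has_der x f (g x).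
Proof.
have lin x : has_der x (fun x => 2 * pi / L * x) (2 * pi / L).
  by apply: (der_eq (derM (derC x _) (derX x))); ring.
elim=> {f} [c|||f g _ [f1 tf1 df] _ [g1 tg1 dg]|f g tf [f1 tf1 df] tg [g1 tg1 dg]].
- by exists (fun=> 0); [exact: trig_cst|move=> x; exact: derC].
- exists (fun x => sin (2 * pi / L * x) * - (2 * pi / L)).
    by apply: trigM; [exact: trig_sin|exact: trig_cst].
  by move=> x; apply: (der_eq (derChain (lin x) (der_cos _))); ring.
- exists (fun x => cos (2 * pi / L * x) * (2 * pi / L)).
    by apply: trigM; [exact: trig_cos|exact: trig_cst].
  by move=> x; apply: (der_eq (derChain (lin x) (der_sin _))).
- by exists (fun x => f1 x + g1 x); [exact: trigD|move=> x; exact: derD].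
- exists (fun x => f1 x * g x + f x * g1 x); last by move=> x; exact: derM.
  by apply: trigD; exact: trigM.
Qed.

Lemma trig_periodic f : trig f -> periodic f L.
Proof.
have lin x : 2 * pi / L * (x + L) = 2 * pi / L * x + pi *+ 2.
  by rewrite -mulr_natl; field; rewrite gt_eqF.
elim=> {f} [c|||f g _ hf _ hg|f g _ hf _ hg] x //.
- by rewrite lin cosD2pi.
- by rewrite lin sinD2pi.
- by rewrite hf hg.
- by rewrite hf hg.
Qed.

Lemma trig_cont f : trig f -> continuous f.
Proof. by move=> /trig_der[g _ dg] x; exact: der_cont (dg x). Qed.

Lemma trig_exp f n : trig f -> trig (fun x => f x ^+ n).
Proof.
move=> tf; elim: n => [|n ih].
  by have -> : (fun x => f x ^+ 0) = (fun=> 1) by []; exact: trig_cst.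
have -> : (fun x => f x ^+ n.+1) = (fun x => f x * f x ^+ n).
  by apply/funext => x; rewrite exprS.
exact: trigM.
Qed.

Lemma trig_cos_shift x0 : trig (fun x => cos (2 * pi / L * (x - x0))).
Proof.
have -> : (fun x => cos (2 * pi / L * (x - x0))) = (fun x =>
    cos (2 * pi / L * x) * cos (2 * pi / L * x0) + sin (2 * pi / L * x) * sin (2 * pi / L * x0)).
  by apply/funext => x; rewrite mulrBr cosB.
by apply: trigD; apply: trigM; [exact: trig_cos|exact: trig_cst|exact: trig_sin|exact: trig_cst].
Qed.

Lemma trig_test f : trig f -> test_function L f.
Proof.
move=> tf; split; first exact: trig_periodic.
move=> n x; suff /trig_der [g _ dg] : trig (derive1n n f) by case: (dg x).
elim: n => [|n ih] //=; have [g tg dg] := trig_der ih.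
suff -> : derive1 (derive1n n f) = g by [].
by apply/funext => y; exact: der_derive1 (dg y).
Qed.

Lemma test_der psi : test_function L psi -> forall x, has_der x psi (derive1 psi x).
Proof. by move=> [_ /(_ 0%N) d] x; split; [exact: d|rewrite derive1E]. Qed.

Lemma test_cont psi : test_function L psi -> continuous psi.
Proof. by move=> tp x; exact: der_cont (test_der tp x). Qed.

Lemma test_der_cont psi : test_function L psi -> continuous (derive1 psi).
Proof.
move=> [_ /(_ 1%N) d] x; apply: differentiable_continuous; apply/derivable1_diffP.
exact: d.
Qed.

(* Subtracting the mean makes the primitive periodic. *)
Lemma test_prim rho : test_function L rho ->
  let m := ip rho L / L in
  test_function L (prim (fun x => rho x - m)) /\
  derive1 (prim (fun x => rho x - m)) = (fun x => rho x - m).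
Proof.
move=> tr m; have cr := test_cont tr.
have cm : continuous (fun x => rho x - m) by move=> x; exact: (contB (cr x) (@contC R m x)).
have dm x := prim_der x cm.
have derE : derive1 (prim (fun x => rho x - m)) = (fun x => rho x - m).
  by apply/funext => x; exact: der_derive1 (dm x).
split; last exact: derE.
split.
  move=> x; apply/eqP; rewrite -subr_eq0; apply/eqP.
  have E y : prim (fun x => rho x - m) (y + L) - prim (fun x => rho x - m) y =
             prim (fun x => rho x - m) L.
    apply: (@antider_eq _ (fun y => prim (fun x => rho x - m) (y + L) - prim (fun x => rho x - m) y)
       (fun=> prim (fun x => rho x - m) L) (fun=> 0)).
    - by rewrite add0r prim0 subr0.
    - move=> t; have dt := derD (derX t) (derC t L).
      apply: (der_eq (derD (derChain dt (dm _)) (derN (dm t)))).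
      by have [-> _] := tr; ring.
    - by move=> t; exact: derC.
  rewrite E -ip_prim ?(ltW L0) // (ipB (intg_cont L cr) (intg_cont L (fun x => @contC R m x)) (lexx L)).
  by rewrite ip_cst ?(ltW L0) // /m divfK ?gt_eqF // subrr.
case=> [|n] x; first by case: (dm x).
rewrite derive1Sn derE.
have [_ /(_ n.+1)] := tr; case: n => [|n] d.
  by apply: derivableB; [exact: (tr.2 0%N)|exact: derivable_cst].
have -> : derive1n n.+1 (fun x => rho x - m) = derive1n n.+1 rho.
  rewrite !derive1Sn; congr (derive1n n); apply/funext => y.
  by rewrite (der_derive1 (derD (test_der tr y) (derN (derC y m)))) oppr0 addr0.
exact: (tr.2 n.+1).
Qed.

(** If G x0 > 0, integrate G against powers of a trigonometric polynomial that exceeds some q > 1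
    near x0 and has modulus at most 1 where G may be negative: the integral would grow like q^n.
    Applied to - G as well, this gives G = 0. *)
Lemma trig_dense (G : R -> R) : continuous G ->
  (forall rho, trig rho -> ip (fun x => G x * rho x) L = 0) ->
  forall x, 0 < x < L -> G x <= 0.
Proof.
move=> cG orth x0 /andP[x00 x0L]; rewrite leNgt; apply/negP => g0.
set g := G x0 in g0 *.
have [M M0 GM] := cont_bounded L0 cG.
have [e e0 near_x0] : exists2 e, 0 < e & forall x, `|x - x0| < e -> g / 2 < G x.
  have /cvgrPdist_lt/(_ (g / 2)) := cG x0.
  rewrite divr_gt0 // => /(_ isT) [e /= e0 he]; exists e => // x xe.
  have := he x; rewrite /= distrC => /(_ xe); rewrite -/g ltr_norml => /andP[_]; lra.
(* G is at least g / 2 on the window |x - x0| <= d, and a distance of at least 2 d to 0 and L keeps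
   the periodic copies of the window outside [0, L]. *)
pose d := Num.min e (Num.min x0 (L - x0)) / 2.
have mgt : 0 < Num.min e (Num.min x0 (L - x0)) by rewrite !lt_min e0 x00 subr_gt0.
have d0 : 0 < d by rewrite divr_gt0.
have de : d < e.
  have : Num.min e (Num.min x0 (L - x0)) <= e by rewrite ge_min lexx.
  by rewrite /d; lra.
have dx0 : 2 * d <= x0.
  have : Num.min e (Num.min x0 (L - x0)) <= x0 by rewrite !ge_min lexx orbT.
  by rewrite /d; lra.
have dL : 2 * d <= L - x0.
  have : Num.min e (Num.min x0 (L - x0)) <= L - x0 by rewrite !ge_min lexx !orbT.
  by rewrite /d; lra.
pose om := 2 * pi / L.
have om0 : 0 < om by rewrite divr_gt0 // mulr_gt0 // pi_gt0.
have omL : om * L = 2 * pi by rewrite /om divfK // gt_eqF.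
have pi0 := pi_gt0 R.
have cosle a b : 0 <= a -> a <= b -> b <= pi -> cos b <= cos a.
  rewrite le_eqVlt => + + bp; move=> a0; rewrite le_eqVlt => /predU1P[-> //|ab].
  have a0' : 0 <= a by rewrite le_eqVlt.
  apply: ltW; rewrite ltr_cos // in_itv /= ?a0' ?bp ?(le_trans (ltW ab)) //.
  by rewrite (le_trans a0' (ltW ab)).
have cosabs (t : R) : cos t = cos `|t| by case: (ger0P t) => // _; rewrite cosN.
pose c0 := cos (om * d); pose c1 := cos (om * (d / 2)).
have odp : om * d <= pi.
  have : om * (4 * d) <= om * L by rewrite ler_pM2l //; lra.
  by rewrite omL; lra.
have c01 : c0 < c1.
  have h : om * (d / 2) < om * d by rewrite ltr_pM2l //; lra.
  have h0 : 0 < om * (d / 2) by rewrite mulr_gt0 // divr_gt0.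
  have m1 : om * d \in `[0, pi] by rewrite in_itv /= odp (ltW (lt_trans h0 h)).
  have m2 : om * (d / 2) \in `[0, pi] by rewrite in_itv /= (ltW h0) (le_trans (ltW h)).
  by rewrite /c0 /c1 ltr_cos.
(* Subtracting c0 = cos(om d) sets the level: b >= 1 on the window, |b| <= 1 on the rest of [0, L],
   and b >= q > 1 on the inner half of the window. *)
pose b x := 1 + cos (om * (x - x0)) - c0.
have omabs x : `|om * (x - x0)| = om * `|x - x0| by rewrite normrM (gtr0_norm om0).
have inside x : `|x - x0| <= d -> 1 <= b x.
  move=> xd; rewrite /b -addrA lerDl subr_ge0 cosabs omabs.
  by apply: cosle => //; [rewrite mulr_ge0 // ltW|rewrite ler_pM2l].
have core x : `|x - x0| <= d / 2 -> 1 + c1 - c0 <= b x.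
  move=> xd; rewrite /b lerD2r lerD2l cosabs omabs.
  apply: cosle; [by rewrite mulr_ge0 // ltW|by rewrite ler_pM2l|].
  by rewrite (le_trans _ odp) // ler_pM2l //; lra.
have outside x : 0 <= x <= L -> d < `|x - x0| -> `|b x| <= 1.
  move=> /andP[xl xr] xd.
  have h : cos (om * (x - x0)) <= c0.
    rewrite cosabs omabs; set t := om * `|x - x0|.
    have t1 : om * d <= t by rewrite ler_pM2l // ltW.
    (* Past pi the cosine rises again, but x stays at least d short of the next copy of x0. *)
    have t2 : t <= 2 * pi - om * d.
      rewrite -omL /t -mulrBr ler_pM2l // ler_norml; apply/andP; split; lra.
    have od0 : 0 <= om * d by rewrite mulr_ge0 // ltW.
    have [tp|tp] := leP t pi; first exact: cosle.
    have -> : cos t = cos (2 * pi - t).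
      by rewrite -cosN -(@cosD2pi _ (- t)) addrC mulr_natl.
    by apply: cosle => //; lra.
  have := cos_geN1 (om * (x - x0)); have := cos_le1 (om * d); rewrite -/c0 => h1 h2.
  by rewrite ler_norml /b; apply/andP; split; lra.
pose q := 1 + c1 - c0.
have q1 : 1 < q by rewrite /q; lra.
pose x1 := x0 - d / 2; pose x2 := x0 + d / 2.
have tb : trig b.
  have -> : b = (fun x => (1 - c0) + cos (om * (x - x0))) by apply/funext => x; rewrite /b; ring.
  by apply: trigD; [exact: trig_cst|exact: trig_cos_shift].
have key n : g / 2 * q ^+ n * d <= M * L.
  have tn := trig_exp n tb; have cn := trig_cont tn.
  pose F x := G x * b x ^+ n.
  have cF : continuous F by move=> x; exact: (contM (cG x) (cn x)).
  have dF x := prim_der x cF.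
  have FM x : 0 <= x <= L -> - M <= F x.
    move=> xL; have [xd|xd] := leP `|x - x0| d.
      rewrite (@le_trans _ _ 0) ?oppr_le0 // mulr_ge0 //.
        by rewrite ltW // (lt_trans _ (near_x0 x (le_lt_trans xd de))) // divr_gt0.
      by rewrite exprn_ge0 // (le_trans ler01) // inside.
    have : `|F x| <= M.
      rewrite normrM normrX -[leRHS]mulr1 ler_pM ?GM //.
      by rewrite exprn_ile1 // outside.
    by rewrite ler_norml => /andP[].
  have Fc x : x1 <= x <= x2 -> g / 2 * q ^+ n <= F x.
    move=> /andP[h1 h2]; have xd : `|x - x0| <= d / 2.
      by rewrite ler_norml; move: h1 h2; rewrite /x1 /x2 => h1 h2; apply/andP; split; lra.
    have xd' : `|x - x0| < e by rewrite (le_lt_trans xd) // (lt_trans _ de) //; lra.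
    have bq := core x xd.
    apply: ler_pM; [by rewrite divr_ge0 // ltW|by rewrite exprn_ge0 // (le_trans ler01) // ltW| |].
      exact: ltW (near_x0 x xd').
    by rewrite lerXn2r // nnegrE (le_trans ler01) ?(ltW q1) // (le_trans (ltW q1)).
  have lin (k : R) t : has_der t (fun x => prim F x - k * x) (F t - k).
    by apply: (der_eq (derD (dF t) (derN (derM (derC t k) (derX t))))); ring.
  have x1L : 0 <= x1 by rewrite /x1; lra.
  have x12 : x1 <= x2 by rewrite /x1 /x2; lra.
  have x2L : x2 <= L by rewrite /x2; lra.
  (* The integral is split at x1 and x2: at least - M per unit length outside, at least (g / 2) q^n
     on the middle interval of length d. *)
  have i1 : prim F 0 - (- M) * 0 <= prim F x1 - (- M) * x1.
    apply: (antider_le x1L (fun t _ => lin (- M) t)) => t /andP[t0 t1].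
    by rewrite subr_ge0 FM // (ltW t0) (le_trans (ltW t1)) // (le_trans x12).
  have i2 : prim F x1 - (g / 2 * q ^+ n) * x1 <= prim F x2 - (g / 2 * q ^+ n) * x2.
    apply: (antider_le x12 (fun t _ => lin _ t)) => t /andP[t0 t1].
    by rewrite subr_ge0 Fc // (ltW t0) ltW.
  have i3 : prim F x2 - (- M) * x2 <= prim F L - (- M) * L.
    apply: (antider_le x2L (fun t _ => lin (- M) t)) => t /andP[t0 t1].
    by rewrite subr_ge0 FM // (ltW t1) (le_trans x1L) // (le_trans x12) // ltW.
  have := orth _ tn; rewrite ip_prim ?(ltW L0) // -/F => FL.
  rewrite prim0 in i1; rewrite FL in i3.
  have Md : 0 <= M * d by rewrite mulr_ge0 // ltW.
  move: i1 i2 i3; rewrite /x1 /x2; move: (g / 2 * q ^+ n) => A; move: (prim F _) (prim F _) => P1 P2; nra.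
have [n nE] : exists n : nat, M * L < g / 2 * (1 + n%:R * (q - 1)) * d.
  pose A := g / 2 * (q - 1) * d.
  have A0 : 0 < A by rewrite mulr_gt0 // mulr_gt0 ?subr_gt0 // divr_gt0.
  exists (Num.trunc (M * L / A)).+1.
  have := truncnS_gt (M * L / A); rewrite ltr_pdivrMr // => h.
  apply: (lt_trans h); move: (_.+1%:R) => N.
  have -> : g / 2 * (1 + N * (q - 1)) * d = N * A + g / 2 * d by rewrite /A; ring.
  by rewrite ltrDl mulr_gt0 // divr_gt0.
have bern : 1 + n%:R * (q - 1) <= q ^+ n.
  elim: (n) => [|k ih]; first by rewrite mul0r addr0 expr0.
  rewrite exprS -natr1; have qq : 0 <= q - 1 by rewrite subr_ge0 ltW.
  have h1 : 0 <= (q - 1) * (q ^+ k - (1 + k%:R * (q - 1))) by rewrite mulr_ge0 // subr_ge0.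
  have h2 : 0 <= k%:R * (q - 1) ^+ 2 by rewrite mulr_ge0 // sqr_ge0.
  by move: (q ^+ k) (k%:R) ih h1 h2 => Q K; lra.
have := key n; rewrite leNgt => /negP; apply.
by rewrite (lt_le_trans nE) // ler_pM2r // ler_pM2l // divr_gt0.
Qed.

End TestFunctions.

(** * Weak derivatives *)

Section WeakDerivatives.
Context {R : realType}.
Notation mu := (@lebesgue_measure R).
Variable L : R.
Hypothesis L0 : 0 < L.
Implicit Types u v w psi rho : R -> R.

Let LL : 0 <= L <= L. Proof. by rewrite lexx ltW. Qed.

Lemma weak_derivative_realE u v : weak_derivative_real L u v <->
  forall psi, test_function L psi ->
    ip (fun x => u x * derive1 psi x) L = - ip (fun x => v x * psi x) L.
Proof. by []. Qed.

Lemma weak_of_primitive u v : intg L v ->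
  (forall x, 0 <= x <= L -> u x = u 0 + ip v x) -> u L = u 0 ->
  weak_derivative_real L u v.
Proof.
move=> iv uE uL; apply/weak_derivative_realE => psi tp.
have dp := test_der tp; have cd := test_der_cont tp.
have ipL : ip v L = 0 by have := uE L LL; rewrite uL; lra.
rewrite (@ip_eq _ _ (fun x => u 0 * derive1 psi x + ip v (clamp L x) * derive1 psi x)); last first.
  by move=> t tL; rewrite uE // clamp_id // mulrDl.
have ic := intg_cont L cd.
have iP : intg L (fun x => ip v (clamp L x) * derive1 psi x).
  by apply: intgM => //; apply: intg_cont; exact: ip_clamp_cont.
rewrite (ipD (intgZ (u 0) ic) iP (lexx L)) (ipZ _ ic (lexx L)) (ip_by_parts L0 iv dp cd).
rewrite ip_prim ?(ltW L0) // (prim_antider cd dp) ipL.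
have [/(_ 0)] := tp; rewrite add0r => -> _.
by rewrite subrr mulr0 mul0r add0r sub0r.
Qed.

(** At a Lebesgue point inside (0, L) the value of w is the derivative of its primitive, which is
    0. *)
Lemma ip_cont_eq0 w : intg L w -> (forall x, 0 < x < L -> ip w x = 0) ->
  {ae mu, forall x, 0 <= x <= L -> w x = 0}.
Proof.
move=> iw w0; pose f := w \_ (`[0, L]%classic : set R).
have mI : measurable (`[0, L]%classic : set R) by [].
have /lebesgue_differentiation := integrable_locally mI iw.
have n0 : mu.-negligible [set (0 : R)].
  by apply/negligibleP => //; exact: lebesgue_measure_set1.
have nL : mu.-negligible [set (L : R)].
  by apply/negligibleP => //; exact: lebesgue_measure_set1.
move=> nf; have := negligibleU nf (negligibleU n0 nL).
apply: negligibleS => x /= /not_implyP [xL wx].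
have [x0|x0] := eqVneq x 0; first by right; left.
have [x1|x1] := eqVneq x L; first by right; right.
left=> lp; apply: wx.
have xi : 0 < x < L.
  by case/andP: xL => h1 h2; rewrite !lt_neqAle eq_sym x0 h1 x1.
have x00 : 0 < x by case/andP: xi.
have xl : x < L by case/andP: xi.
have intf : mu.-integrable `[0, L] (EFin \o f).
  rewrite /f -restrict_EFin; apply/integrable_restrict => //=; rewrite setIid; exact: iw.
have /= FT := @FTC1_lebesgue_pt R f (BLeft 0) x L xl intf.
have [|dF FE] := FT _ lp; first by rewrite /= ?bnd_simp ?ltW.
have -> : w x = f x by rewrite /f patchE mem_set //= in_itv.
rewrite -FE.
have H : has_der x (fun y => \int[mu]_(t in `[0, y]) f t) 0.
  apply: (der_near _ (derC x 0)); near=> y.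
  have yi : 0 < y < L by apply/andP; split; near: y; [exact: lt_nbhsr|exact: lt_nbhsl].
  apply: (etrans (esym (w0 y yi))); apply: eq_Rintegral => t; rewrite inE /= in_itv /= => /andP[t0 ty].
  rewrite /f patchE mem_set //= in_itv /= t0 (le_trans ty) // ltW //.
  by case/andP: yi.
exact: der_derive1 H.
Unshelve. all: by end_near. Qed.

(** Du Bois-Reymond: u minus the primitive of v and minus its mean is orthogonal to all derivatives
    of test functions, hence to all test functions, and has to vanish almost everywhere. *)
Lemma primitive_of_weak u v : intg L u -> intg L v -> weak_derivative_real L u v ->
  ip v L = 0 /\ exists c, {ae mu, forall x, 0 <= x <= L -> u x = c + ip v x}.
Proof.
move=> iu iv /weak_derivative_realE uv.
have vL : ip v L = 0.
  have t1 : test_function L (fun=> 1) := trig_test L0 (trig_cst L 1).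
  have := uv _ t1.
  rewrite (@ip_eq _ _ (fun=> 0)); last first.
    by move=> t _; rewrite (der_derive1 (derC t 1)) mulr0.
  rewrite ip_cst ?(ltW L0) // mul0r (@ip_eq _ (fun x => v x * 1) v); last first.
    by move=> t _; rewrite mulr1.
  by move/esym/eqP; rewrite oppr_eq0 => /eqP.
split => //.
pose P x := ip v (clamp L x).
have cP : continuous P by exact: ip_clamp_cont.
have iP : intg L P := intg_cont L cP.
have iuP := intgB iu iP.
have iC (k : R) : intg L (fun=> k) by apply: intg_cont => x; exact: contC.
pose c := ip (fun x => u x - P x) L / L.
pose w x := u x - P x - c.
have iw : intg L w := intgB iuP (iC c).
have wL : ip w L = 0.
  by rewrite /w (ipB iuP (iC c) (lexx L)) ip_cst ?(ltW L0) // /c divfK ?subrr // gt_eqF.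
have w1 psi : test_function L psi -> ip (fun x => w x * derive1 psi x) L = 0.
  move=> tp; have cd := test_der_cont tp; have dp := test_der tp.
  rewrite (@ip_eq _ _ (fun x => u x * derive1 psi x - P x * derive1 psi x - c * derive1 psi x)); last first.
    by move=> t _; rewrite /w; ring.
  have ic := intg_cont L cd.
  rewrite (ipB (intgB (intgM L0 iu cd) (intgM L0 iP cd)) (intgZ c ic) (lexx L)).
  rewrite (ipB (intgM L0 iu cd) (intgM L0 iP cd) (lexx L)) (ipZ _ ic (lexx L)) uv //.
  rewrite (ip_by_parts L0 iv dp cd) vL mul0r sub0r subrr sub0r ip_prim ?(ltW L0) //.
  rewrite (prim_antider cd dp); have [/(_ 0)] := tp; rewrite add0r => -> _.
  by rewrite subrr mulr0 oppr0.
have w2 rho : test_function L rho -> ip (fun x => w x * rho x) L = 0.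
  move=> tr; have [tp pE] := test_prim L0 tr; have := w1 _ tp; rewrite pE.
  set m := ip rho L / L; have cr := test_cont tr.
  rewrite (@ip_eq _ _ (fun x => w x * rho x - m * w x)); last by move=> t _; ring.
  by rewrite (ipB (intgM L0 iw cr) (intgZ m iw) (lexx L)) (ipZ _ iw (lexx L)) wL mulr0 subr0.
(* [trig_dense] needs a continuous function, so it is applied to the primitive of [w] less its mean.
   As W 0 = 0, the mean is 0 as well, W vanishes, and Lebesgue differentiation returns to [w]. *)
pose W x := ip w (clamp L x).
have cW : continuous W by exact: ip_clamp_cont.
have iW : intg L W := intg_cont L cW.
pose k := ip W L / L; pose G x := W x - k.
have cG : continuous G by move=> x; exact: (contB (cW x) (@contC R k x)).
have G0 rho : trig L rho -> ip (fun x => G x * rho x) L = 0.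
  move=> /(trig_test L0) tr; have [tp pE] := test_prim L0 tr.
  have cr := test_cont tr; have ir := intg_cont L cr.
  have := ip_by_parts L0 iw (test_der tp) (test_der_cont tp).
  rewrite pE wL mul0r sub0r (w2 _ tp) oppr0 -/W.
  set m := ip rho L / L => h.
  have mL : m * L = ip rho L by rewrite /m divfK // gt_eqF.
  have kL : k * L = ip W L by rewrite /k divfK // gt_eqF.
  have {}h : ip (fun x => W x * rho x) L - m * ip W L = 0.
    rewrite -h -(ipZ _ iW (lexx L)) -(ipB (intgM L0 iW cr) (intgZ m iW) (lexx L)).
    by apply: ip_eq => t _; rewrite /W; ring.
  rewrite (@ip_eq _ _ (fun x => W x * rho x - k * rho x)); last by move=> t _; rewrite /G; ring.
  rewrite (ipB (intgM L0 iW cr) (intgZ k ir) (lexx L)) (ipZ _ ir (lexx L)) -mL.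
  by move: h; rewrite -kL; lra.
have Gx x : 0 < x < L -> G x = 0.
  move=> xL; apply/eqP; rewrite eq_le (trig_dense L0 cG G0 xL) /= -oppr_le0.
  apply: (@trig_dense _ _ L0 (fun x => - G x)) => // [y|rho tr].
    exact: (contN (cG y)).
  have cr := trig_cont tr.
  rewrite (@ip_eq _ _ (fun x => -1 * (G x * rho x))); last by move=> t _; ring.
  by rewrite (ipZ _ (intgM L0 (intg_cont L cG) cr) (lexx L)) G0 // mulr0.
have k0 : k = 0.
  have := cont_eq0_right L0 (cG 0) Gx.
  by rewrite /G /W clamp_id ?lexx ?(ltW L0) // ip0 sub0r => /eqP; rewrite oppr_eq0 => /eqP.
have ww := ip_cont_eq0 iw _.
exists c; have {}ww := ww _; apply: filterS (ww _); first exact: (ae_filter_ringOfSetsType mu).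
  move=> x h xL; have := h xL; rewrite /w /P clamp_id //; lra.
move=> x xL; have := Gx x xL; rewrite /G /W k0 subr0 clamp_id //.
by case/andP: xL => /ltW -> /ltW ->.
Qed.

End WeakDerivatives.

(** * Reduction modulo the period *)

Section PeriodicExtension.
Context {R : realType}.
Notation mu := (@lebesgue_measure R).
Variable L : R.
Hypothesis L0 : 0 < L.
Implicit Types (A : set R) (c x : R).

Let shift c (x : measurableTypeR R) : measurableTypeR R := x + c.

Let shift_meas c : measurable_fun setT (shift c).
Proof. by apply: measurable_funD => //; exact: measurable_id. Qed.

HB.instance Definition _ c := isMeasurableFun.Build _ _ _ _ _ (shift_meas c).

Lemma lebesgue_measure_shift c A : measurable A -> mu (shift c @^-1` A) = mu A.
Proof.
move=> mA; rewrite -[LHS]/(pushforward mu (shift c) A).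
apply/esym/lebesgue_measure_unique => //= _ [[a b]] _ <-.
rewrite /pushforward.
have -> : shift c @^-1` (`]a, b]%classic) = `]a - c, b - c]%classic.
  by apply/seteqP; split => x /=; rewrite /shift !in_itv /= ltrBlDr lerBrDr.
rewrite !lebesgue_measure_itv /= !lte_fin ltrBlDr subrK; case: ifP => // _.
by rewrite -!EFinB; congr (_%:E); ring.
Qed.

Lemma negligible_shift A c : mu.-negligible A -> mu.-negligible [set x | A (x + c)].
Proof.
move=> [B [mB B0 AB]]; exists (shift c @^-1` B); split => //.
- by rewrite -[X in measurable X]setTI; exact: shift_meas.
- by rewrite lebesgue_measure_shift.
- by move=> x /= Ax; exact: AB.
Qed.

Definition frac (x : R) : R := x - L * (Num.floor (x / L))%:~R.

Lemma frac_itv x : 0 <= frac x < L.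
Proof.
have xE : x = L * (x / L) by rewrite mulrC divfK // gt_eqF.
have /andP[h1 h2] := floor_itv (x / L); rewrite rmorphD /= in h2.
rewrite /frac [X in X - _]xE -mulrBr; apply/andP; split.
  by apply: mulr_ge0; [exact: ltW|rewrite subr_ge0].
by rewrite -[ltRHS]mulr1 ltr_pM2l // ltrBlDl.
Qed.

Lemma frac_id x : 0 <= x < L -> frac x = x.
Proof.
move=> /andP[h1 h2]; rewrite /frac (@floor_def _ _ 0) ?mulr0 ?subr0 //.
by rewrite add0r divr_ge0 ?ltr_pdivrMr ?mul1r // ltW.
Qed.

Lemma frac_periodic x : frac (x + L) = frac x.
Proof.
rewrite /frac mulrDl divff ?gt_eqF // floorDrz ?rmorph1 //.
by rewrite floor1 rmorphD /= rmorph1; ring.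
Qed.

Lemma frac_meas : measurable_fun setT frac.
Proof.
apply: measurable_funB; first exact: measurable_id.
apply: measurable_funM; first exact: measurable_cst.
apply: nondecreasing_measurable => // x y xy.
by rewrite ler_int; apply: le_floor; rewrite ler_pdivrMr // divfK // gt_eqF.
Qed.

Lemma periodic_frac (T : Type) (f : R -> T) x : (forall y, f (y + L) = f y) -> f (frac x) = f x.
Proof.
move=> fL.
have fn n y : f (y + L *+ n) = f y.
  by elim: n => [|n IH]; rewrite ?mulr0n ?addr0 // mulrS [L + _]addrC addrA fL IH.
rewrite /frac; case: (Num.floor _) => n.
  by rewrite -[LHS](fn n) -mulr_natr subrK.
by rewrite NegzE mulrNz mulrN opprK mulr_natr fn.
Qed.

(** The exceptional set is covered by countably many translates of a null subset of [0, L]. *)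
Lemma ae_periodic (P : R -> Prop) : (forall x, P (x + L) = P x) ->
  {ae mu, forall x, 0 <= x <= L -> P x} -> {ae mu, forall x, P x}.
Proof.
move=> PL nP.
have h (n : nat) := negligibleU (negligible_shift (L *+ n) nP) (negligible_shift (- (L *+ n)) nP).
have := negligible_bigcup h; apply: negligibleS => x /= Px.
have := frac_itv x; have := periodic_frac x PL; rewrite /frac.
case E : (Num.floor _) => [n|n] fP /andP[h1 h2].
  exists n => //; right => /= hP; apply: Px; rewrite -fP.
  by move: hP; rewrite -[L *+ n]mulr_natr; apply; rewrite h1 ltW.
exists n.+1 => //; left => /= hP; apply: Px; rewrite -fP.
move: h1 h2 hP; rewrite NegzE mulrNz mulrN opprK mulr_natr => h1 h2; apply.
by rewrite h1 ltW.
Qed.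

End PeriodicExtension.

(** * Square-integrable periodic functions *)

Section SquareIntegrable.
Context {R : realType}.
Notation mu := (@lebesgue_measure R).
Variable L : R.
Hypothesis L0 : 0 < L.
Implicit Types (u v w : R -> R) (f g : R -> R[i]).

Definition L2real v : Prop :=
  [/\ periodic v L, measurable_fun setT v & intg L (fun x => v x ^+ 2)].

Lemma L2real_le v w : periodic v L -> measurable_fun setT v -> intg L w ->
  (forall x, 0 <= x <= L -> v x ^+ 2 <= `|w x|) -> L2real v.
Proof.
move=> pv mv iw vw; split => //; apply: (intg_le (v := w)) => //.
  by apply: measurable_funX; exact: measurable_funTS.
by move=> x xL; rewrite ger0_norm ?sqr_ge0 //; exact: vw.
Qed.

Lemma L2real_intg v : L2real v -> intg L v.
Proof.
move=> [pv mv iv]; have i1 : intg L (fun=> 1) by apply: intg_cont => x; exact: contC.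
apply: (intg_le _ (intgD i1 iv)); first exact: measurable_funTS.
move=> x _; rewrite (@ger0_norm _ (_ + _)) ?addr_ge0 ?sqr_ge0 ?ler01 //.
rewrite ler_norml; have := sqr_ge0 (v x - 1); have := sqr_ge0 (v x + 1).
by rewrite sqrrD sqrrB !mulr1 expr1n; have := sqr_ge0 (v x) => h1 h2 h3; apply/andP; split; lra.
Qed.

Lemma L2realD u v : L2real u -> L2real v -> L2real (fun x => u x + v x).
Proof.
move=> [pu mu_ iu] [pv mv iv]; apply: (L2real_le (w := fun x => 2 * u x ^+ 2 + 2 * v x ^+ 2)).
- by move=> x; rewrite pu pv.
- exact: measurable_funD.
- by apply: intgD; exact: intgZ.
move=> x _; apply: (le_trans _ (ler_norm _)).
have := sqr_ge0 (u x - v x); nra.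
Qed.

Lemma L2realM u (V : R -> R) (m : R) : L2real u -> periodic V L -> continuous V ->
  (forall x, `|V x| <= m) -> L2real (fun x => V x * u x).
Proof.
move=> [pu mu_ iu] pV cV Vm; apply: (L2real_le (w := fun x => m ^+ 2 * u x ^+ 2)).
- by move=> x; rewrite pu pV.
- by apply: measurable_funM => //; exact: continuous_measurable_fun.
- exact: intgZ.
move=> x _; rewrite exprMn normrM; apply: ler_pM; rewrite ?sqr_ge0 //; last by rewrite ler_norm.
by rewrite (le_trans _ (ler_norm _)) // -real_normK ?num_real // lerXn2r ?nnegrE // (le_trans _ (Vm x)).
Qed.

Lemma L2realZ k u : L2real u -> L2real (fun x => k * u x).
Proof.
move=> Lu; apply: (L2realM (V := fun=> k) (m := `|k|)) => //.
by move=> x; exact: contC.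
Qed.

Lemma L2realN u : L2real u -> L2real (fun x => - u x).
Proof.
move=> /(L2realZ (-1)); congr L2real; apply/funext => x; exact: mulN1r.
Qed.

Lemma L2realB u v : L2real u -> L2real v -> L2real (fun x => u x - v x).
Proof. by move=> Lu /L2realN; exact: L2realD. Qed.

Lemma L2real_frac F : continuous F -> L2real (F \o frac L).
Proof.
move=> cF; have [M M0 FM] := cont_bounded L0 cF.
apply: (L2real_le (w := fun=> M ^+ 2)).
- by move=> x; rewrite /= frac_periodic.
- by apply: measurableT_comp; [exact: continuous_measurable_fun|exact: frac_meas].
- by apply: intg_cont => x; exact: contC.
move=> x _; rewrite (le_trans _ (ler_norm _)) // -real_normK ?num_real //=.
rewrite lerXn2r ?nnegrE //; apply: FM.
by have /andP[-> /ltW ->] := frac_itv L0 x.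
Qed.

Lemma L2real0 : L2real (fun=> 0).
Proof. by apply: (@L2real_frac (fun=> 0)) => x; exact: contC. Qed.

(* Jensen, from [0 <= (|v| - t)^2] for the mean value [t] of [|v|]. *)
Lemma ip_abs_sqr v : L2real v ->
  ip (fun x => `|v x|) L ^+ 2 <= L * ip (fun x => v x ^+ 2) L.
Proof.
move=> Lv; have iv := intg_abs (L2real_intg Lv); have [_ _ iv2] := Lv.
set I := ip _ L; pose t := I / L.
have i1 : intg L (fun=> t ^+ 2) by apply: intg_cont => x; exact: contC.
have i0 : intg L (fun=> 0) by apply: intg_cont => x; exact: contC.
have ii := intgD (intgB iv2 (intgZ (2 * t) iv)) i1.
have := @ip_le _ _ _ _ L i0 ii (lexx L) _.
rewrite ip_cst ?(ltW L0) // mul0r (ipD (intgB iv2 (intgZ _ iv)) i1 (lexx L)).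
rewrite (ipB iv2 (intgZ _ iv) (lexx L)) (ipZ _ iv (lexx L)) ip_cst ?(ltW L0) // -/I.
have tL : I = t * L by rewrite /t divfK // gt_eqF.
move=> /(_ _)/wrap[x _|].
  by rewrite -(real_normK (num_real (v x))); have := sqr_ge0 (`|v x| - t); nra.
rewrite tL => /(mulr_ge0 (ltW L0)); lra.
Qed.

Lemma periodic_parts f : periodic f L <-> periodic (re_part f) L /\ periodic (im_part f) L.
Proof.
split=> [pf|[pr pi] x]; first by split => x; rewrite /re_part /im_part pf.
have := pr x; have := pi x; rewrite /re_part /im_part.
by case: (f x) => ? ?; case: (f (x + L)) => ? ? /= -> ->.
Qed.

Lemma L2perP f : L2per L f <-> L2real (re_part f) /\ L2real (im_part f).
Proof.
split=> [[/periodic_parts[pr pi] mr mi sf]|[[pr mr ir] [pi mi ii]]]; last first.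
  split => //; first exact/periodic_parts.
  have := intgD ir ii => /integrableP[_]; rewrite /sqnorm.
  by under eq_integral do rewrite /= ger0_norm ?addr_ge0 ?sqr_ge0 //.
have iS : intg L (fun x => re_part f x ^+ 2 + im_part f x ^+ 2).
  apply/integrableP; split.
    by apply/measurable_EFinP/measurable_funD; apply: measurable_funX; exact: measurable_funTS.
  by under eq_integral do rewrite /= ger0_norm ?addr_ge0 ?sqr_ge0 //.
by split; apply: (L2real_le _ _ iS) => // x _;
  rewrite ger0_norm ?addr_ge0 ?sqr_ge0 // ?lerDl ?lerDr sqr_ge0.
Qed.

Lemma L2normE f : L2norm L f = Num.sqrt (ip (fun x => re_part f x ^+ 2 + im_part f x ^+ 2) L).
Proof. by []. Qed.

End SquareIntegrable.

(** * The Schroedinger operator as a first-order system *)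

Section SchrodingerODE.
Context {R : realType}.
Notation mu := (@lebesgue_measure R).
Variables (L s m : R) (V : R -> R).
Hypotheses (L0 : 0 < L) (s0 : 0 < s) (cV : continuous V).
Hypotheses (Vm : forall x, `|V x| <= m) (pV : periodic V L).
Implicit Types (a b x : R) (u v w k : R -> R) (f g h : R -> R[i]).

Lemma ae_imp (P Q : R -> Prop) : (forall x, P x -> Q x) ->
  {ae mu, forall x, P x} -> {ae mu, forall x, Q x}.
Proof. by move=> PQ; apply: negligibleS => x nQ Px; apply: nQ; exact: PQ. Qed.

Lemma ae_and (P Q : R -> Prop) : {ae mu, forall x, P x} -> {ae mu, forall x, Q x} ->
  {ae mu, forall x, P x /\ Q x}.
Proof.
move=> aP aQ; have := negligibleU aP aQ; apply: negligibleS => x nPQ.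
by have [Px|] := pselect (P x); [right => Qx; apply: nPQ|left].
Qed.

(** Real form of -s f'' + V f - z f = h with z = a + i b. Components 0 and 1 are the real and
    imaginary parts of f, components 2 and 3 those of f' + (1/s) int_0^x h. *)
Definition coef a b (i j : 'I_4) x : R :=
  match nat_of_ord i, nat_of_ord j with
  | 0%N, 2%N | 1%N, 3%N => 1
  | 2%N, 0%N | 3%N, 1%N => (V x - a) / s
  | 2%N, 1%N => b / s
  | 3%N, 0%N => - (b / s)
  | _, _ => 0
  end.

Definition vec4 (T : Type) (z0 z1 z2 z3 : T) (i : 'I_4) : T := nth z0 [:: z0; z1; z2; z3] i.

Notation i0 := (@Ordinal 4 0 isT).
Notation i1 := (@Ordinal 4 1 isT).
Notation i2 := (@Ordinal 4 2 isT).
Notation i3 := (@Ordinal 4 3 isT).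

Lemma ord4P (P : 'I_4 -> Prop) : P i0 -> P i1 -> P i2 -> P i3 -> forall i, P i.
Proof.
by move=> h0 h1 h2 h3; case=> [[|[|[|[|//]]]]] h; rewrite (bool_irrelevance h isT).
Qed.

Lemma sum4 (F : 'I_4 -> R) : \sum_j F j = F i0 + F i1 + F i2 + F i3.
Proof.
rewrite !big_ord_recl big_ord0 addr0 !addrA.
by congr (F _ + F _ + F _ + F _); exact: val_inj.
Qed.

Lemma ode4E a b (b0 b1 : R -> R) Y x :
  ode_at (coef a b) (vec4 b0 b1 (fun=> 0) (fun=> 0)) Y x <->
  [/\ has_der x (Y i0) (Y i2 x + b0 x), has_der x (Y i1) (Y i3 x + b1 x),
      has_der x (Y i2) (((V x - a) * Y i0 x + b * Y i1 x) / s) &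
      has_der x (Y i3) ((- b * Y i0 x + (V x - a) * Y i1 x) / s)].
Proof.
split=> [H|[h0 h1 h2 h3]].
  by split; [have := H i0|have := H i1|have := H i2|have := H i3];
    rewrite sum4 /coef /vec4 /= => h; apply: (der_eq h); ring.
apply: ord4P; rewrite sum4 /coef /vec4 /=;
  [apply: (der_eq h0)|apply: (der_eq h1)|apply: (der_eq h2)|apply: (der_eq h3)]; ring.
Qed.

Lemma coef_cont a b i j : continuous (coef a b i j).
Proof.
have c0 (e : R) : continuous (fun _ : R => e) by move=> x; exact: contC.
have cVa : continuous (fun x => (V x - a) / s).
  by move=> x; exact: (contM (contB (@cV x) (c0 a x)) (c0 s^-1 x)).
by move: i j; apply: ord4P; apply: ord4P; rewrite /coef /=.
Qed.

Let mbound a b := 1 + (m + `|a| + `|b|) / s.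

Lemma coef_bound a b i j x : `|coef a b i j x| <= mbound a b.
Proof.
have m0 : 0 <= m := le_trans (normr_ge0 _) (Vm 0).
have B0 : 0 <= (m + `|a| + `|b|) / s by rewrite divr_ge0 ?addr_ge0 ?(ltW s0).
have hb : `|b / s| <= mbound a b.
  rewrite normrM (gtr0_norm (x := s^-1)) ?invr_gt0 //.
  apply: (@le_trans _ _ ((m + `|a| + `|b|) / s)); last by rewrite lerDr.
  by rewrite ler_pM2r ?invr_gt0 // lerDr addr_ge0.
have hV : `|(V x - a) / s| <= mbound a b.
  rewrite normrM (gtr0_norm (x := s^-1)) ?invr_gt0 //.
  apply: (@le_trans _ _ ((m + `|a| + `|b|) / s)); last by rewrite lerDr.
  rewrite ler_pM2r ?invr_gt0 // (le_trans (ler_normB _ _)) //.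
  by rewrite -addrA lerD // lerDl.
have h1 : `|1 : R| <= mbound a b by rewrite normr1 lerDl.
have h0 : `|0 : R| <= mbound a b by rewrite normr0 addr_ge0.
have hb' : `|- (b / s)| <= mbound a b by rewrite normrN.
by move: i j; apply: ord4P; apply: ord4P; rewrite /coef /=.
Qed.

Lemma weak_component u v w : intg L u -> intg L v -> intg L w ->
  weak_derivative_real L u v -> weak_derivative_real L v w ->
  exists c0 c1, let F x := c1 + ip w (clamp L x) in
    [/\ {ae mu, forall x, 0 <= x <= L -> u x = c0 + prim F x}, ip w L = 0 & prim F L = 0].
Proof.
move=> iu iv iw uv vw.
have [vL [c0 uE]] := primitive_of_weak L0 iu iv uv.
have [wL [c1 vE]] := primitive_of_weak L0 iv iw vw.
exists c0, c1 => F.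
have cF : continuous F.
  by move=> x; rewrite /F; exact: (contD (@contC R c1 x) (ip_clamp_cont L0 iw (x := x))).
have {}vE : {ae mu, forall x, 0 <= x <= L -> v x = F x}.
  by apply: ae_imp vE => x h xL; rewrite h // /F clamp_id.
have FE x : 0 <= x <= L -> ip v x = prim F x.
  move=> /andP[x0 xL].
  by rewrite -ip_prim // (ip_ae_eq iv (intg_cont L cF) xL vE).
split => //; last by rewrite -FE ?lexx ?(ltW L0).
by apply: ae_imp uE => x h xL; rewrite h // FE.
Qed.

Lemma weak_second w (h : R -> R) k x : intg L w -> intg L h -> continuous k ->
  {ae mu, forall x, 0 <= x <= L -> w x = (k x - h x) / s} -> 0 <= x <= L ->
  ip w x = prim k x / s - ip h x / s.
Proof.
move=> iw ih ck wE /andP[x0 xL]; have ik := intg_cont L ck.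
rewrite (ip_ae_eq (v := fun x => s^-1 * (k x - h x)) iw _ xL); last first.
- by apply: ae_imp wE => t hw tL; rewrite hw // mulrC.
- exact: (intgZ s^-1 (intgB ik ih)).
by rewrite (ipZ _ (intgB ik ih) xL) (ipB ik ih xL) ip_prim // mulrC mulrBl.
Qed.

(** Since h is only square integrable, it enters through its primitive: f' minus this term is
    continuously differentiable, and all data of the system are continuous. *)
Definition forcing v x : R := - ip v (clamp L x) / s.

Lemma forcing0 v : forcing v 0 = 0.
Proof. by rewrite /forcing clamp_id ?lexx ?(ltW L0) // ip0 oppr0 mul0r. Qed.

Lemma forcing_cont v : intg L v -> continuous (forcing v).
Proof.
by move=> iv x; exact: (contM (contN (ip_clamp_cont L0 iv (x := x))) (@contC R s^-1 x)).
Qed.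

Lemma forcing_bound v x : intg L v -> `|forcing v x| <= ip (fun t => `|v t|) L / s.
Proof.
move=> iv; rewrite /forcing normrM normrN (gtr0_norm (x := s^-1)) ?invr_gt0 //.
by rewrite ler_pM2r ?invr_gt0 //; apply: ip_abs => //; exact: clamp_itv.
Qed.

Lemma L2per_comb a b f g (h := fun x => g x - (a +i* b)%C * f x) : L2per L f -> L2per L g ->
  [/\ forall x, re_part h x = re_part g x - (a * re_part f x - b * im_part f x),
      forall x, im_part h x = im_part g x - (a * im_part f x + b * re_part f x) & L2per L h].
Proof.
move=> /(L2perP _ _)[Lr Li] /(L2perP _ _)[Lgr Lgi].
have hr x : re_part h x = re_part g x - (a * re_part f x - b * im_part f x).
  by rewrite /h /re_part /im_part; case: (f x) => ? ?; case: (g x).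
have hi x : im_part h x = im_part g x - (a * im_part f x + b * re_part f x).
  by rewrite /h /re_part /im_part; case: (f x) => ? ?; case: (g x).
split; [exact: hr|exact: hi|apply/L2perP; rewrite (funext hr) (funext hi); split].
  exact: (L2realB Lgr (L2realB (L2realZ a Lr) (L2realZ b Li))).
exact: (L2realB Lgi (L2realD (L2realZ a Li) (L2realZ b Lr))).
Qed.

(** f and f' are periodic, but f' + (1/s) int h jumps over a period by the integral of h / s; this
    is the prescribed increment in components 2 and 3. The solution represents f almost
    everywhere. *)
Lemma schrodinger_ode a b f g (h := fun x => g x - (a +i* b)%C * f x) :
  schrodinger L s V f g ->
  exists Y : 'I_4 -> R -> R, [/\ forall i, continuous (Y i),
    forall x, 0 <= x <= L -> ode_at (coef a b)
      (vec4 (forcing (re_part h)) (forcing (im_part h)) (fun=> 0) (fun=> 0)) Y x,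
    forall i, Y i L = Y i 0 +
      vec4 0 0 (- forcing (re_part h) L) (- forcing (im_part h) L) i &
    {ae mu, forall x, 0 <= x <= L -> re_part f x = Y i0 x /\ im_part f x = Y i1 x}].
Proof.
move=> [f1 [f2 [[/(L2perP _ _)[Lr Li] /(L2perP _ _)[L1r L1i] /(L2perP _ _)[L2r L2i] [wr wi] [w1r w1i]]]]].
move=> [/(L2perP _ _)[Lgr Lgi] gE].
have [hr hi Lh] : [/\ forall x, re_part h x = re_part g x - (a * re_part f x - b * im_part f x),
    forall x, im_part h x = im_part g x - (a * im_part f x + b * re_part f x) & L2per L h].
  by apply: L2per_comb; apply/L2perP.
have /(L2perP _ _)[Lhr Lhi] := Lh.
have ihr := L2real_intg Lhr; have ihi := L2real_intg Lhi.
have [c0 [c1 /= [fE f2L FL]]] := weak_component (L2real_intg Lr) (L2real_intg L1r) (L2real_intg L2r) wr w1r.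
have [d0 [d1 /= [fE' f2L' FL']]] := weak_component (L2real_intg Li) (L2real_intg L1i) (L2real_intg L2i) wi w1i.
pose F x := c1 + ip (re_part f2) (clamp L x); pose G x := d1 + ip (im_part f2) (clamp L x).
rewrite -/F in fE FL; rewrite -/G in fE' FL'.
have cF : continuous F.
  by move=> x; rewrite /F; exact: (contD (@contC R c1 x) (ip_clamp_cont L0 (L2real_intg L2r) (x := x))).
have cG : continuous G.
  by move=> x; rewrite /G; exact: (contD (@contC R d1 x) (ip_clamp_cont L0 (L2real_intg L2i) (x := x))).
pose Z0 x := c0 + prim F x; pose Z1 x := d0 + prim G x.
have dZ0 x : has_der x Z0 (F x).
  by rewrite /Z0; apply: (der_eq (derD (derC x c0) (prim_der x cF))); rewrite add0r.
have dZ1 x : has_der x Z1 (G x).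
  by rewrite /Z1; apply: (der_eq (derD (derC x d0) (prim_der x cG))); rewrite add0r.
pose kr x := (V x - a) * Z0 x + b * Z1 x.
pose ki x := - b * Z0 x + (V x - a) * Z1 x.
have cC e x : {for x, continuous (fun _ : R => e)} := @contC R e x.
have cZ0 x := der_cont (dZ0 x); have cZ1 x := der_cont (dZ1 x).
have ckr : continuous kr.
  by move=> x; rewrite /kr; exact: (contD (contM (contB (@cV x) (cC a x)) (cZ0 x)) (contM (cC b x) (cZ1 x))).
have cki : continuous ki.
  by move=> x; rewrite /ki; exact: (contD (contM (cC (- b) x) (cZ0 x)) (contM (contB (@cV x) (cC a x)) (cZ1 x))).
pose Z2 x := c1 + prim kr x / s; pose Z3 x := d1 + prim ki x / s.
have f2E : {ae mu, forall x, 0 <= x <= L ->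
    re_part f2 x = (kr x - re_part h x) / s /\ im_part f2 x = (ki x - im_part h x) / s}.
  apply: ae_imp (ae_and (ae_and fE fE') gE) => x [[hf hf'] hg] xL; move: (hf xL) (hf' xL) hg.
  rewrite -/(Z0 x) -/(Z1 x) /kr /ki hr hi /re_part /im_part.
  case: (f x) => fr fi; case: (g x) => gr gi; case: (f2 x) => f2r f2i /= <- <-.
  move=> /eqP; rewrite eq_complex /= => /andP[/eqP -> /eqP ->].
  by split; field; exact: lt0r_neq0.
(* The first weak derivative is c1 plus the primitive of f2 = (kr - h) / s; the continuous part and
   the part with h are separated. *)
have FZ x : 0 <= x <= L -> F x = Z2 x + forcing (re_part h) x.
  move=> xL; rewrite /F /Z2 /forcing clamp_id //.
  rewrite (weak_second (L2real_intg L2r) ihr ckr _ xL); first by rewrite mulNr addrA.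
  by apply: ae_imp f2E => t ht /ht[].
have GZ x : 0 <= x <= L -> G x = Z3 x + forcing (im_part h) x.
  move=> xL; rewrite /G /Z3 /forcing clamp_id //.
  rewrite (weak_second (L2real_intg L2i) ihi cki _ xL); first by rewrite mulNr addrA.
  by apply: ae_imp f2E => t ht /ht[].
have LL : 0 <= L <= L by rewrite lexx ltW.
have L00 : 0 <= (0 : R) <= L by rewrite lexx ltW.
have dZ2 x : has_der x Z2 (((V x - a) * Z0 x + b * Z1 x) / s).
  by rewrite /Z2; apply: (der_eq (derD (derC x c1) (derM (prim_der x ckr) (derC x s^-1)))); rewrite /kr; ring.
have dZ3 x : has_der x Z3 ((- b * Z0 x + (V x - a) * Z1 x) / s).
  by rewrite /Z3; apply: (der_eq (derD (derC x d1) (derM (prim_der x cki) (derC x s^-1)))); rewrite /ki; ring.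
exists (vec4 Z0 Z1 Z2 Z3); split.
- by apply: ord4P => x; [exact: cZ0|exact: cZ1|exact: der_cont (dZ2 x)|exact: der_cont (dZ3 x)].
- move=> x xL; apply/ode4E; split; rewrite /vec4 /=.
  + by apply: (der_eq (dZ0 x)); exact: FZ.
  + by apply: (der_eq (dZ1 x)); exact: GZ.
  + exact: dZ2.
  + exact: dZ3.
- apply: ord4P; rewrite /vec4 /=.
  + by rewrite /Z0 FL prim0 !addr0.
  + by rewrite /Z1 FL' prim0 !addr0.
  + have := FZ L LL; have := FZ 0 L00; rewrite forcing0 addr0 /F !clamp_id // f2L ip0 => <- ->.
    by rewrite addrK.
  + have := GZ L LL; have := GZ 0 L00; rewrite forcing0 addr0 /G !clamp_id // f2L' ip0 => <- ->.
    by rewrite addrK.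
by apply: ae_imp (ae_and fE fE') => x [h1 h2] xL; split; [exact: h1|exact: h2].
Qed.

End SchrodingerODE.

(** * From periodic solutions of the system back to the operator *)

Section PeriodicSolutions.
Context {R : realType}.
Notation mu := (@lebesgue_measure R).
Variables (L s m : R) (V : R -> R).
Hypotheses (L0 : 0 < L) (s0 : 0 < s) (cV : continuous V).
Hypotheses (Vm : forall x, `|V x| <= m) (pV : periodic V L).
Implicit Types (a b x : R) (u v w k F : R -> R) (f g h : R -> R[i]).

Notation i0 := (@Ordinal 4 0 isT).
Notation i1 := (@Ordinal 4 1 isT).
Notation i2 := (@Ordinal 4 2 isT).
Notation i3 := (@Ordinal 4 3 isT).

Lemma frac_closed F x : F L = F 0 -> 0 <= x <= L -> F (frac L x) = F x.
Proof.
move=> FL /andP[x0]; rewrite le_eqVlt => /orP[/eqP ->|xL]; last by rewrite frac_id // x0.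
by have := frac_periodic L0 0; rewrite add0r => ->; rewrite frac_id // lexx.
Qed.

Lemma weak_frac F v : intg L v -> F L = F 0 ->
  (forall x, 0 <= x <= L -> F x = F 0 + ip v x) -> weak_derivative_real L (F \o frac L) v.
Proof.
move=> iv FL FE; have L00 : 0 <= (0 : R) <= L by rewrite lexx ltW.
have LL : 0 <= L <= L by rewrite lexx ltW.
apply: weak_of_primitive => //= [x xL|]; last by rewrite !frac_closed.
by rewrite !frac_closed //; exact: FE.
Qed.

(** Converse of [schrodinger_ode]: the prescribed jump makes [Y i2] plus the forcing, which is the
    derivative of f, periodic, so restricting to a period and extending by [frac] creates no
    singular part in the second derivative. *)
Lemma ode_schrodinger a b h (Y : 'I_4 -> R -> R)
  (f := fun x => (Y i0 (frac L x) +i* Y i1 (frac L x))%C) : L2per L h ->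
  (forall x, ode_at (coef s V a b)
     (vec4 (forcing L s (re_part h)) (forcing L s (im_part h)) (fun=> 0) (fun=> 0)) Y x) ->
  (forall i, Y i L = Y i 0 +
     vec4 0 0 (- forcing L s (re_part h) L) (- forcing L s (im_part h) L) i) ->
  schrodinger L s V f (fun x => h x + (a +i* b)%C * f x).
Proof.
move=> /(L2perP _ _)[Lhr Lhi] HY YL.
have sn0 : s != 0 by rewrite gt_eqF.
have cC e x : {for x, continuous (fun _ : R => e)} := @contC R e x.
have ihr := L2real_intg Lhr; have ihi := L2real_intg Lhi.
have cHr : continuous (forcing L s (re_part h)) by exact: forcing_cont.
have cHi : continuous (forcing L s (im_part h)) by exact: forcing_cont.
have Y0L : Y i0 L = Y i0 0 by rewrite YL /vec4 /= addr0.
have Y1L : Y i1 L = Y i1 0 by rewrite YL /vec4 /= addr0.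
pose G x := Y i2 x + forcing L s (re_part h) x.
pose K x := Y i3 x + forcing L s (im_part h) x.
have GL : G L = G 0 by rewrite /G YL /vec4 /= forcing0 //; ring.
have KL : K L = K 0 by rewrite /K YL /vec4 /= forcing0 //; ring.
have d0 x : has_der x (Y i0) (G x) by have /ode4E[] := HY x.
have d1 x : has_der x (Y i1) (K x) by have /ode4E[] := HY x.
have d2 x : has_der x (Y i2) (((V x - a) * Y i0 x + b * Y i1 x) / s) by have /ode4E[] := HY x.
have d3 x : has_der x (Y i3) ((- b * Y i0 x + (V x - a) * Y i1 x) / s) by have /ode4E[] := HY x.
have c0 : continuous (Y i0) by move=> x; exact: der_cont (d0 x).
have c1 : continuous (Y i1) by move=> x; exact: der_cont (d1 x).
have cG : continuous G by move=> x; exact: (contD (der_cont (d2 x)) (cHr x)).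
have cK : continuous K by move=> x; exact: (contD (der_cont (d3 x)) (cHi x)).
pose kr x := (V x - a) * Y i0 x + b * Y i1 x.
pose ki x := - b * Y i0 x + (V x - a) * Y i1 x.
have ckr : continuous kr.
  by move=> x; rewrite /kr; exact: (contD (contM (contB (@cV x) (cC a x)) (c0 x)) (contM (cC b x) (c1 x))).
have cki : continuous ki.
  by move=> x; rewrite /ki; exact: (contD (contM (cC (- b) x) (c0 x)) (contM (contB (@cV x) (cC a x)) (c1 x))).
have primY (y k : R -> R) x : continuous k -> (forall x, has_der x y (k x / s)) -> prim k x / s = y x - y 0.
  move=> ck dy; have dF t : has_der t (fun x => s * y x) (k t).
    by apply: (der_eq (derM (derC t s) (dy t))); field.
  by rewrite (prim_antider ck dF); field.
pose f1 x := (G (frac L x) +i* K (frac L x))%C.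
pose f2r x := (kr (frac L x) - re_part h x) / s.
pose f2i x := (ki (frac L x) - im_part h x) / s.
have Vfrac x : V (frac L x) = V x by apply: periodic_frac.
have L2r : L2real L f2r.
  have -> : f2r = (fun x => s^-1 * ((kr \o frac L) x - re_part h x)).
    by apply/funext => x; rewrite mulrC.
  have h1 := L2real_frac L0 ckr; have h2 := L2realB h1 Lhr.
  exact: (L2realZ s^-1 h2).
have L2i : L2real L f2i.
  have -> : f2i = (fun x => s^-1 * ((ki \o frac L) x - im_part h x)).
    by apply/funext => x; rewrite mulrC.
  have h1 := L2real_frac L0 cki; have h2 := L2realB h1 Lhi.
  exact: (L2realZ s^-1 h2).
have Lf : L2per L f by apply/L2perP; split; exact: L2real_frac.
exists f1, (fun x => (f2r x +i* f2i x)%C); split; last split.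
- split; first exact: Lf.
  + by apply/L2perP; split; exact: L2real_frac.
  + by apply/L2perP.
  + have cw F F1 : continuous F1 -> F L = F 0 -> F1 L = F1 0 -> (forall x, has_der x F (F1 x)) ->
      weak_derivative_real L (F \o frac L) (F1 \o frac L).
      move=> cF1 FL F1L dF; apply: weak_frac => //.
        exact: L2real_intg (L2real_frac L0 cF1).
      move=> x /andP[x0 xL]; rewrite (@ip_eq _ _ F1).
        by rewrite ip_prim // (prim_antider cF1 dF) addrC subrK.
      by move=> t /andP[t0 tx]; apply: frac_closed => //; rewrite t0 (le_trans tx).
    by split; exact: cw.
  + split; [apply: (weak_frac (F := G) (L2real_intg L2r) GL) => x xL
    |apply: (weak_frac (F := K) (L2real_intg L2i) KL) => x xL].
      rewrite (weak_second (s := s) (L2real_intg L2r) ihr ckr (x := x) _ xL).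
        by rewrite (primY _ _ _ ckr d2) /G forcing0 // /forcing clamp_id //; ring.
      by apply: aeW => t tL; rewrite /f2r /kr Vfrac !frac_closed.
    rewrite (weak_second (s := s) (L2real_intg L2i) ihi cki (x := x) _ xL).
      by rewrite (primY _ _ _ cki d3) /K forcing0 // /forcing clamp_id //; ring.
    by apply: aeW => t tL; rewrite /f2i /ki Vfrac !frac_closed.
- have [Lfr Lfi] := (L2perP _ _).1 Lf.
  apply/L2perP; split.
    rewrite (_ : re_part _ = (fun x => re_part h x + (a * re_part f x - b * im_part f x))).
      exact: (L2realD Lhr (L2realB (L2realZ a Lfr) (L2realZ b Lfi))).
    by apply/funext => x; rewrite /re_part /im_part; case: (h x).
  rewrite (_ : im_part _ = (fun x => im_part h x + (a * im_part f x + b * re_part f x))).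
    exact: (L2realD Lhi (L2realD (L2realZ a Lfi) (L2realZ b Lfr))).
  by apply/funext => x; rewrite /re_part /im_part; case: (h x).
apply: aeW => x; rewrite /f /f2r /f2i /kr /ki Vfrac /re_part /im_part.
by case: (h x) => hr hi; apply/eqP; rewrite eq_complex /=; apply/andP; split; apply/eqP; field.
Qed.

End PeriodicSolutions.

(** * Eigenvalues and the resolvent set *)

Section Spectrum.
Context {R : realType}.
Notation mu := (@lebesgue_measure R).
Variables (L s m : R) (V : R -> R).
Hypotheses (L0 : 0 < L) (s0 : 0 < s) (cV : continuous V).
Hypotheses (Vm : forall x, `|V x| <= m) (pV : periodic V L).
Implicit Types (a b x : R) (u v w k F : R -> R) (f g h : R -> R[i]) (Y : 'I_4 -> R -> R).

Notation A := (schrodinger L s V).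
Notation i0 := (@Ordinal 4 0 isT).
Notation i1 := (@Ordinal 4 1 isT).
Notation i2 := (@Ordinal 4 2 isT).
Notation i3 := (@Ordinal 4 3 isT).

Notation psys a b := (ode_at (coef s V a b) (fun _ _ => 0)).

Lemma forcing_zero v : (forall x, v x = 0) -> forcing L s v = fun=> 0.
Proof.
move=> v0; apply/funext => x; have /andP[c0 _] := clamp_itv L0 x.
by rewrite /forcing (@ip_eq _ _ (fun=> 0)) // ip_cst // mul0r oppr0 mul0r.
Qed.

Lemma vec4_zero (T : Type) (t : T) : vec4 t t t t = fun=> t.
Proof. by apply/funext; apply: ord4P. Qed.

Lemma periodic_eigen a b Y : (forall x, psys a b Y x) -> (forall i, Y i L = Y i 0) ->
  let f := fun x => (Y i0 (frac L x) +i* Y i1 (frac L x))%C in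
  A f (fun x => (a +i* b)%C * f x).
Proof.
move=> HY YL f; pose h (_ : R) : R[i] := 0.
have Lh : L2per L h by apply/L2perP; split; exact: L2real0.
have Er : forcing L s (re_part h) = fun=> 0 by apply: forcing_zero.
have Ei : forcing L s (im_part h) = fun=> 0 by apply: forcing_zero.
have := @ode_schrodinger R L s V L0 s0 cV pV a b h Y Lh; rewrite Er ?Ei !oppr0 !vec4_zero.
have YL' i : Y i L = Y i 0 + 0 by rewrite YL addr0.
move=> /(_ HY YL').
by congr (A _ _); apply/funext => x; rewrite /h add0r.
Qed.

Lemma eigen_ode a b f : A f (fun x => (a +i* b)%C * f x) ->
  exists Y, [/\ forall i, continuous (Y i),
    forall x, 0 <= x <= L -> psys a b Y x, forall i, Y i L = Y i 0 &
    {ae mu, forall x, 0 <= x <= L -> re_part f x = Y i0 x /\ im_part f x = Y i1 x}].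
Proof.
move=> /(schrodinger_ode L0 s0 cV a b)[Y]; rewrite /= !forcing_zero; last 2 first.
- by move=> x; rewrite /im_part subrr.
- by move=> x; rewrite /re_part subrr.
rewrite oppr0 !vec4_zero => -[cY HY YL fE]; exists Y; split => // i.
by rewrite YL addr0.
Qed.

Lemma cont_ae0 w : continuous w -> {ae mu, forall x, 0 <= x <= L -> w x = 0} ->
  forall x, 0 < x < L -> w x = 0.
Proof.
move=> cw w0 x /andP[x0 xL].
apply: (der_uniq (f := prim w) (x := x) (prim_der x cw)).
apply: (der_near _ (derC x 0)); near=> t.
have t0 : 0 < t by near: t; exact: lt_nbhsr.
have tL : t < L by near: t; exact: lt_nbhsl.
have i0 : intg L (fun=> 0) by apply: intg_cont => y; exact: contC.
rewrite -ip_prim ?(ltW t0) // (ip_ae_eq (intg_cont L cw) i0 (ltW tL) w0).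
by rewrite ip_cst ?mul0r // ltW.
Unshelve. all: by end_near. Qed.

Lemma der_vanish F d x : has_der x F d -> (forall y, 0 < y < L -> F y = 0) -> 0 < x < L -> d = 0.
Proof.
move=> dF F0 /andP[x0 xL]; apply: (der_uniq dF).
apply: (der_near _ (derC x 0)); near=> t.
by rewrite F0 //; apply/andP; split; near: t; [exact: lt_nbhsr|exact: lt_nbhsl].
Unshelve. all: by end_near. Qed.

Lemma ode_zero a b Y : (forall i, continuous (Y i)) -> (forall x, 0 <= x <= L -> psys a b Y x) ->
  (forall x, 0 < x < L -> Y i0 x = 0) -> (forall x, 0 < x < L -> Y i1 x = 0) ->
  forall i, Y i 0 = 0.
Proof.
move=> cY HY Y0 Y1.
have HY' x : 0 < x < L -> has_der x (Y i0) (Y i2 x) /\ has_der x (Y i1) (Y i3 x).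
  move=> /andP[x0 xL]; have := HY x; rewrite (ltW x0) (ltW xL) => /(_ isT).
  rewrite -(vec4_zero (fun _ : R => 0 : R)) => /ode4E; rewrite !addr0.
  by case.
have Y2 x : 0 < x < L -> Y i2 x = 0.
  by move=> xL; have [h _] := HY' x xL; exact: der_vanish h Y0 xL.
have Y3 x : 0 < x < L -> Y i3 x = 0.
  by move=> xL; have [_ h] := HY' x xL; exact: der_vanish h Y1 xL.
by apply: ord4P; [exact: (cont_eq0_right L0 (@cY i0 0) Y0)|exact: (cont_eq0_right L0 (@cY i1 0) Y1)
  |exact: (cont_eq0_right L0 (@cY i2 0) Y2)|exact: (cont_eq0_right L0 (@cY i3 0) Y3)].
Qed.

Lemma ae_zero_parts f Y : {ae mu, forall x, 0 <= x <= L -> re_part f x = Y i0 x /\ im_part f x = Y i1 x} ->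
  periodic f L -> (forall x, 0 < x < L -> Y i0 x = 0) -> (forall x, 0 < x < L -> Y i1 x = 0) ->
  ae_equal f (fun=> 0).
Proof.
move=> fE pf Y0 Y1.
have n0 : {ae mu, forall x, x != 0 :> R}.
  exists [set 0]; split => //; first exact: lebesgue_measure_set1.
  by move=> x /= /negP; rewrite negbK => /eqP.
have nL : {ae mu, forall x, x != L :> R}.
  exists [set L]; split => //; first exact: lebesgue_measure_set1.
  by move=> x /= /negP; rewrite negbK => /eqP.
apply: (ae_periodic L0 (P := fun x => f x = 0)); first by move=> x; rewrite pf.
apply: ae_imp (ae_and fE (ae_and n0 nL)) => x [h [x0 xL]] xI.
have [] := h xI; have xI' : 0 < x < L.
  by case/andP: xI => h1 h2; rewrite !lt_neqAle eq_sym x0 h1 xL.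
rewrite Y0 // Y1 // /re_part /im_part; case: (f x) => fr fi /= -> ->; exact: erefl.
Qed.

Lemma eigenvalue_real (z : R[i]) : eigenvalue_of A z -> exists a, z = a%:C%C.
Proof.
case: z => a b [f [Af nf]]; exists a; have [->//|b0] := eqVneq b 0; exfalso; apply: nf.
have [Y [cY HY YL fE]] := eigen_ode Af.
pose Q x := Y i0 x ^+ 2 + Y i1 x ^+ 2.
have Q0 x : 0 <= Q x by rewrite addr_ge0 ?sqr_ge0.
have cQ : continuous Q.
  by move=> x; rewrite /Q; exact: (contD (contXn (n := 2) (@cY i0 x)) (contXn (n := 2) (@cY i1 x))).
pose W x := Y i0 x * Y i3 x - Y i1 x * Y i2 x.
(* The derivative of [W] is - (b / s) |f|^2. As [W] is periodic, |f|^2 integrates to 0 when b is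
   nonzero. *)
have dW x : 0 <= x <= L -> has_der x (fun x => W x + b / s * prim Q x) 0.
  move=> xL; have := HY x xL; rewrite -(vec4_zero (fun _ : R => 0 : R)) => /ode4E[d0 d1 d2 d3].
  rewrite /W; apply: (der_eq (derD (derD (derM d0 d3) (derN (derM d1 d2))) (derM (derC x (b / s)) (prim_der x cQ)))).
  rewrite /Q; field; exact: lt0r_neq0.
have [L1 L2] : L <= L /\ 0 <= L by split; [exact: lexx|exact: ltW].
have PL : prim Q L = 0.
  have := der0_cst L2 dW; rewrite /W !YL prim0 mulr0 addr0 => /eqP.
  rewrite eq_sym -subr_eq0 addrC addKr.
  by rewrite !mulf_eq0 invr_eq0 (negbTE b0) gt_eqF //= => /eqP.
have iQ : intg L Q := intg_cont L cQ.
have PQ x : 0 < x < L -> prim Q x = 0.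
  move=> /andP[x0 xL]; apply/eqP; rewrite eq_le -ip_prim ?(ltW x0) //; apply/andP; split.
    by rewrite -PL -ip_prim //; apply: ip_mono => //; rewrite !ltW.
  by apply: Rintegral_ge0 => t _.
have Qz x : 0 < x < L -> Q x = 0 by exact: der_vanish (prim_der x cQ) PQ.
have pf : periodic f L by case: Af => f1 [f2 [[[]]]].
apply: (ae_zero_parts fE pf) => x /Qz /eqP; rewrite paddr_eq0 ?sqr_ge0 // !sqrf_eq0.
  by move=> /andP[/eqP].
by move=> /andP[_ /eqP].
Qed.

(** The sup norm of the forcing is controlled by the L^1 norm, and by Cauchy-Schwarz the L^1 norm is
    at most sqrt L times the L^2 norm. *)
Lemma forcing_le u x (N : R) : L2real L u -> 0 <= N -> ip (fun x => u x ^+ 2) L <= N ^+ 2 ->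
  `|forcing L s u x| <= Num.sqrt L / s * N.
Proof.
move=> Lu N0 uN; have iu := L2real_intg Lu.
apply: (le_trans (forcing_bound L0 s0 x iu)).
rewrite mulrAC ler_pM2r ?invr_gt0 //.
have sL : 0 <= Num.sqrt L * N by rewrite mulr_ge0 ?sqrtr_ge0.
have I0 : 0 <= ip (fun t => `|u t|) L by apply: Rintegral_ge0 => t _.
rewrite -(@ler_pXn2r _ 2) ?nnegrE // exprMn sqr_sqrtr ?(ltW L0) //.
by apply: (le_trans (ip_abs_sqr L0 Lu)); rewrite ler_pM2l.
Qed.

Lemma L2norm_parts h : L2per L h ->
  ip (fun x => re_part h x ^+ 2) L <= L2norm L h ^+ 2 /\
  ip (fun x => im_part h x ^+ 2) L <= L2norm L h ^+ 2.
Proof.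
move=> /(L2perP _ _)[[_ _ ir] [_ _ ii]]; rewrite L2normE sqr_sqrtr; last first.
  by apply: Rintegral_ge0 => t _; rewrite addr_ge0 ?sqr_ge0.
by split; [apply: (ip_le ir (intgD ir ii) (lexx L)) => t _; rewrite lerDl
  |apply: (ip_le ii (intgD ir ii) (lexx L)) => t _; rewrite lerDr]; exact: sqr_ge0.
Qed.

Lemma L2norm_le f Y (B : R) : L2per L f -> (forall i, continuous (Y i)) ->
  {ae mu, forall x, 0 <= x <= L -> re_part f x = Y i0 x /\ im_part f x = Y i1 x} ->
  0 <= B -> (forall i x, 0 <= x <= L -> `|Y i x| <= B) -> L2norm L f <= Num.sqrt (2 * L) * B.
Proof.
move=> /(L2perP _ _)[[_ _ ir] [_ _ ii]] cY fE B0 YB.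
have cQ : continuous (fun x => Y i0 x ^+ 2 + Y i1 x ^+ 2).
  by move=> x; exact: (contD (contXn (n := 2) (@cY i0 x)) (contXn (n := 2) (@cY i1 x))).
have iB : intg L (fun=> 2 * B ^+ 2) by apply: intg_cont => x; exact: contC.
rewrite L2normE (ip_ae_eq (intgD ir ii) (intg_cont L cQ) (lexx L)); last first.
  by apply: ae_imp fE => x h /h[-> ->].
have -> : Num.sqrt (2 * L) * B = Num.sqrt (2 * B ^+ 2 * L).
  by rewrite [2 * B ^+ 2 * L]mulrAC [RHS]sqrtrM ?mulr_ge0 ?(ltW L0) // sqrtr_sqr ger0_norm.
rewrite ler_sqrt; last by rewrite ?mulr_ge0 ?(ltW L0) ?sqr_ge0.
rewrite -(ip_cst _ (ltW L0)); apply: (ip_le (intg_cont L cQ) iB (lexx L)) => t tL.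
have sq i : Y i t ^+ 2 <= B ^+ 2.
  by rewrite -(real_normK (num_real (Y i t))) ler_pXn2r ?nnegrE //; exact: YB.
by rewrite mulr_natl mulr2n; apply: lerD.
Qed.

Lemma resolvent_or_eigenvalue (z : R[i]) : eigenvalue_of A z \/ resolvent_set L A z.
Proof.
case: z => a b; have [|nz] := pselect (eigenvalue_of A (a +i* b)%C); [by left|right].
have cb := coef_bound s0 Vm a b.
have m0 := le_trans (normr_ge0 _) (cb i0 i0 0).
have cC i j : continuous (coef s V a b i j) by exact: coef_cont.
(* A periodic homogeneous solution yields an eigenfunction unless it vanishes almost everywhere;
   since z is not an eigenvalue it does vanish, and by continuity its initial values are 0. *)
have nonper Y : (forall x, psys a b Y x) -> (forall i, Y i L = Y i 0) -> forall i, Y i 0 = 0.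
  move=> HY YL; have Af := periodic_eigen HY YL; have cY i : continuous (Y i).
    by move=> x; exact: der_cont (HY x i).
  set f := (fun x => _) in Af.
  have f0 : ae_equal f (fun=> 0) by apply: contrapT => nf; apply: nz; exists f.
  have Y0 : {ae mu, forall x, 0 <= x <= L -> Y i0 x = 0}.
    by apply: ae_imp f0 => x fx xL; move: fx; rewrite /f frac_closed // => -[].
  have Y1 : {ae mu, forall x, 0 <= x <= L -> Y i1 x = 0}.
    by apply: ae_imp f0 => x fx xL; move: fx; rewrite /f (frac_closed L0 (YL i1)) // => -[].
  exact: (ode_zero cY (fun x _ => HY x) (cont_ae0 (@cY i0) Y0) (cont_ae0 (@cY i1) Y1)).
have [ex [C C0 bd]] := ode_fredholm cb cC m0 (ltW L0) nonper.
have sL0 : 0 <= Num.sqrt L / s by rewrite divr_ge0 ?sqrtr_ge0 // ltW.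
split.
(* Three factors: sqrt L / s from the L^2 norm of h to the sup norm of the data, C from there to the
   sup norm of the solution, and sqrt(2 L) back to the L^2 norm of its two first components. *)
- exists (Num.sqrt (2 * L) * (C * (Num.sqrt L / s))) => f g Afg.
  have [Lf Lg] : L2per L f /\ L2per L g by case: Afg => f1 [f2 [[]]] ? ? ? ? ? [].
  have [_ _ Lh] := L2per_comb a b Lf Lg.
  have [Y [cY HY YL fE]] := schrodinger_ode L0 s0 cV a b Afg.
  set h := (fun x => g x - _) in Lh HY YL *.
  have N0 : 0 <= L2norm L h by exact: sqrtr_ge0.
  have [Nr Ni] := L2norm_parts Lh; have [Lhr Lhi] := (L2perP _ _).1 Lh.
  have B0 : 0 <= Num.sqrt L / s * L2norm L h by rewrite mulr_ge0.
  have YB := bd _ _ _ _ B0 HY YL.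
  rewrite (_ : _ * L2norm L h = Num.sqrt (2 * L) * (C * (Num.sqrt L / s * L2norm L h))); last by rewrite !mulrA.
  apply: (L2norm_le Lf cY fE); first by rewrite mulr_ge0.
  apply: YB; last by apply: ord4P; rewrite /vec4 /= ?normr0 // normrN; exact: forcing_le.
  by apply: ord4P => x _; rewrite /vec4 /= ?normr0 //; exact: forcing_le.
move=> h Lh; have [Nr Ni] := L2norm_parts Lh; have [Lhr Lhi] := (L2perP _ _).1 Lh.
have N0 : 0 <= L2norm L h by exact: sqrtr_ge0.
pose bb := vec4 (forcing L s (re_part h)) (forcing L s (im_part h)) (fun=> 0) (fun=> 0).
have cbb i : continuous (bb i).
  move: i; apply: ord4P; rewrite /bb /vec4 /=; try exact: cst_continuous;
  by apply: forcing_cont => //; exact: L2real_intg.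
have [|Z [HZ ZL]] := ex bb (Num.sqrt L / s * L2norm L h)
  (vec4 0 0 (- forcing L s (re_part h) L) (- forcing L s (im_part h) L)) cbb.
  have B0 : 0 <= Num.sqrt L / s * L2norm L h by rewrite mulr_ge0.
  by apply: ord4P => x; rewrite /bb /vec4 /= ?normr0 //; exact: forcing_le.
exists (fun x => (Z i0 (frac L x) +i* Z i1 (frac L x))%C).
have Af := ode_schrodinger L0 s0 cV pV Lh HZ ZL.
eexists; split; first exact: Af.
by apply: aeW => x; rewrite addrK.
Qed.

Lemma eigen_sol2 (lam : R) f : A f (fun x => lam%:C%C * f x) -> exists y y1 w w1,
  [/\ sol2 (fun x => (V x - lam) / s) L y y1 /\ sol2 (fun x => (V x - lam) / s) L w w1,
      y L = y 0 /\ y1 L = y1 0, w L = w 0 /\ w1 L = w1 0 &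
      {ae mu, forall x, 0 <= x <= L -> f x = (y x +i* w x)%C}].
Proof.
move=> /(eigen_ode (a := lam) (b := 0))[Y [cY HY YL fE]].
exists (Y i0), (Y i2), (Y i1), (Y i3); split; rewrite ?YL //; last first.
  by apply: ae_imp fE => x h /h; rewrite /re_part /im_part; case: (f x) => ? ? /= [-> ->].
by split=> x /HY; rewrite -(vec4_zero (fun _ : R => 0 : R)) => /ode4E;
  rewrite !addr0 => -[d0 d1 d2 d3]; split => //; [apply: (der_eq d2)|apply: (der_eq d3)]; ring.
Qed.

Lemma sol2_eigen (lam : R) (y y1 : R -> R) :
  (forall x, has_der x y (y1 x) /\ has_der x y1 ((V x - lam) / s * y x)) ->
  y L = y 0 -> y1 L = y1 0 ->
  A (fun x => (y (frac L x))%:C%C) (fun x => lam%:C%C * (y (frac L x))%:C%C).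
Proof.
move=> Hy yL y1L; pose Y := vec4 y (fun=> 0) y1 (fun _ : R => 0 : R).
apply: (@periodic_eigen lam 0 Y); last by apply: ord4P.
move=> x; rewrite -(vec4_zero (fun _ : R => 0 : R)); apply/ode4E; rewrite /Y /vec4 /=.
have [d0 d1] := Hy x; split.
- by apply: (der_eq d0); rewrite addr0.
- by apply: (der_eq (derC x 0)); rewrite addr0.
- by apply: (der_eq d1); ring.
- by apply: (der_eq (derC x 0)); ring.
Qed.

End Spectrum.

(** * Spectrum *)

Section SturmSpectrum.
Context {R : realType}.
Notation mu := (@lebesgue_measure R).
Variables (s l m : R) (V p p1 u u1 : R -> R).
Hypothesis H : sturm_pair s l m V p p1 u u1.
Hypothesis Vsym : forall x, V (2 * l - x) = V x.
Hypothesis pV : periodic V (2 * l).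
Hypothesis pp : periodic p (2 * l).

Notation A := (schrodinger (2 * l) s V).

Let s0 := sturm_s H.
Let l0 := sturm_l H.
Let cV := sturm_cont H.
Let L0 : 0 < 2 * l. Proof. by rewrite mulr_gt0 // l0. Qed.

Lemma ae_periodic_eq (f g : R -> R[i]) : periodic f (2 * l) -> periodic g (2 * l) ->
  {ae mu, forall x, 0 <= x <= 2 * l -> f x = g x} -> ae_equal f g.
Proof.
move=> pf pg fg; apply: (ae_periodic L0 (P := fun x => f x = g x)) fg.
by move=> x; rewrite pf pg.
Qed.

Lemma schrodinger_periodic (f g : R -> R[i]) : A f g -> periodic f (2 * l).
Proof. by move=> [f1 [f2 [[[]]]]]. Qed.

Lemma eigen_psol (lam : R) f : A f (fun x => lam%:C%C * f x) -> exists y y1 w w1,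
  [/\ psol s l V lam y y1, psol s l V lam w w1 &
      {ae mu, forall x, 0 <= x <= 2 * l -> f x = (y x +i* w x)%C}].
Proof.
move=> /(eigen_sol2 L0 s0 cV)[y [y1 [w [w1 [[Hy Hw] [yL y1L] [wL w1L] fE]]]]].
by exists y, y1, w, w1; split.
Qed.

Lemma eigenvalue_type (lam : R) : eigenvalue_of A lam%:C%C ->
  neumann_type s l V lam \/ dirichlet_type s l V lam.
Proof.
move=> [f [Af nf]]; have [y [y1 [w [w1 [Hy Hw fE]]]]] := eigen_psol Af.
have [[x xL yx]|y0] := pselect (exists2 x, 0 <= x <= 2 * l & y x != 0).
  by apply: (psol_type H Vsym Hy); exists x.
have [[x xL wx]|w0] := pselect (exists2 x, 0 <= x <= 2 * l & w x != 0).
  by apply: (psol_type H Vsym Hw); exists x.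
exfalso; apply: nf; apply: ae_periodic_eq => //; first exact: schrodinger_periodic Af.
apply: ae_imp fE => x h xL; rewrite (h xL).
have -> : y x = 0 by apply/eqP; apply: contrapT => /negP yx; apply: y0; exists x.
by have -> : w x = 0 by apply/eqP; apply: contrapT => /negP wx; apply: w0; exists x.
Qed.

Lemma ground_state : exists lam : R, [/\ lam < 0, neumann_type s l V lam &
  simple_eigenvalue A lam%:C%C].
Proof.
have [lam lam0 [y [y1 [y0 y10 y1l Hy]]]] := neumann_exists H.
have py := neumann_psol H Vsym Hy y10 y1l; have [Sy yL y1L] := py.
have nt := psol_neumann H Vsym py; rewrite y0 oner_neq0 in nt.
exists lam; split => //; first exact: nt.
have cy : continuous y by move=> x; have [h _] := Hy x; exact: der_cont h.
exists (fun x => (y (frac (2 * l) x))%:C%C); split; first split.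
- exact: (sol2_eigen L0 s0 cV pV Hy).
- move=> f0; have y00 : {ae mu, forall x, 0 <= x <= 2 * l -> y x = 0}.
    by apply: ae_imp f0 => x; rewrite /= => fx xL; move: fx; rewrite frac_closed // => -[].
  have := cont_eq0_right L0 (cy 0) (cont_ae0 cy y00).
  by move/eqP; rewrite y0 oner_eq0.
move=> g Ag; have [z [z1 [w [w1 [Hz Hw gE]]]]] := eigen_psol Ag.
(* For negative lam the slope at 0 vanishes by [psol_neg], so the value at 0 determines the
   solution. *)
have multiple f f1 x : psol s l V lam f f1 -> 0 <= x <= 2 * l -> f x = f 0 * y x.
  move=> pf xL; have f10 := psol_neg H Vsym lam0 pf; have [Sf _ _] := pf.
  have e0 : f 0 = f 0 * y 0 + 0 * y 0 by rewrite y0 mulr1 mul0r addr0.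
  have e1 : f1 0 = f 0 * y1 0 + 0 * y1 0 by rewrite f10 y10 !mulr0 addr0.
  by have [-> _] := sturm_uniq H Sf (sol2_comb (f 0) 0 Sy Sy) e0 e1 xL; rewrite mul0r addr0.
exists (z 0 +i* w 0)%C; apply: ae_periodic_eq.
- exact: schrodinger_periodic Ag.
- by move=> x; rewrite frac_periodic.
apply: ae_imp gE => x h xL; rewrite (h xL) frac_closed // (multiple _ _ _ Hz xL) (multiple _ _ _ Hw xL).
by apply/eqP; rewrite eq_complex /=; apply/andP; split; apply/eqP; ring.
Qed.

Lemma kernel_simple : simple_eigenvalue_with A 0 (fun x => (p x)%:C%C).
Proof.
have pf x : p (frac (2 * l) x) = p x by exact: periodic_frac.
have p1L : p1 (2 * l) = p1 0.
  have [d0 _] := sturm_p H 0; have [dL _] := sturm_p H (0 + 2 * l).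
  have /derChain/(_ dL) := derD (derX 0) (derC 0 (2 * l)).
  rewrite addr0 mulr1 add0r (_ : (fun _ => _) = p); last by apply/funext => x; rewrite pp.
  by move=> h; exact: der_uniq h d0.
have p2L : p (2 * l) = p 0 by rewrite -[X in p X]add0r pp.
have Hp x : has_der x p (p1 x) /\ has_der x p1 ((V x - 0) / s * p x).
  by rewrite subr0; exact: sturm_p H x.
split; first split.
- have := sol2_eigen L0 s0 cV pV Hp p2L p1L.
  have -> : (fun x => (p (frac (2 * l) x))%:C%C) = (fun x => (p x)%:C%C).
    by apply/funext => x; rewrite pf.
  by congr (A _ _); apply/funext => x; rewrite pf.
- have cp : continuous p by move=> x; have [h _] := Hp x; exact: der_cont h.
  move=> f0; have p00 : {ae mu, forall x, 0 <= x <= 2 * l -> p x = 0}.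
    by apply: ae_imp f0 => x + _ => -[].
  have l2 : 0 < l / 2 < l by have := l0; lra.
  have l2' : 0 < l / 2 < 2 * l by have := l0; lra.
  by have := sturm_p_lt0 H l2; rewrite (cont_ae0 cp p00 l2') ltxx.
move=> g; rewrite (_ : (fun x => 0 * g x) = (fun x => 0%:C%C * g x)); last first.
  by apply/funext => x; rewrite rmorph0.
move=> Ag; have [z [z1 [w [w1 [Hz Hw gE]]]]] := eigen_psol Ag.
exists (z1 0 / p1 0 +i* (w1 0 / p1 0))%C; apply: ae_periodic_eq.
- exact: schrodinger_periodic Ag.
- by move=> x; rewrite pp.
apply: ae_imp gE => x h xL; rewrite (h xL) (psol_zero H Vsym Hz xL) (psol_zero H Vsym Hw xL).
by apply/eqP; rewrite eq_complex /=; apply/andP; split; apply/eqP; ring.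
Qed.

(** Near a limit point there would be three distinct eigenvalues, picked ever closer to it so that
    they differ; two of them have the same type, contradicting [type_separation]. *)
Lemma eigenvalues_isolated (E : set R[i]) (t : R[i]) :
  (forall z, E z -> eigenvalue_of A z) -> ~ limit_point (E : set R[i]^o) t.
Proof.
move=> EA lt_.
have [eps eps0 sep] := type_separation H (`|complex.Re t| + 1).
pose r := Num.min (eps / 2) 1.
have r0 : 0 < r by rewrite lt_min ltr01 divr_gt0.
have close (e : R[i]) : 0 < e -> exists z, [/\ E z, z != t & `|t - z| < e].
  move=> e0; have [z [zt Ez Uz]] := lt_ _ (nbhsx_ballx (t : R[i]^o) e e0).
  by exists z; split.
have rC : 0 < r%:C%C by rewrite ltcR.
have [z1 [E1 t1 d1]] := close _ rC.
have [z2 [E2 t2 d2]] : exists z, [/\ E z, z != t & `|t - z| < `|t - z1|].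
  by apply: close; rewrite normr_gt0 subr_eq0 eq_sym.
have [z3 [E3 t3 d3]] : exists z, [/\ E z, z != t & `|t - z| < `|t - z2|].
  by apply: close; rewrite normr_gt0 subr_eq0 eq_sym.
(* The point t may be nonreal, but eigenvalues are real, and their distance to the real part of t is
   at most their distance to t. *)
have near z : E z -> `|t - z| < r%:C%C -> exists a : R, [/\ z = a%:C%C, `|a| <= `|complex.Re t| + 1,
    `|complex.Re t - a| < eps / 2 & neumann_type s l V a \/ dirichlet_type s l V a].
  move=> Ez zr; have [a az] := eigenvalue_real L0 s0 cV (EA _ Ez).
  have ar : `|complex.Re t - a| < r.
    rewrite -ltcR (le_lt_trans _ zr) // (le_trans _ (normc_ge_Re _)) // az.
    by case: (t).
  exists a; split => //.
  - rewrite -[a](subKr (complex.Re t)) (le_trans (ler_normB _ _)) // lerD2l (le_trans (ltW ar)) //.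
    by rewrite ge_min lexx orbT.
  - by rewrite (lt_le_trans ar) // ge_min lexx.
  - by apply: eigenvalue_type; rewrite -az; exact: EA.
have [a [az aL ae ta]] := near _ E1 d1.
have [b [bz bL be tb]] := near _ E2 (lt_trans d2 d1).
have [c [cz cL ce tc]] := near _ E3 (lt_trans d3 (lt_trans d2 d1)).
have dist x y : `|complex.Re t - x| < eps / 2 -> `|complex.Re t - y| < eps / 2 -> `|x - y| < eps.
  move=> h1 h2; rewrite (_ : x - y = (complex.Re t - y) - (complex.Re t - x)); last by ring.
  by rewrite (le_lt_trans (ler_normB _ _)) //; lra.
have ab : a != b by apply: contraTneq d2 => e; rewrite bz az e ltxx.
have bc : b != c by apply: contraTneq d3 => e; rewrite cz bz e ltxx.
have ac : a != c by apply: contraTneq (lt_trans d3 d2) => e; rewrite cz az e ltxx.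
have no x y : `|x| <= `|complex.Re t| + 1 -> `|y| <= `|complex.Re t| + 1 ->
    `|complex.Re t - x| < eps / 2 -> `|complex.Re t - y| < eps / 2 -> x != y ->
    neumann_type s l V x /\ neumann_type s l V y \/ dirichlet_type s l V x /\ dirichlet_type s l V y -> False.
  move=> xL yL xe ye xy ty; move/eqP: xy; apply; exact: sep (dist _ _ xe ye) ty.
have nab := no _ _ aL bL ae be ab; have nbc := no _ _ bL cL be ce bc.
have nac := no _ _ aL cL ae ce ac.
by move: ta tb tc => [ta|ta] [tb|tb] [tc|tc];
  by [apply: nab; left|apply: nab; right|apply: nbc; left|apply: nbc; right|apply: nac; left|apply: nac; right].
Qed.

Lemma sturm_spectrum : exists lam0 : R[i],
    (lam0 < 0 /\ simple_eigenvalue A lam0 /\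
     forall mu : R[i], mu < 0 -> eigenvalue_of A mu -> mu = lam0) /\
    simple_eigenvalue_with A 0 (fun x => (p x)%:C%C) /\
    (let rest : set R[i] := spectrum (2 * l) A `\` [set lam0; 0] in
     (forall z, rest z -> eigenvalue_of A z) /\
     limit_point (rest : set R[i]^o) = set0 /\
     exists2 d : R, 0 < d & forall z, rest z -> d%:C%C <= `|z|).
Proof.
have [lam [lam0 nlam slam]] := ground_state; exists lam%:C%C.
split; first split; first by rewrite ltcR.
  split=> // z z0 Ez; have [a az] := eigenvalue_real L0 s0 cV Ez.
  rewrite az; congr (_%:C)%C; rewrite az ltcR in z0 Ez.
  have [na|da] := eigenvalue_type Ez; first exact: (neumann_type_uniq H z0 lam0 na nlam).
  by have := dirichlet_type_nonneg H da; rewrite leNgt z0.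
split; first exact: kernel_simple.
move=> rest; have restE z : rest z -> eigenvalue_of A z.
  by move=> [nz _]; have [//|] := resolvent_or_eigenvalue L0 s0 cV (sturm_bound H) pV z.
have iso := eigenvalues_isolated restE.
split => //; split; first by apply/seteqP; split => // t /iso.
(* The set [rest] neither contains 0 nor accumulates there, so it misses a ball around 0, whose
   radius is the bound [d]. The radius comes as a positive element of R[i] and is therefore real. *)
have /existsNP[U /not_implyP[U0 nU]] := iso 0.
have /nbhs_ballP[e /= e0 eU] := U0.
have [d de] : exists d : R, e = d%:C%C.
  by exists (complex.Re e); apply/eqP; rewrite eq_complex /= eqxx; move: e0; rewrite ltcE /= => /andP[/eqP ->].
exists d; first by rewrite -ltcR -de.
move=> z rz; rewrite -de real_leNgt ?normr_real ?gtr0_real //; apply/negP => ze.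
apply: nU; exists z; split => //.
  by case: rz => _ /= h; apply/eqP => z0; apply: h; right.
by apply: eU; rewrite /ball /= sub0r normrN.
Qed.

End SturmSpectrum.

(** * The wave provides the Sturm data *)

Section WaveSpectrum.
Context {R : realType}.
Variables (s r x3 a l : R) (phi p : R -> R).
Hypothesis W : wave s r x3 a l phi p.

Lemma wave_sturm : exists m p1 u u1, sturm_pair s l m (potential r phi) p p1 u u1.
Proof.
have [u [u1 [du du1 [u0 u10] [ul u1l]]]] := wave_second W.
have s0 := wave_s W; have x30 := wave_x3 W; have x3a := wave_a W; have rE := wave_r W.
exists (`|r| + 3 * a + 5 * a ^+ 2), (fun x => (r * phi x - phi x ^+ 3 - phi x ^+ 5) / s), u, u1.
have p1E x : r * phi x - phi x ^+ 3 - phi x ^+ 5 = phi x * (r - phi x ^+ 2 - (phi x ^+ 2) ^+ 2) by ring.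
have ne x : r - phi x ^+ 2 - (phi x ^+ 2) ^+ 2 != 0 -> (r * phi x - phi x ^+ 3 - phi x ^+ 5) / s != 0.
  move=> h; rewrite p1E; apply: mulf_neq0; last by rewrite invr_eq0 gt_eqF.
  by apply: mulf_neq0; rewrite // gt_eqF // (wave_gt0 W).
have cphi : continuous phi by move=> x; exact: der_cont (wave_der W x).
split => //; rewrite ?(wave_l W) ?(wave_p0 W) ?(wave_pl W) //.
- move=> x; rewrite /potential.
  exact: (contB (contB (@contC R r x) (contM (@contC R 3 x) (contXn (n := 2) (@cphi x))))
    (contM (@contC R 5 x) (contXn (n := 4) (@cphi x)))).
- move=> x; rewrite /potential.
  have h1 := wave_le W x; have h0 := sqr_ge0 (phi x).
  have -> : phi x ^+ 4 = (phi x ^+ 2) ^+ 2 by ring.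
  have h2 : (phi x ^+ 2) ^+ 2 <= a ^+ 2 by rewrite ler_pXn2r ?nnegrE // (le_trans h0).
  have h3 := sqr_ge0 (phi x ^+ 2).
  have h4 := ler_norm r; have h5 := ler_norm (- r); rewrite normrN in h5.
  by rewrite ler_norml; apply/andP; split; lra.
- by move=> x; split; [exact: wave_eq W x|exact: wave_p_der W x].
- exact: wave_p_lt0 W.
(* With d = a - x3: r - a - a^2 = - d (3 + 6 x3 + 4 d) / 6 at the maximum, and r - x3 - x3^2 = d (3
   + 6 x3 + 2 d) / 6 at the minimum. *)
- by apply: ne; rewrite (wave_phi0 W) lt_eqF //; nra.
- by apply: ne; rewrite (wave_phil W) gt_eqF //; nra.
Qed.

Lemma wave_p_periodic : periodic p (2 * l).
Proof.
move=> x; have /derChain/(_ (wave_der W (x + 2 * l))) := derD (derX x) (derC x (2 * l)).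
rewrite addr0 mulr1 (_ : (fun _ => _) = phi); last by apply/funext => y; rewrite (wave_per W).
by move=> h; exact: der_uniq h (wave_der W x).
Qed.

Lemma potential_periodic : periodic (potential r phi) (2 * l).
Proof. by move=> x; rewrite /potential (wave_per W). Qed.

Lemma potential_reflect x : potential r phi (2 * l - x) = potential r phi x.
Proof. by rewrite /potential [2 * l - x]addrC (wave_per W) (wave_even W). Qed.

End WaveSpectrum.

(** The radicand is 5 minus a nonnegative quotient, and it is positive because its root exceeds 2 c;
    hence 4 c^2 < 5. *)
Lemma speed_bound {R : realType} (L c : R) : 0 < c ->
  c < 2^-1 * Num.sqrt (5 - L ^+ 4 / (L ^+ 2 - 4 * pi ^+ 2) ^+ 2) -> 0 < sc c.
Proof.
move=> c0; set q := _ / _; set S := Num.sqrt _ => cS.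
have q0 : 0 <= q by rewrite divr_ge0 // ?sqr_ge0 // (exprM L 2 2) sqr_ge0.
have S0 : 0 < S by lra.
have S2 : S ^+ 2 = 5 - q by rewrite sqr_sqrtr // ltW // -sqrtr_gt0.
rewrite /sc; nra.
Qed.

Local Open Scope complex_scope.
Local Open Scope ring_scope.

Theorem lemma4p3 (R : realType) (L c alpha4 : R)
  (hL : 2 * pi * Num.sqrt (Num.sqrt 5 / (Num.sqrt 5 - 1)) < L)
  (hc0 : 0 < c)
  (hc1 : c < 2^-1 * Num.sqrt (5 - L ^+ 4 / (L ^+ 2 - 4 * pi ^+ 2) ^+ 2))
  (halpha4 : admissible c alpha4)
  (hT : wave_period c alpha4 = L) :
  let phi : R -> R := dnoidal c alpha4 in
  let A : op_graph := L1op L c phi in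
  exists lam0 : R[i],
    (lam0 < 0 /\ simple_eigenvalue A lam0 /\
     forall mu : R[i], mu < 0 -> eigenvalue_of A mu -> mu = lam0) /\
    simple_eigenvalue_with A 0 (fun x => (derive1 phi x)%:C) /\
    (let rest : set R[i] := spectrum L A `\` [set lam0; 0] in
     (forall z, rest z -> eigenvalue_of A z) /\
     limit_point (rest : set R[i]^o) = set0 /\
     exists2 d : R, 0 < d & forall z, rest z -> d%:C <= `|z|).
Proof.
have [l lE] : exists l, L = 2 * l by exists (L / 2); field.
have W : wave (sc c) (rc c) (alpha3 c alpha4) alpha4 l (dnoidal c alpha4) (dnoidal' c alpha4).
  by apply: (dnoidal_wave (speed_bound hc0 hc1) halpha4); rewrite hT.
have [m [p1 [u [u1 H]]]] := wave_sturm W.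
move=> phi A.
have -> : (fun x => (derive1 phi x)%:C%C) = (fun x => (dnoidal' c alpha4 x)%:C%C).
  by apply/funext => x; rewrite (der_derive1 (wave_der W x)).
have := sturm_spectrum H (potential_reflect W) (potential_periodic W) (wave_p_periodic W).
by rewrite -lE.
Qed.
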